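(* Let $n\ge 3$ and $m=n-2$. For $K_n$ and for every successive coordinate descent of $K_n$ (for every prefix and every choice of the fixed values), the generic monodromy group acting on the $nm$ sheets $(t_i,\zeta a_i)$ is $$G_n=\begin{cases}\mu_m^n\rtimes S_n,& n\text{ odd},\\[2pt] \bigl\{(\zeta_1,\ldots,\zeta_n;\sigma)\in\mu_m^n\rtimes S_n:\ (\prod_i\zeta_i)^{m/2}=\operatorname{sgn}(\sigma)\bigr\},& n\text{ even},\end{cases}$$ where $(\zeta_1,\ldots,\zeta_n;\sigma)$ acts by $t_i\mapsto t_{\sigma(i)}$, $a_i\mapsto\zeta_i a_{\sigma(i)}$. In particular $|G_n|=m^n\,n!/\gcd(2,m)$.
   Context: All varieties are over $\mathbb C$; $\mu_m\subset\mathbb C^*$ is the group of $m$-th roots of unity. Definition of $K_n$. For $n\ge 3$ use coordinates $(x,y,z_3,\ldots,z_n)$ on $\mathbb A^n$, put $p=1+xy$, and let $$\Phi_n(T)=(1-yT)^{n-1}(pT-x)+(pT-x)^2\Bigl[ny\bigl(yT+\tfrac12\bigr)+z_3\bigl(pT+\tfrac x2\bigr)+\sum_{j=4}^n z_jT^{j-2}\Bigr]$$ (the sum is empty for $n=3$). Its coefficient of $T$ equals $1$. Write $\Phi_n(T)=\sum_{j=3}^n C_jT^j+A_2T^2+T-A_0$ and $K_n=(C_3,\ldots,C_n,A_2,A_0):\mathbb A^n\to\mathbb A^n$. A target point is identified with the polynomial $$P(T)=qT^n+rT^{n-1}+\sum_{j=2}^{n-2}\lambda_jT^j+T-b,$$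 where for $n\ge4$: $q=C_n$, $r=C_{n-1}$, $\lambda_j=C_j$ ($3\le j\le n-2$), $\lambda_2=A_2$, $b=A_0$; for $n=3$ the sum is empty and $(r,q,b)=(A_2,C_3,A_0)$. Successive coordinate descents. For $n\ge4$ fix a prefix $\lambda_2,\ldots,\lambda_k$ of the lower coefficients $\lambda_2,\ldots,\lambda_{n-2}$ to complex values and keep the remaining lower coefficients and $r,q,b$ free; the descent is the restriction of $K_n$ to the locus in $\mathbb A^n$ where these coefficients take the fixed values. This locus is isomorphic to an affine space $\mathbb A^d$ with $3\le d\le n$, and the descent is a polynomial map $\mathbb A^d\to\mathbb A^d$ whose target coordinates are the free coefficients; it has geometric degree $nm$. The empty prefix gives $K_n$ up to a permutation of outputs. Generic monodromy and sheets. The generic monodromy of a dominant generically finite map is the Galois group of the normal closure of the source function field over the target function field, acting on the embeddings of the source field. Here, if $k$ is the target function field and $P\in k[T]$ the generic target polynomial, the source function field is $k(t,a)$ with $t=x/p$, $a=1/p$, which satisfy $P(t)=0$ and $a^m=P'(t)$. If $t_1,\ldots,t_n$ are the roots of $P$ and $a_i$ is a chosen $m$-th root of $P'(t_i)$, the $nm$ sheets are the pairs $(t_i,\zeta a_i)$ with $1\le i\le n$, $\zeta\in\mu_m$. *)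

(* Defs.v *)
From mathcomp Require Import all_boot all_order all_algebra all_fingroup all_field.
From mathcomp Require Import reals complex.
From mathcomp Require Import mpoly.

Set Implicit Arguments.
Unset Strict Implicit.
Unset Printing Implicit Defensive.

Import GRing.Theory Num.Theory.
Local Open Scope ring_scope.

(* The complex numbers are R[i], for R : realType. *)

Section PolynomialMap.
Variables (R : realType) (n : nat).

(* The coordinates (x, y, z_3, ..., z_n) of A^n are the variables of index
   0, 1, 2, ..., n-1; the default value 0 is never reached when 3 <= n. *)
Definition coord (j : nat) : {mpoly R[i][n]} :=
  if insub j is Some i then 'X_(i : 'I_n) else 0.

Definition xvar := coord 0.
Definition yvar := coord 1.
Definition zvar (j : nat) := coord j.-1.
Definition pvar : {mpoly R[i][n]} := 1 + xvar * yvar.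

Definition half : {mpoly R[i][n]} := (2^-1 : R[i])%:MP.

Definition Phi : {poly {mpoly R[i][n]}} :=
  (1 - yvar *: 'X) ^+ (n - 1)%N * (pvar *: 'X - xvar%:P)
  + (pvar *: 'X - xvar%:P) ^+ 2 *
    ((n%:R * yvar) *: (yvar *: 'X + half%:P)
     + zvar 3 *: (pvar *: 'X + (half * xvar)%:P)
     + \sum_(4 <= j < n.+1) zvar j *: 'X^(j - 2)%N).

(* The outputs of K_n are (C_3, ..., C_n, A_2, A_0), in this order: output i is,
   up to sign, the coefficient of T^(outdeg i). *)
Definition outdeg (i : 'I_n) : nat :=
  (if i < n - 2 then i + 3 else if i == n - 2 :> nat then 2 else 0)%N.

Definition outsign (A : pzRingType) (i : 'I_n) : A :=
  if outdeg i == 0%N then -1 else 1.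

Definition K (i : 'I_n) : {mpoly R[i][n]} :=
  outsign _ i * Phi`_(outdeg i).

(* The polynomial
     P(T) = w_(n-3) T^n + ... + w_0 T^3 + w_(n-2) T^2 + T - w_(n-1)
   identified with the target point w. *)
Definition target_poly (A : nzRingType) (w : 'I_n -> A) : {poly A} :=
  'X + \sum_i (outsign A i * w i) *: 'X^(outdeg i).

(* The prefix lambda_2, ..., lambda_k is fixed to the values c 2, ..., c k
   (lambda_j being the coefficient of T^j). It is empty when k < 2, and then
   the descent is K_n itself. *)
Definition target_locus (k : nat) (c : nat -> R[i]) (w : 'I_n -> R[i]) : Prop :=
  forall i, (2 <= outdeg i <= k)%N -> w i = c (outdeg i).

Definition source_locus (k : nat) (c : nat -> R[i]) (v : 'I_n -> R[i]) : Prop :=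
  target_locus k c (fun i => (K i).@[v]).

(* F, with the embedding iota of the constants and the coordinate functions u,
   is the function field of the irreducible closed subset V of A^n: the
   relations between the u_i are the polynomials vanishing on V, and the u_i
   generate F over the constants. *)
Definition is_function_field (V : ('I_n -> R[i]) -> Prop)
    (F : fieldType) (iota : R[i] -> F) (u : 'I_n -> F) : Prop :=
  (forall f : {mpoly R[i][n]},
     mmap iota u f = 0 <-> (forall v, V v -> f.@[v] = 0))
  /\ (forall e : F, exists f g : {mpoly R[i][n]},
     mmap iota u g != 0 /\ e = mmap iota u f / mmap iota u g).

End PolynomialMap.

(* N is normal over F since it is a splittingFieldType; the condition below says
   that L embeds in N and that no proper intermediate normal extension
   contains the image. *)
Definition is_normal_closure (F : fieldType) (L : fieldExtType F)
    (N : splittingFieldType F) : Prop :=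
  exists j : 'AHom(L, N), forall M : {subfield N},
    (limg j <= M)%VS -> normalField 1 M -> ({:N} <= M)%VS.

Section Sheets.
Variable R : realType.

Definition unity_roots (m : nat) : seq R[i] :=
  undup (sval (closed_field_poly_normal ('X^m - 1 : {poly R[i]}))).

Lemma mem_unity_roots (m : nat) (z : R[i]) :
  (0 < m)%N -> (z \in unity_roots m) = (z ^+ m == 1).
Proof.
move=> m0; rewrite mem_undup; case: closed_field_poly_normal => r /= e.
rewrite -root_prod_XsubC.
have -> : \prod_(x <- r) ('X - x%:P) = 'X^m - 1 :> {poly R[i]}.
  by rewrite [RHS]e (monicP _) ?scale1r // monicXnsubC.
by rewrite rootE !hornerE subr_eq0.
Qed.

(* mu_m, as a finite type (for 0 < m). *)
Definition mu (m : nat) : finType := seq_sub (unity_roots m).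

(* (i, xi) stands for the sheet (t_i, xi a_i). *)
Definition sheet (n : nat) : finType := ('I_n * mu (n - 2))%type.

(* pi is the action of (zeta; sigma), i.e. t_i |-> t_(sigma i) and
   a_i |-> zeta_i a_(sigma i), so that
   (t_i, xi a_i) |-> (t_(sigma i), xi zeta_i a_(sigma i)). *)
Definition acts_as (n : nat) (zeta : {ffun 'I_n -> mu (n - 2)}) (sigma : 'S_n)
    (pi : {perm sheet n}) : bool :=
  [forall s : sheet n, ((pi s).1 == sigma s.1)
     && (ssval (pi s).2 == ssval s.2 * ssval (zeta s.1))].

(* The condition (prod_i zeta_i)^(m/2) = sgn(sigma) is imposed for n even only. *)
Definition G (n : nat) : {set {perm sheet n}} :=
  [set pi : {perm sheet n} |
    [exists zeta : {ffun 'I_n -> mu (n - 2)}, exists sigma : 'S_n,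
      (odd n || ((\prod_i ssval (zeta i)) ^+ ((n - 2) %/ 2) == (-1) ^+ sigma))
      && acts_as zeta sigma pi]].

End Sheets.

(* t lists the roots of P in N with multiplicity, and a_i is an m-th root of
   P'(t_i). *)
Definition root_data (F : fieldType) (N : splittingFieldType F) (n m : nat)
    (P : {poly F}) (t a : 'I_n -> N) : Prop :=
  let PN := map_poly (in_alg N) P in
  PN = lead_coef PN *: \prod_i ('X - (t i)%:P)
  /\ forall i, a i ^+ m = (PN^`()).[t i].

(* Main.v *)
Require Import Defs.
From HB Require Import structures.
From mathcomp Require Import boolp.
From mathcomp Require Import all_boot all_order all_algebra all_fingroup.
From mathcomp Require Import all_solvable all_field.
From mathcomp Require Import generic_quotient reals complex.
From mathcomp Require Import mpoly.
From mathcomp Require Import zify ring.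

Set Implicit Arguments.
Unset Strict Implicit.
Unset Printing Implicit Defensive.

Import GRing.Theory Num.Theory.
Local Open Scope ring_scope.

(** Write [P = q T^n + r T^(n-1) + ... + T - b] for the generic target polynomial, over
    the target function field [F]. The source function field is [F(t, a)], where
    [t = x/p] is a root of [P] and [a = 1/p] satisfies [a^m = P'(t)] ([source_root],
    [source_deriv], [source_gen]). So the normal closure is generated by the roots [t_i]
    of [P] and by [m]-th roots [a_i] of the [P'(t_i)] ([normal_closure_gen]), and its
    automorphisms act by [t_i |-> t_(s i)], [a_i |-> zeta_i a_(s i)]: the monodromy group
    is a subgroup of the wreath product of [mu_m] by [S_n].

    It lies in [G_n]: for [n] even, the product of the [a_i^(m/2)] is, up to a constant,
    a power of [q] times the Vandermonde determinant of the roots, which a permutation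
    of the roots multiplies by its sign ([galois_parity]).

    It contains [G_n] because of its inertia elements. The coefficients [q], [r] and [b]
    are free in every descent. So for constants [q0 <> 0], [r0], [b0], the field [F]
    embeds in the Laurent series [F((u))] by adding [u^-K (q0, r0, b0 + u^E)] to
    [(q, r, b)] ([arc_phi_ex]); this turns [P] into [u^-K (M - u^E + u^K P)], where
    [M = q0 T^n + r0 T^(n-1) - b0] has constant coefficients. If [E] is divisible enough,
    Newton polygons and Hensel's lemma give, for each root [c] of [M] of multiplicity
    [e], exactly [e] roots [c + u^(E/e) Y] of [P], at which [P'] is an [m]-th power
    ([cluster_root], [arc_roots]). So the whole normal closure embeds in [F((u))], and
    the substitution [u |-> w u], with [w] a primitive [E]-th root of unity, fixes [F] and
    induces an automorphism [g] of it ([arc_galois]): [g] permutes cyclically the [e]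
    roots above [c], and [g^e] multiplies each of their [a_i] by [z^(e-1)], where [z] is a
    primitive [m]-th root of unity.

    Three choices of [M] suffice. With [M = T^n], the group is transitive on the roots,
    and [P] is irreducible. With [M = T^n - T^(n-1)], one root is fixed and the others are
    permuted transitively, whence double transitivity. With
    [M = (n-1) T^n - n T^(n-1) + 1], which has a double root and [n - 2] simple ones, [g]
    exchanges two roots and [g^2] multiplies their two radicals by [z], everything else
    being fixed. Such elements generate [G_n] ([wreath_full]). *)

(** * Formal power series *)

(** A record, so that the Cauchy product is the only product in sight. *)
Record fps (K : fieldType) := Fps { fcoef : nat -> K }.

Section PowerSeries.
Variable K : fieldType.
Implicit Types f g h : fps K.

Lemma fps_eqP f g : (forall n, fcoef f n = fcoef g n) -> f = g.
Proof. by case: f => f; case: g => g /= e; congr Fps; apply: funext. Qed.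

HB.instance Definition _ := gen_eqMixin (fps K).
HB.instance Definition _ := gen_choiceMixin (fps K).

Definition fps_add f g := Fps (fun n => fcoef f n + fcoef g n).
Definition fps_opp f := Fps (fun n => - fcoef f n).

Fact fps_addA : associative fps_add.
Proof. by move=> f g h; apply: fps_eqP => n /=; rewrite addrA. Qed.
Fact fps_addC : commutative fps_add.
Proof. by move=> f g; apply: fps_eqP => n /=; rewrite addrC. Qed.
Fact fps_add0 : left_id (Fps (fun=> 0)) fps_add.
Proof. by move=> f; apply: fps_eqP => n /=; rewrite add0r. Qed.
Fact fps_addN : left_inverse (Fps (fun=> 0)) fps_opp fps_add.
Proof. by move=> f; apply: fps_eqP => n /=; rewrite addNr. Qed.

HB.instance Definition _ :=
  GRing.isZmodule.Build (fps K) fps_addA fps_addC fps_add0 fps_addN.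

Definition fps_mul f g :=
  Fps (fun n => \sum_(i < n.+1) fcoef f i * fcoef g (n - i)).
Definition fps_const (c : K) := Fps (fun n => if n == 0%N then c else 0).

(** Coefficients of a product are read off polynomial truncations, which turns the
    ring axioms into those of polynomials. *)
Definition fps_trunc N f : {poly K} := \poly_(i < N) fcoef f i.

Lemma fcoef_mul_trunc N f g n : (n < N)%N ->
  fcoef (fps_mul f g) n = (fps_trunc N f * fps_trunc N g)`_n.
Proof.
move=> nN; rewrite coefM; apply: eq_bigr => i _ /=.
rewrite !coef_poly (leq_ltn_trans _ nN) ?(leq_ltn_trans _ nN) ?leq_subr //.
by rewrite -ltnS.
Qed.

Fact fps_mulA : associative fps_mul.
Proof.
move=> f g h; apply: fps_eqP => n.
have [nN leN] : (n < n.+1)%N /\ forall i : 'I_n.+1, (n - i < n.+1)%N.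
  by split=> // i; rewrite ltnS leq_subr.
transitivity ((fps_trunc n.+1 f * (fps_trunc n.+1 g * fps_trunc n.+1 h))`_n).
  rewrite coefM /=; apply: eq_bigr => i _.
  by rewrite -(fcoef_mul_trunc _ _ (leN i)) coef_poly ltn_ord.
rewrite mulrA coefM /=; apply: eq_bigr => i _.
by rewrite -(fcoef_mul_trunc _ _ (ltn_ord i)) coef_poly leN.
Qed.

Fact fps_mulC : commutative fps_mul.
Proof.
move=> f g; apply: fps_eqP => n.
by rewrite !(fcoef_mul_trunc _ _ (ltnSn n)) mulrC.
Qed.

Fact fps_mul1 : left_id (fps_const 1) fps_mul.
Proof.
move=> f; apply: fps_eqP => n /=.
rewrite big_ord_recl /= mul1r subn0 big1 ?addr0 // => i _.
by rewrite mul0r.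
Qed.

Fact fps_mulD : left_distributive fps_mul fps_add.
Proof.
move=> f g h; apply: fps_eqP => n /=; rewrite -big_split.
by apply: eq_bigr => i _; rewrite mulrDl.
Qed.

Fact fps_1neq0 : fps_const 1 != 0 :> fps K.
Proof.
apply/eqP => /(congr1 (fun f => fcoef f 0)) /= /eqP.
by rewrite oner_eq0.
Qed.

HB.instance Definition _ := GRing.Zmodule_isComNzRing.Build (fps K)
  fps_mulA fps_mulC fps_mul1 fps_mulD fps_1neq0.

Lemma fcoefM f g n :
  fcoef (f * g) n = \sum_(i < n.+1) fcoef f i * fcoef g (n - i).
Proof. by []. Qed.

Lemma fcoefD f g n : fcoef (f + g) n = fcoef f n + fcoef g n.
Proof. by []. Qed.

Lemma fcoefB f g n : fcoef (f - g) n = fcoef f n - fcoef g n.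
Proof. by []. Qed.

Lemma fps_const_is_zmod : zmod_morphism fps_const.
Proof. by move=> a b; apply: fps_eqP => -[|n] //=; rewrite subr0. Qed.

Lemma fps_const_is_monoid : monoid_morphism fps_const.
Proof.
split=> // a b; apply: fps_eqP => n; rewrite fcoefM big_ord_recl /= subn0.
rewrite big1 => [|i _]; last by rewrite mul0r.
by case: n => [|n] /=; rewrite ?mulr0 addr0.
Qed.

HB.instance Definition _ :=
  GRing.isZmodMorphism.Build K (fps K) fps_const fps_const_is_zmod.
HB.instance Definition _ :=
  GRing.isMonoidMorphism.Build K (fps K) fps_const fps_const_is_monoid.

Definition fps_coef0 f := fcoef f 0.

Lemma fps_coef0_is_zmod : zmod_morphism fps_coef0.
Proof. by []. Qed.

Lemma fps_coef0_is_monoid : monoid_morphism fps_coef0.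
Proof. by split=> // f g; rewrite /fps_coef0 fcoefM big_ord1. Qed.

HB.instance Definition _ :=
  GRing.isZmodMorphism.Build (fps K) K fps_coef0 fps_coef0_is_zmod.
HB.instance Definition _ :=
  GRing.isMonoidMorphism.Build (fps K) K fps_coef0 fps_coef0_is_monoid.

Lemma fps_constK c : fps_coef0 (fps_const c) = c. Proof. by []. Qed.

(** [vanish N (f - g)] is the congruence of [f] and [g] modulo [u^N]. *)
Definition vanish N f := forall i, (i < N)%N -> fcoef f i = 0.

Lemma vanishS N f : vanish N f -> fcoef f N = 0 -> vanish N.+1 f.
Proof. by move=> vf fN i; rewrite ltnS leq_eqVlt => /predU1P[-> //|/vf]. Qed.

Lemma fcoefM_vanish N M f g : vanish N f -> vanish M g ->
  fcoef (f * g) (N + M) = fcoef f N * fcoef g M.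
Proof.
move=> vf vg; have NM : (N < (N + M).+1)%N by rewrite ltnS leq_addr.
rewrite fcoefM (bigD1 (Ordinal NM)) //= addKn big1 ?addr0 // => i neq.
have [iN|Ni] := ltnP i N; first by rewrite vf ?mul0r.
rewrite vg ?mulr0 // ltn_subLR; last by rewrite -ltnS.
rewrite ltn_add2r ltn_neqAle Ni andbT eq_sym.
by apply: contraNneq neq => e; apply/eqP/val_inj.
Qed.

Lemma vanishM N M f g : vanish N f -> vanish M g -> vanish (N + M) (f * g).
Proof.
move=> vf vg i iNM; rewrite fcoefM big1 // => j _.
have [jN|Nj] := ltnP j N; first by rewrite vf ?mul0r.
rewrite vg ?mulr0 // ltn_subLR; last by rewrite -ltnS.
by rewrite (leq_trans iNM) // leq_add2r.
Qed.

Lemma vanishMl N f g : vanish N f -> vanish N (f * g).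
Proof. by move=> vf; rewrite -[N]addn0; apply: vanishM. Qed.

Lemma vanishMr N f g : vanish N g -> vanish N (f * g).
Proof. by rewrite mulrC; apply: vanishMl. Qed.

Lemma vanish_all0 f : (forall N, vanish N f) -> f = 0.
Proof. by move=> vf; apply: fps_eqP => n; apply: (vf n.+1). Qed.

Lemma fps_order f : f != 0 -> {N | vanish N f & fcoef f N != 0}.
Proof.
move=> f0; have exN : exists N, fcoef f N != 0.
  apply/not_existsP => nf; case/eqP: f0; apply: fps_eqP => n.
  by apply/eqP/negPn/negP/nf.
exists (ex_minn exN); case: ex_minnP => // N _ minN i iN.
by apply/eqP; apply: contraT => /minN; rewrite leqNgt iN.
Qed.

(** Units and inverses are found by choice: the fraction field only asks for them to
    exist. *)
Definition fps_unit : pred (fps K) := fun f => `[< exists g, g * f = 1 >].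
Definition fps_inv f : fps K :=
  if pselect (exists g, g * f = 1) is left e then projT1 (cid e) else f.

Fact fps_mulV : {in fps_unit, left_inverse 1 fps_inv *%R}.
Proof.
move=> f /asboolP ex; rewrite /fps_inv.
by case: pselect => // e; case: cid.
Qed.
Fact fps_unitPl f g : g * f = 1 -> fps_unit f.
Proof. by move=> e; apply/asboolP; exists g. Qed.
Fact fps_invr_out : {in [predC fps_unit], fps_inv =1 id}.
Proof.
move=> f; rewrite inE /= => /asboolP nf.
by rewrite /fps_inv; case: pselect.
Qed.

HB.instance Definition _ := GRing.ComNzRing_hasMulInverse.Build (fps K)
  fps_mulV fps_unitPl fps_invr_out.

Fact fps_idomain : GRing.integral_domain_axiom (fps K).
Proof.
move=> f g fg0; have [//|f0] := eqVneq f 0; have [//|g0] := eqVneq g 0.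
have [N vf fN] := fps_order f0; have [M vg gM] := fps_order g0.
have := fcoefM_vanish vf vg; rewrite fg0 => /esym/eqP.
by rewrite mulf_eq0 (negPf fN) (negPf gM).
Qed.

HB.instance Definition _ := GRing.ComUnitRing_isIntegral.Build (fps K)
  fps_idomain.

Definition fps_var : fps K := Fps (fun n => (n == 1%N)%:R).

Lemma fcoef_varX N n : fcoef (fps_var ^+ N) n = (n == N)%:R.
Proof.
elim: N n => [|N IHN] n; first by rewrite expr0 /=; case: n.
rewrite exprS fcoefM; case: n => [|n].
  by rewrite big_ord1 /= mul0r.
rewrite big_ord_recl big_ord_recl /= mul0r add0r mul1r big1 => [|i _].
  by rewrite addr0 /= subSS subn0 IHN eqSS.
by rewrite mul0r.
Qed.

Lemma fps_var_neq0 : fps_var != 0.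
Proof.
apply/eqP => /(congr1 (fun f => fcoef f 1)) /= /eqP.
by rewrite oner_eq0.
Qed.

Lemma vanish_varX N : vanish N (fps_var ^+ N).
Proof. by move=> i iN; rewrite fcoef_varX ltn_eqF. Qed.

Lemma fps_coef0D f g : fps_coef0 (f + g) = fps_coef0 f + fps_coef0 g.
Proof. by []. Qed.

Lemma fps_coef0M f g : fps_coef0 (f * g) = fps_coef0 f * fps_coef0 g.
Proof. exact: rmorphM. Qed.

Lemma fps_coef0_varX N : (0 < N)%N -> fps_coef0 (fps_var ^+ N) = 0.
Proof. by case: N => // N _; rewrite /fps_coef0 fcoef_varX. Qed.

Lemma fps_coef0_mul_var N f : (0 < N)%N -> fps_coef0 (fps_var ^+ N * f) = 0.
Proof. by move=> N0; rewrite fps_coef0M fps_coef0_varX // mul0r. Qed.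

(** The substitution [u |-> w u]. *)
Definition fps_scale (w : K) f := Fps (fun n => w ^+ n * fcoef f n).

Lemma fps_scale_is_zmod w : zmod_morphism (fps_scale w).
Proof. by move=> f g; apply: fps_eqP => n /=; rewrite mulrBr. Qed.

Lemma fps_scale_is_monoid w : monoid_morphism (fps_scale w).
Proof.
split=> [|f g]; apply: fps_eqP => n.
  by case: n => [|n] /=; rewrite ?mulr0 // expr0 mul1r.
rewrite fcoefM /= mulr_sumr; apply: eq_bigr => i _.
by rewrite mulrACA -exprD subnKC // -ltnS.
Qed.

HB.instance Definition _ w := GRing.isZmodMorphism.Build (fps K) (fps K)
  (fps_scale w) (fps_scale_is_zmod w).
HB.instance Definition _ w := GRing.isMonoidMorphism.Build (fps K) (fps K)
  (fps_scale w) (fps_scale_is_monoid w).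

Lemma fps_scale_const w c : fps_scale w (fps_const c) = fps_const c.
Proof.
by apply: fps_eqP => -[|n] /=; rewrite ?expr0 ?mul1r ?mulr0.
Qed.

Lemma fps_scale_var w : fps_scale w fps_var = fps_const w * fps_var.
Proof.
apply: fps_eqP => n; rewrite fcoefM big_ord_recl /= subn0 big1 => [|i _].
  by rewrite addr0; case: n => [|[|n]] //=; rewrite ?mulr0 ?mulr1 ?expr1.
by rewrite mul0r.
Qed.

Lemma fps_coef0_scale w f : fps_coef0 (fps_scale w f) = fps_coef0 f.
Proof. by rewrite /fps_coef0 /= expr0 mul1r. Qed.

Lemma fps_scale_eq0 w f : w != 0 -> (fps_scale w f == 0) = (f == 0).
Proof.
move=> w0; apply/eqP/eqP => [e|->]; last by rewrite rmorph0.
apply: fps_eqP => n; have := congr1 (fun g => fcoef g n) e => /= /eqP.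
by rewrite mulf_eq0 expf_eq0 (negPf w0) andbF => /eqP.
Qed.

Lemma horner_vanish (p : {poly fps K}) x y N :
  vanish N (x - y) -> vanish N (p.[x] - p.[y]).
Proof.
move=> v; have /factor_theorem[q e] : root (p - p.[y]%:P) y.
  by rewrite rootE !hornerE subrr.
have := congr1 (fun r : {poly fps K} => r.[x]) e.
rewrite !hornerE => ->; rewrite mulrC; exact: vanishMl.
Qed.

(** One coefficient at a time: [d] is the derivative of the reduced polynomial at the
    root, so the correction cancels the first coefficient of [p.[z]] that survives. *)
Fixpoint newton_seq (p : {poly fps K}) (d : K) (y : fps K) N : fps K :=
  if N is N'.+1 then
    let z := newton_seq p d y N' in
    z - fps_const (fcoef p.[z] N'.+1 / d) * fps_var ^+ N'.+1
  else y.

(** Correcting [z] by a multiple of [u^(N+1)] changes [p.[z]] by [p'(z)] times the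
    correction, up to a term of order [2(N+1)]; as [p'(z)] is a unit, every order can be
    cancelled in turn. *)
Lemma hensel (p : {poly fps K}) (c : K) :
    root (map_poly fps_coef0 p) c -> ~~ root (map_poly fps_coef0 p)^`() c ->
  exists y, fps_coef0 y = c /\ root p y.
Proof.
move=> rc nrc; set d := (map_poly fps_coef0 p)^`().[c].
have d0 : d != 0 by [].
pose z N := newton_seq p d (fps_const c) N.
have zS N : z N.+1 = z N - fps_const (fcoef p.[z N] N.+1 / d) * fps_var ^+ N.+1.
  by [].
have v1 N : vanish N.+1 (z N.+1 - z N).
  rewrite zS addrAC subrr sub0r -mulNr mulrC.
  exact/vanishMl/vanish_varX.
have z0 N : fps_coef0 (z N) = c.
  elim: N => [|N <-]; first exact: fps_constK.
  by apply/eqP; rewrite -subr_eq0 -rmorphB; apply/eqP/v1.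
have pz N : vanish N.+1 p.[z N].
  elim: N => [|N IHN].
    move=> [|//] _; rewrite -[fcoef _ 0]/(fps_coef0 _) -horner_map /=.
    exact/rootP.
  apply: vanishS.
    rewrite -[p.[z N.+1]](subrK p.[z N]) => i iN.
    by rewrite -[LHS]/(fcoef _ _ + fcoef _ _) IHN // (horner_vanish p (v1 N)) ?addr0.
  (* Taylor expansion of [p] at [z N], with quadratic remainder. *)
  have [q e] : exists q, p = (q * ('X - (z N)%:P) + (p^`().[z N])%:P)
       * ('X - (z N)%:P) + p.[z N]%:P.
    have /factor_theorem[q e] : root (p - p.[z N]%:P) (z N).
      by rewrite rootE !hornerE subrr.
    have e' : p = q * ('X - (z N)%:P) + p.[z N]%:P by rewrite -e subrK.
    have dq : p^`().[z N] = q.[z N].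
      by rewrite [in LHS]e' !derivE !hornerE subrr mulr0 add0r.
    have /factor_theorem[q' e2] : root (q - q.[z N]%:P) (z N).
      by rewrite rootE !hornerE subrr.
    by exists q'; rewrite dq -e2 subrK.
  have -> : p.[z N.+1] = (q.[z N.+1] * (z N.+1 - z N)) * (z N.+1 - z N)
       + p^`().[z N] * (z N.+1 - z N) + p.[z N].
    by rewrite [in LHS]e !hornerE mulrDl.
  have lt2 : (N.+1 < N.+1 + N.+1)%N by rewrite -{1}[N.+1]addn0 ltn_add2l.
  have -> : forall f g h, fcoef (f + g + h) N.+1
      = fcoef f N.+1 + fcoef g N.+1 + fcoef h N.+1 by [].
  rewrite (vanishM (vanishMr q.[z N.+1] (v1 N)) (v1 N)) // add0r.
  have v0 f : vanish 0 f by [].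
  rewrite -[in LHS](add0n N.+1) (fcoefM_vanish (v0 _) (v1 N)).
  have -> : fcoef p^`().[z N] 0 = d.
    by rewrite -[LHS]/(fps_coef0 _) -horner_map /= -deriv_map z0.
  rewrite zS addrAC subrr sub0r -[fcoef (- _) _]/(- fcoef _ _).
  rewrite -[in X in - X](add0n N.+1) (fcoefM_vanish (v0 _) (@vanish_varX N.+1)).
  rewrite fcoef_varX eqxx mulr1 -[fcoef (fps_const _) 0]/(fps_coef0 _).
  by rewrite fps_constK mulrN mulrCA divff // mulr1 addNr.
pose y : fps K := Fps (fun n => fcoef (z n) n).
have zM N M : vanish N.+1 (z (M + N)%N - z N).
  elim: M => [|M IHM]; first by rewrite subrr.
  rewrite addSn -[z _.+1](subrK (z (M + N)%N)) -addrA => i iN.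
  rewrite fcoefD IHM // v1 ?addr0 //.
  by rewrite (leq_trans iN) // ltnS leq_addl.
have yz N : vanish N.+1 (y - z N).
  move=> i; rewrite ltnS => iN; have := zM i (N - i)%N i (ltnSn i).
  rewrite subnK // fcoefB => /eqP; rewrite subr_eq0 => /eqP e.
  by rewrite fcoefB e subrr.
exists y; split; first exact: z0 0.
apply/rootP/vanish_all0 => N i iN.
rewrite -[p.[y]](subrK p.[z N]) fcoefD.
by rewrite pz ?addr0 ?(horner_vanish p (@yz N)) // ltnW.
Qed.

End PowerSeries.

(** * Laurent series *)

(** A field generated as a fraction field by the image of [f] maps to [Om] along [g] as
    soon as [f] and [g] have the same kernel. This is used for fraction fields proper
    (Laurent series), for function fields ([A] a polynomial ring in several variables)
    and for simple algebraic extensions ([A] a polynomial ring in one variable). *)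
Lemma lift_to_fractions (A : nzRingType) (B Om : fieldType)
    (f : {rmorphism A -> B}) (g : {rmorphism A -> Om}) :
    (forall a, f a = 0 <-> g a = 0) ->
    (forall b, exists x y, f y != 0 /\ b = f x / f y) ->
  exists h : {rmorphism B -> Om}, forall a, h (f a) = g a.
Proof.
move=> fg0 frac.
have fgn0 a : f a != 0 -> g a != 0.
  by apply: contra => /eqP e; apply/eqP/fg0.
have ex_nd b : exists c : A * A, f c.2 != 0 /\ b = f c.1 / f c.2.
  by have [x [y H]] := frac b; exists (x, y).
pose nd b := projT1 (cid (ex_nd b)).
have ndP b : f (nd b).2 != 0 /\ b = f (nd b).1 / f (nd b).2.
  exact: projT2 (cid (ex_nd b)).
pose h b := g (nd b).1 / g (nd b).2.
have hE x y : f y != 0 -> h (f x / f y) = g x / g y.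
  move=> fy0; have [d0 e] := ndP (f x / f y).
  apply/eqP; rewrite /h eqr_div ?fgn0 // -!rmorphM -subr_eq0 -rmorphB.
  apply/eqP/fg0; rewrite rmorphB !rmorphM; apply/eqP; rewrite subr_eq0.
  by rewrite -eqr_div // -e.
have hf a : h (f a) = g a.
  by rewrite -[f a]divr1 -(rmorph1 f) hE ?rmorph1 ?oner_eq0 // divr1.
have hB : zmod_morphism h.
  move=> b1 b2; have [x1 [y1 [n1 ->]]] := frac b1.
  have [x2 [y2 [n2 ->]]] := frac b2.
  rewrite -mulNr addf_div // -!rmorphN -!rmorphM -rmorphD.
  rewrite !hE // ?rmorphM ?mulf_neq0 // -mulNr addf_div ?fgn0 //.
  by rewrite rmorphD !rmorphM rmorphN.
have hM : monoid_morphism h.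
  split=> [|b1 b2]; first by rewrite -(rmorph1 f) hf rmorph1.
  have [x1 [y1 [n1 ->]]] := frac b1; have [x2 [y2 [n2 ->]]] := frac b2.
  rewrite mulf_div -!rmorphM !hE // ?rmorphM ?mulf_neq0 //.
  by rewrite mulf_div.
pose hZ := GRing.isZmodMorphism.Build B Om h hB.
pose hR := GRing.isMonoidMorphism.Build B Om h hM.
pose H : {rmorphism B -> Om} := HB.pack h hZ hR.
by exists H.
Qed.

Lemma fraction_ratio (R : idomainType) (x : {fraction R}) :
  exists a b, @tofrac R b != 0 /\ x = @tofrac R a / @tofrac R b.
Proof.
elim/quotW: x => r; exists (\n_r), (\d_r).
have d0 : @tofrac R \d_r != 0 by rewrite tofrac_eq0 denom_ratioP.
split=> //; apply: (mulIf d0); rewrite divfK //.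
rewrite -[LHS]/(FracField.mul _ _) !piE; apply/eqmodP.
rewrite /= /equivf /FracField.equivf /FracField.mulf.
rewrite !numden_Ratio ?oner_eq0 ?mulf_neq0 ?denom_ratioP ?oner_eq0 //.
by rewrite !mulr1 mulrC.
Qed.

Section Laurent.
Variable K : fieldType.

Definition laurent : fieldType := {fraction fps K}.
Definition fps_frac : {rmorphism fps K -> laurent} := @tofrac (fps K).

Lemma fps_frac_eq0 f : (fps_frac f == 0) = (f == 0).
Proof. exact: tofrac_eq0. Qed.

Lemma fps_frac_inj : injective fps_frac.
Proof. by move=> f g /eqP; rewrite -subr_eq0 -rmorphB fps_frac_eq0 subr_eq0 => /eqP. Qed.

Definition laurent_var : laurent := fps_frac (fps_var K).
Definition laurent_const : {rmorphism K -> laurent} :=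
  fps_frac \o (@fps_const K).

Lemma laurent_var_neq0 : laurent_var != 0.
Proof. by rewrite fps_frac_eq0 fps_var_neq0. Qed.

Lemma laurent_scale (w : K) : w != 0 -> exists rho : {rmorphism laurent -> laurent},
  forall f, rho (fps_frac f) = fps_frac (fps_scale w f).
Proof.
move=> w0; apply: (lift_to_fractions (f := fps_frac) (g := fps_frac \o fps_scale w)).
  by move=> f; split=> /eqP; rewrite /= !fps_frac_eq0 ?fps_scale_eq0 // => /eqP ->;
     rewrite ?rmorph0.
exact: fraction_ratio.
Qed.

(** Multiplying by [u^(deg p)] gives a power series whose coefficients are those of [p]
    in reverse order. *)
Lemma laurent_varV_transc (p : {poly K}) :
  (map_poly laurent_const p).[laurent_var^-1] = 0 -> p = 0.
Proof.
move=> p0; apply/polyP => i; rewrite coef0.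
have [ip|ip] := ltnP i (size p); last exact: nth_default.
pose d := (size p).-1.
pose f : fps K := \sum_(j < size p) fps_const p`_j * fps_var K ^+ (d - j).
have : fps_frac f = 0.
  have -> : fps_frac f = laurent_var ^+ d * (map_poly laurent_const p).[laurent_var^-1].
    rewrite (horner_coef_wide _ (size_poly _ _)) mulr_sumr rmorph_sum.
    apply: eq_bigr => j _; rewrite rmorphM rmorphXn coef_map_id0 ?rmorph0 //.
    rewrite mulrCA; congr (_ * _); rewrite exprB ?unitfE ?laurent_var_neq0 //.
      by rewrite exprVn.
    by rewrite /d -ltnS prednK // (leq_ltn_trans _ ip).
  by rewrite p0 mulr0.
move/eqP; rewrite fps_frac_eq0 => /eqP/(congr1 (fun g => fcoef g (d - i))).
have fs (s : seq 'I_(size p)) (F : 'I_(size p) -> fps K) k :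
    fcoef (\sum_(j <- s) F j) k = \sum_(j <- s) fcoef (F j) k.
  by elim: s => [|j s IHs]; rewrite ?big_nil // !big_cons fcoefD IHs.
have cX c k n : fcoef (fps_const c * fps_var K ^+ k) n = c * (n == k)%:R.
  rewrite fcoefM big_ord_recl /= subn0 big1 => [|j _]; last by rewrite mul0r.
  by rewrite addr0 fcoef_varX.
rewrite fs (bigD1 (Ordinal ip)) // cX eqxx mulr1 big1 => [|j neq].
  by move=> e; rewrite -[LHS]addr0; exact: e.
rewrite cX (negPf (_ : (d - i)%N != (d - j)%N)) ?mulr0 //.
apply: contra neq => /eqP e; apply/eqP/val_inj => /=.
have le k : (k < size p)%N -> (k <= d)%N.
  by rewrite /d => kp; rewrite -ltnS prednK // (leq_ltn_trans _ kp).
by rewrite -(subKn (le _ ip)) e subKn // le.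
Qed.

End Laurent.

(** * Extension of embeddings to finite extensions *)

Definition splits (K : fieldType) (p : {poly K}) :=
  exists c rs, p = c *: \prod_(r <- rs) ('X - r%:P).

Lemma splits_root (K : fieldType) (p q : {poly K}) :
  q != 0 -> splits q -> p %| q -> (1 < size p)%N -> exists z, root p z.
Proof.
move=> q0 [c [rs e]] pq sp.
have c0 : c != 0 by apply: contraNneq q0 => c0; rewrite e c0 scale0r.
move: pq; rewrite e dvdpZr // => /dvdp_prod_XsubC[msk pe].
have : (0 < size (mask msk rs))%N.
  by rewrite -ltnS -(size_prod_XsubC _ id) -(eqp_size pe).
case: (mask msk rs) pe => // z s pe _; exists z.
by rewrite (eqp_root pe) root_prod_XsubC mem_head.
Qed.

Section Extend.
Variables (F : fieldType) (N : fieldExtType F) (Om : fieldType).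

Definition extends (E E' : {subfield N}) (psi : subvs_of E -> Om)
    (psi' : subvs_of E' -> Om) :=
  forall y z, vsval y = vsval z -> psi' z = psi y.

Lemma subvs_incl (E E' : {subfield N}) : (E <= E')%VS ->
  exists j : {rmorphism subvs_of E -> subvs_of E'},
    forall y, vsval (j y) = vsval y.
Proof.
move=> sEE; pose j (y : subvs_of E) : subvs_of E' :=
  Subvs (subvP sEE _ (subvsP y)).
have jB : zmod_morphism j by move=> y z; apply: val_inj.
have jM : monoid_morphism j.
  split=> [|y z]; apply: val_inj => //=.
  by rewrite !algid1.
pose jZ := GRing.isZmodMorphism.Build _ _ j jB.
pose jR := GRing.isMonoidMorphism.Build _ _ j jM.
by exists (HB.pack j jZ jR : {rmorphism _ -> _}).
Qed.

(** The minimal polynomial of [x] over [E] divides [q], so its image has a root in [Om];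
    sending [x] to that root extends [psi]. *)
Lemma extend_step (E : {subfield N}) (psi : {rmorphism subvs_of E -> Om})
    (x : N) (q : {poly subvs_of E}) :
    q != 0 -> root (map_poly vsval q) x -> splits (map_poly psi q) ->
  exists psi' : {rmorphism subvs_of <<E; x>>%AS -> Om}, extends psi psi'.
Proof.
move=> q0 qx spl; have [j jE] := subvs_incl (subv_adjoin E x).
have [th thE] := polyOver_subvs (minPolyOver E x).
have valM : map_poly vsval q \is a polyOver E by apply/polyOver_subvs; exists q.
have dvd p : (map_poly vsval p).[x] = 0 -> th %| p.
  move=> px; rewrite -(dvdp_map (vsval : {rmorphism subvs_of E -> N})) -thE.
  by apply: minPoly_dvdp; [apply/polyOver_subvs; exists p | apply/rootP].
have [z zr] : exists z, root (map_poly psi th) z.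
  apply: (splits_root (q := map_poly psi q)) => //; first by rewrite map_poly_eq0.
    by rewrite dvdp_map; apply: dvd; apply/rootP.
  rewrite size_map_poly -(size_map_poly (vsval : {rmorphism subvs_of E -> N})).
  by rewrite -thE size_minPoly ltnS.
have xE : x \in <<E; x>>%VS by apply: memv_adjoin.
pose f : {rmorphism {poly subvs_of E} -> subvs_of <<E; x>>%AS} :=
  (horner_eval (Subvs xE)) \o (map_poly j).
pose g : {rmorphism {poly subvs_of E} -> Om} := horner_eval z \o map_poly psi.
have fE p : vsval (f p) = (map_poly vsval p).[x].
  rewrite /f /= /horner_eval -(horner_map (vsval : {rmorphism _ -> N})) /=.
  by rewrite -map_poly_comp; congr _.[_]; apply: eq_map_poly => y /=.
have fg p : f p = 0 -> g p = 0.
  move=> fp0; have /dvdpP[r ->] : th %| p by apply: dvd; rewrite -fE fp0.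
  by rewrite rmorphM /= /horner_eval (rootP zr) mulr0.
have surj b : exists p, b = f p.
  have /Fadjoin_polyP[_ /polyOver_subvs[p ->] e] := subvsP b.
  by exists p; apply: val_inj; rewrite /= fE.
have gf p : g p = 0 -> f p = 0.
  move=> gp0; apply/eqP; apply: contraT => fp0.
  have [r re] := surj (f p)^-1.
  have /fg/eqP : f (p * r - 1) = 0.
    by rewrite rmorphB rmorphM rmorph1 -re divff ?subrr.
  by rewrite rmorphB rmorphM rmorph1 gp0 mul0r sub0r oppr_eq0 oner_eq0.
have [|b|psi' psiE] := lift_to_fractions (f := f) (g := g).
- by move=> q'; split; [apply: fg | apply: gf].
- by have [r ->] := surj b; exists r, 1; rewrite rmorph1 oner_eq0 divr1.
exists psi' => y w yw.
have -> : w = f y%:P by apply: val_inj; rewrite /= fE map_polyC hornerC.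
by rewrite psiE /g /= /horner_eval map_polyC hornerC.
Qed.

Lemma extend_seq (E : {subfield N}) (psi : {rmorphism subvs_of E -> Om}) s :
    (forall x, x \in s -> exists q : {poly subvs_of E},
       [/\ q != 0, root (map_poly vsval q) x & splits (map_poly psi q)]) ->
  exists psi' : {rmorphism subvs_of <<E & s>>%AS -> Om}, extends psi psi'.
Proof.
elim: s E psi => [|x s IHs] E psi alg.
  have sub : (<<E & [::]>> <= E)%VS by rewrite Fadjoin_nil.
  have [j jE] := @subvs_incl <<E & [::]>>%AS E sub.
  exists (psi \o j : {rmorphism _ -> _}) => y z yz /=; congr (psi _).
  by apply: val_inj; rewrite /= jE.
have [|q [q0 qx qs]] := alg x; first exact: mem_head.
have [psi1 e1] := extend_step q0 qx qs.
have [j jE] := subvs_incl (subv_adjoin E x).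
have [|psi2 e2] := IHs _ psi1.
  move=> y ys; have [|r [r0 ry rs]] := alg y; first by rewrite inE ys orbT.
  exists (map_poly j r); split; first by rewrite map_poly_eq0.
    by rewrite -map_poly_comp (eq_map_poly (g := vsval)).
  by rewrite -map_poly_comp (eq_map_poly (g := psi)) // => w /=; apply: e1.
have sub : (<<E & x :: s>> <= <<<<E; x>> & s>>)%VS by rewrite adjoin_cons.
have [i iE] := @subvs_incl <<E & x :: s>>%AS <<<<E; x>>%AS & s>>%AS sub.
exists (psi2 \o i : {rmorphism _ -> _}) => y z yz /=.
have yE : vsval y \in <<E; x>>%VS by apply: (subvP (subv_adjoin E x)) (subvsP y).
by rewrite (e2 (Subvs yE)) ?iE //; apply: e1.
Qed.

Lemma extend_base (phi : {rmorphism F -> Om}) :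
  exists psi : {rmorphism subvs_of (1%AS : {subfield N}) -> Om},
    forall c, psi c%:A = phi c.
Proof.
apply: (lift_to_fractions (f := in_alg (subvs_of (1%AS : {subfield N})))).
  by move=> c; split=> /eqP; rewrite fmorph_eq0 => /eqP ->; rewrite rmorph0.
move=> b; have /vlineP[k e] := subvsP b; exists k, 1.
rewrite rmorph1 oner_eq0 divr1; split=> //.
by apply: val_inj; rewrite [LHS]e /= algid1.
Qed.

End Extend.

Lemma map_prod_XsubC (R S : comNzRingType) (f : {rmorphism R -> S}) rs :
  map_poly f (\prod_(r <- rs) ('X - r%:P))
    = \prod_(r <- [seq f r | r <- rs]) ('X - r%:P).
Proof.
by rewrite rmorph_prod big_map; apply: eq_bigr => r _; rewrite /= map_polyXsubC.
Qed.

(** Both embeddings of [N] have the same image, because [N] is normal: [psi2 x] is a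
    root of the image of the minimal polynomial of [x], all of whose roots lie in
    [psi N]. The automorphism is [psi^-1] after [psi2]. *)
Lemma galois_of_embeddings (F : fieldType) (N : splittingFieldType F)
    (Om : fieldType) (psi psi2 : {rmorphism N -> Om}) :
    (forall c : F, psi2 c%:A = psi c%:A) ->
  exists2 g : gal_of {:N}, g \in 'Gal({:N} / 1)%g & forall x, psi (g x) = psi2 x.
Proof.
move=> agree; have ex x : exists y, psi y = psi2 x.
  have [rs /eqP mE] := splitting_field_normal (1%AS : {subfield N}) x.
  have : root (map_poly psi2 (minPoly 1 x)) (psi2 x).
    by rewrite fmorph_root root_minPoly.
  have -> : map_poly psi2 (minPoly 1 x) = map_poly psi (minPoly 1 x).
    apply/polyP => i; rewrite !coef_map /=.
    by have /polyOverP/(_ i)/vlineP[k ->] := minPolyOver (1%AS : {subfield N}) x.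
  rewrite mE map_prod_XsubC root_prod_XsubC => /mapP[y _ ->].
  by exists y.
pose h x := projT1 (cid (ex x)).
have hE x : psi (h x) = psi2 x by exact: projT2 (cid (ex x)).
have hB : zmod_morphism h.
  by move=> x y; apply: (fmorph_inj psi); rewrite rmorphB !hE rmorphB.
have hM : monoid_morphism h.
  by split=> [|x y]; apply: (fmorph_inj psi); rewrite ?rmorph1 ?rmorphM !hE
    ?rmorph1 ?rmorphM.
have hZ : scalable h.
  move=> c x; apply: (fmorph_inj psi).
  by rewrite hE -[c *: x]mulr_algl -[_ *: h x]mulr_algl !rmorphM agree hE.
pose hZm := GRing.isZmodMorphism.Build _ _ h hB.
pose hMm := GRing.isMonoidMorphism.Build _ _ h hM.
pose hSm := GRing.isScalable.Build _ _ _ _ h hZ.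
pose H : {lrmorphism N -> N} := HB.pack h hZm hMm hSm.
have kH : kHom 1 {:N} (linfun H).
  apply/kHom_monoid_morphism; split=> [|x y]; first by rewrite lfunE rmorph1.
  by rewrite !lfunE rmorphM.
have [g gG ge] := kAut_to_gal (etrans (kAutfE _ _) kH).
by exists g => // x; rewrite -ge ?memvf // lfunE hE.
Qed.

(** * Roots over power series *)

Section PrimRoot.
Variable C : closedFieldType.
Hypothesis charC : forall k, (0 < k)%N -> k%:R != 0 :> C.

Lemma closed_prim_root E : (0 < E)%N -> exists w : C, E.-primitive_root w.
Proof.
move=> E0; have [rs e] := closed_field_poly_normal ('X^E - 1 : {poly C}).
move: e; rewrite (monicP (monicXnsubC _ E0)) scale1r => e.
have urs : uniq rs.
  by rewrite -separable_prod_XsubC -e separable_Xn_sub_1 // charC.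
have srs : size rs = E.
  by have := size_XnsubC (1 : C) E0; rewrite e size_prod_XsubC => -[].
have /hasP[w _ wP] : has E.-primitive_root rs; last by exists w.
apply: has_prim_root; rewrite ?srs //; apply/allP => z zr.
rewrite unity_rootE -subr_eq0; move: zr.
by rewrite -root_prod_XsubC -e rootE !hornerE.
Qed.

Lemma closed_root_exp e (a : C) : (0 < e)%N -> exists x, x ^+ e = a.
Proof.
move=> e0; have /closed_rootP[x] : size ('X^e - a%:P) != 1%N.
  by rewrite size_XnsubC // eqSS -lt0n.
by rewrite rootE !hornerE subr_eq0 => /eqP; exists x.
Qed.

(** The multiples of one root by the [e]-th roots of unity. *)
Lemma exp_roots e (a : C) : (0 < e)%N -> a != 0 ->
  exists s : seq C, [/\ uniq s, size s = e & forall x, (x \in s) = (x ^+ e == a)].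
Proof.
move=> e0 a0; have [w wP] := closed_prim_root e0.
have [x0 x0E] := closed_root_exp a e0.
have x00 : x0 != 0.
  by apply: contraNneq a0 => x00; rewrite -x0E x00 expr0n eqn0Ngt e0.
exists [seq x0 * w ^+ k | k : 'I_e]; split=> [||x].
- rewrite map_inj_uniq ?enum_uniq // => i j /(mulfI x00)/eqP.
  rewrite (eq_prim_root_expr wP) /= => /eqP ij; apply: val_inj.
  by move: ij; rewrite !modn_small.
- by rewrite size_map size_enum_ord.
apply/mapP/eqP => [[i _ ->]|xe].
  by rewrite exprMn exprAC (prim_expr_order wP) expr1n mulr1.
have /(prim_rootP wP)[i iE] : (x / x0) ^+ e = 1.
  by rewrite expr_div_n xe x0E divff.
by exists i; rewrite ?mem_enum // -iE mulrCA divff // mulr1.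
Qed.

Definition mup_cofactor (p : {poly C}) c := p %/ ('X - c%:P) ^+ mup c p.

Lemma mup_cofactorE (p : {poly C}) c : p != 0 ->
  p = ('X - c%:P) ^+ mup c p * mup_cofactor p c.
Proof. by move=> p0; rewrite mulrC divpK // -mup_geq. Qed.

Lemma mup_cofactor_neq0 (p : {poly C}) c : p != 0 -> (mup_cofactor p c).[c] != 0.
Proof.
move=> p0; apply/negP => /factor_theorem[q qE].
have : (mup c p < (mup c p).+1)%N by [].
rewrite mup_ltn // => /negP; apply.
by rewrite {2}(mup_cofactorE c p0) qE mulrCA exprSr dvdp_mulIr.
Qed.

End PrimRoot.

Section Arc.
Variables (C : closedFieldType) (K : fieldType) (io : {rmorphism C -> K}).
Hypothesis charC : forall k, (0 < k)%N -> k%:R != 0 :> C.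
Variables (m N Kx : nat).
Hypotheses (m0 : (0 < m)%N) (N0 : (0 < N)%N).
Let E := (m * N)%N.
Hypothesis EKx : (E < Kx)%N.
Variables (M : {poly C}) (P : {poly K}).

Local Notation u := (fps_var K).

Definition ccst : {rmorphism C -> fps K} := (@fps_const K) \o io.

(** Up to the factor [u^Kx], this is the polynomial [P] with its coefficients displaced
    by those of [u^-Kx (M - u^E)]. *)
Definition arc_poly : {poly fps K} :=
  map_poly ccst M - (u ^+ E)%:P + u ^+ Kx *: map_poly (@fps_const K) P.

Lemma ccst0 x : fps_coef0 (ccst x) = io x. Proof. by []. Qed.

Lemma fps_root_exp f (x : C) : x != 0 -> fps_coef0 f = io x ^+ m ->
  exists2 b, fps_coef0 b = io x & b ^+ m = f.
Proof.
move=> x0 fx; have mE : map_poly (@fps_coef0 K) ('X^m - f%:P) = 'X^m - (io x ^+ m)%:P.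
  by rewrite rmorphB /= map_polyXn map_polyC /= fx.
have [||b [b0]] := @hensel K ('X^m - f%:P) (io x).
- by rewrite mE rootE !hornerE subrr.
- rewrite mE !derivE subr0 rootE hornerMn hornerXn -mulr_natl mulf_neq0 //.
    by rewrite -(rmorph_nat io) fmorph_eq0 charC.
  by rewrite expf_neq0 // fmorph_eq0.
by rewrite rootE !hornerE subr_eq0 => /eqP bm; exists b.
Qed.

(** A segment of the Newton polygon. Put [T = c + u^l Y] with [l e = E]: the polynomial
    becomes [u^E] times [Y^e G(c + u^l Y) - 1 + O(u)], whose reduction [G(c) Y^e - 1] has
    simple roots. Hensel's lemma lifts them, and since [m] divides [E - l], the
    derivative at such a root is a power of [u^m] times a unit, hence an [m]-th power. *)
Lemma cluster_root (c x : C) (e : nat) (G : {poly C}) :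
    M = ('X - c%:P) ^+ e * G -> (0 < e)%N -> (e %| N)%N ->
    x ^+ e * G.[c] = 1 ->
  let l := (m * (N %/ e))%N in
  exists Y b, let tau := ccst c + u ^+ l * Y in
    [/\ fps_coef0 Y = io x, root arc_poly tau, fps_coef0 b != 0
      & arc_poly^`().[tau] = u ^+ (l * e.-1) * b ^+ m].
Proof.
move=> ME e0 eN xG l.
have l0 : (0 < l)%N by rewrite muln_gt0 m0 divn_gt0 // dvdn_leq.
have leE : (l * e)%N = E by rewrite -mulnA divnK.
have x0 : x != 0.
  by apply: contra_eq_neq xG => ->; rewrite expr0n eqn0Ngt e0 mul0r eq_sym oner_eq0.
have G0 : G.[c] != 0.
  by apply: contra_eq_neq xG => ->; rewrite mulr0 eq_sym oner_eq0.
pose A : {poly fps K} := (ccst c)%:P + u ^+ l *: 'X.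
pose R := 'X^e * (map_poly ccst G \Po A) - 1
   + u ^+ (Kx - E) *: (map_poly (@fps_const K) P \Po A).
have D : arc_poly \Po A = u ^+ E *: R.
  rewrite /arc_poly comp_polyD comp_polyB comp_polyC comp_polyZ ME.
  rewrite rmorphM rmorphXn /= map_polyXsubC comp_polyM rmorphXn /=.
  rewrite comp_polyB comp_polyX comp_polyC.
  have -> : A - (ccst c)%:P = u ^+ l *: 'X by rewrite /A addrAC subrr add0r.
  rewrite exprZn -exprM leE !scalerDr scalerA -exprD subnKC; last exact: ltnW.
  by rewrite -scalerAl scalerN alg_polyC.
have A0 : map_poly (@fps_coef0 K) A = (io c)%:P.
  rewrite rmorphD /= map_polyC /= map_polyZ /= fps_coef0_varX // scale0r.
  by rewrite addr0.
have cG : map_poly (@fps_coef0 K) (map_poly ccst G) = map_poly io G.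
  by rewrite -map_poly_comp; apply: eq_map_poly.
have R0 : map_poly (@fps_coef0 K) R = (io G.[c])%:P * 'X^e - 1.
  rewrite rmorphD rmorphB rmorphM /= map_polyXn rmorph1 map_polyZ /=.
  rewrite fps_coef0_varX ?subn_gt0 // scale0r addr0 map_comp_poly A0 cG.
  by rewrite comp_polyCr horner_map mulrC.
have [||Y [Y0 RY]] := @hensel K R (io x).
- by rewrite R0 rootE !hornerE -rmorphXn -rmorphM mulrC xG rmorph1 subrr.
- rewrite R0 !derivE subr0 rootE hornerM hornerC hornerMn hornerXn.
  rewrite mulf_neq0 ?fmorph_eq0 // -mulr_natl mulf_neq0 //.
    by rewrite -(rmorph_nat io) fmorph_eq0 charC.
  by rewrite expf_neq0 // fmorph_eq0.
have AY : A.[Y] = ccst c + u ^+ l * Y by rewrite !hornerE.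
have R'0 : fps_coef0 R^`().[Y] = io (e%:R * x ^+ e.-1 * G.[c]).
  rewrite -horner_map /= Y0 -deriv_map R0 !derivE subr0 hornerM hornerC hornerMn hornerXn.
  rewrite -mulr_natl.
  by rewrite !rmorphM rmorph_nat rmorphXn mulrC.
have [y yE] := closed_root_exp (e%:R * x ^+ e.-1 * G.[c]) m0.
have y0 : y != 0.
  apply: contraTneq (isT : true) => y0; have := yE; rewrite y0 expr0n eqn0Ngt m0.
  by move/esym/eqP; rewrite !mulf_eq0 (negPf (charC e0)) expf_eq0 (negPf x0)
    (negPf G0) andbF.
have [b b0 bE] := fps_root_exp y0 (etrans R'0 (etrans (congr1 io (esym yE))
  (rmorphXn io m y))).
exists Y, b; split=> //.
- rewrite -AY; apply/rootP; rewrite -horner_comp D hornerZ (rootP RY).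
  by rewrite mulr0.
- by rewrite b0 fmorph_eq0.
have ul0 : u ^+ l != 0 by rewrite expf_neq0 // fps_var_neq0.
apply: (mulIf ul0); rewrite bE mulrAC -exprD -mulnSr prednK // leE.
have := congr1 (fun p : {poly fps K} => p^`().[Y]) D.
rewrite deriv_comp derivZ hornerZ hornerM horner_comp AY => <-; congr (_ * _).
by rewrite /A !derivE !hornerE.
Qed.
Variables (n : nat) (q0 : C) (rs : seq C).
Hypotheses (q00 : q0 != 0) (size_rs : size rs = n).
Hypothesis ME : M = q0 *: \prod_(c <- rs) ('X - c%:P).
Hypotheses (size_P : (size P <= n.+1)%N) (NE : N = n`!).

Lemma arc_neq0 : M != 0.
Proof. by rewrite ME scaler_eq0 negb_or q00 monic_neq0 // monic_prod_XsubC. Qed.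
Let M0 := arc_neq0.

Lemma mup_arc c : mup c M = count_mem c rs.
Proof.
by rewrite ME -mul_polyC mupMr ?mu_prod_XsubC // rootC.
Qed.

Definition arc_root_spec c x tau := exists Y b,
  let l := (m * (N %/ mup c M))%N in
  [/\ tau = ccst c + u ^+ l * Y, fps_coef0 Y = io x, root arc_poly tau,
      fps_coef0 b != 0
    & arc_poly^`().[tau] = u ^+ (l * (mup c M).-1) * b ^+ m].

Lemma mup_dvd_fact c : root M c -> (0 < mup c M)%N && (mup c M %| N)%N.
Proof.
move=> Mc; rewrite -XsubC_dvd // dvdp_XsubCl Mc NE dvdn_fact //.
by rewrite -XsubC_dvd // dvdp_XsubCl Mc mup_arc -size_rs count_size.
Qed.

Lemma arc_root_exp c l : (0 < l)%N -> forall Y,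
  fps_coef0 (ccst c + u ^+ l * Y) = io c.
Proof.
by move=> l0 Y; rewrite fps_coef0D fps_coef0_mul_var // addr0.
Qed.

Hypothesis n0 : (0 < n)%N.

Lemma size_arc_poly : size arc_poly = n.+1.
Proof.
have sM : size M = n.+1 by rewrite ME size_scale // size_prod_XsubC size_rs.
have E0 : (0 < E)%N by rewrite muln_gt0 m0.
apply/eqP; rewrite eqn_leq; apply/andP; split.
  rewrite (leq_trans (size_polyD _ _)) // geq_max (leq_trans (size_polyD _ _)).
    rewrite (leq_trans (size_scale_leq _ _)) // size_map_poly; exact: size_P.
  rewrite geq_max size_polyN size_map_poly sM leqnn size_polyC.
  by case: (_ == 0) => //=.
have : arc_poly`_n != 0.
  apply: contra_neq (q00) => /(congr1 (@fps_coef0 K)).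
  rewrite coefD coefB coefC gtn_eqF // subr0 coefZ !coef_map.
  rewrite fps_coef0D fps_coef0_mul_var ?(leq_ltn_trans _ EKx) // addr0.
  rewrite ccst0 => /eqP; rewrite fmorph_eq0 -[n]/(n.+1.-1) -{1}sM -lead_coefE.
  by rewrite ME lead_coefZ (monicP (monic_prod_XsubC _ _ _)) mulr1 => /eqP.
by apply: contraNT; rewrite -leqNgt => sa; rewrite nth_default.
Qed.

(** The clusters give [n] distinct roots: two roots with different [c] have different
    reductions, and two roots with the same [c] differ in the leading term [x u^l] of
    [T - c]. As the degree is [n], there are no others. *)
Lemma arc_roots : exists (T : C -> C -> fps K) (S : seq (C * C)),
  [/\ forall c x, ((c, x) \in S)
        = root M c && (x ^+ mup c M * (mup_cofactor M c).[c] == 1),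
      forall c x, (c, x) \in S -> arc_root_spec c x (T c x)
    & map_poly (fps_frac K) arc_poly = fps_frac K (lead_coef arc_poly)
        *: \prod_(s <- S) ('X - (fps_frac K (T s.1 s.2))%:P)].
Proof.
have solsP c : exists s : seq C, root M c ->
    [/\ uniq s, size s = mup c M
      & forall x, (x \in s) = (x ^+ mup c M * (mup_cofactor M c).[c] == 1)].
  have [Mc|] := boolP (root M c); last by exists [::].
  have /andP[e0 _] := mup_dvd_fact Mc; have g0 := mup_cofactor_neq0 c M0.
  have [s [us ss sE]] := exp_roots charC e0 (invr_neq0 g0).
  exists s => _; split=> // x.
  by rewrite sE -[RHS](inj_eq (mulIf (invr_neq0 g0))) mulfK // mul1r.
pose sols c := projT1 (cid (solsP c)).
have solE c (Mc : root M c) := projT2 (cid (solsP c)) Mc; rewrite -/(sols _) in solE.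
have rootM c : root M c = (c \in rs).
  by rewrite ME rootE hornerZ mulf_eq0 (negPf q00) -rootE root_prod_XsubC.
pose S := [seq (c, x) | c <- undup rs, x <- sols c].
have SE c x : ((c, x) \in S)
    = root M c && (x ^+ mup c M * (mup_cofactor M c).[c] == 1).
  rewrite rootM; apply/allpairsPdep/andP => [[c' [x' [c'r x's [-> ->]]]]|[cr xE]].
    rewrite mem_undup in c'r; split=> //; rewrite -rootM in c'r.
    by have [_ _ <-] := solE _ c'r.
  exists c, x; rewrite mem_undup; split=> //; rewrite -rootM in cr.
  by have [_ _ ->] := solE _ cr.
have Tex c x : exists tau, (c, x) \in S -> arc_root_spec c x tau.
  have [cxS|] := boolP ((c, x) \in S); last by exists 0.
  move: (cxS); rewrite SE => /andP[Mc /eqP xE]; have /andP[e0 eN] := mup_dvd_fact Mc.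
  have [Y [b [Y0 rt b0 d]]] := cluster_root (mup_cofactorE c M0) e0 eN xE.
  by exists (ccst c + u ^+ (m * (N %/ mup c M)) * Y) => _; exists Y, b.
pose T c x := projT1 (cid (Tex c x)).
have TP c x : (c, x) \in S -> arc_root_spec c x (T c x).
  exact: projT2 (cid (Tex c x)).
have l0 c : root M c -> (0 < m * (N %/ mup c M))%N.
  by move=> /mup_dvd_fact/andP[e0 eN]; rewrite muln_gt0 m0 divn_gt0 // dvdn_leq.
exists T, S; split=> //.
have sS : size S = n.
  rewrite size_allpairs_dep -size_rs.
  have -> : [seq size (sols c) | c <- undup rs] = [seq count_mem c rs | c <- undup rs].
    apply/eq_in_map => c; rewrite mem_undup -rootM => Mc.
    by have [_ -> _] := solE _ Mc; rewrite mup_arc.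
  by rewrite -(perm_size (perm_count_undup rs)) size_flatten /shape -map_comp;
    congr sumn; apply: eq_map => c /=; rewrite size_nseq.
pose TS := [seq fps_frac K (T s.1 s.2) | s <- S].
have uS : uniq S.
  apply: allpairs_uniq_dep => [|c|[c x] [c' x'] _ _ [-> ->]] //.
    exact: undup_uniq.
  by rewrite mem_undup -rootM => Mc; have [] := solE _ Mc.
have uTS : uniq TS.
  rewrite map_inj_in_uniq // => -[c x] [c' x'] sS1 sS2 /= /fps_frac_inj eT.
  have [Y [b [tE Y0 _ _ _]]] := TP _ _ sS1.
  have [Y' [b' [tE' Y0' _ _ _]]] := TP _ _ sS2.
  have Mc : root M c by move: sS1; rewrite SE => /andP[].
  have Mc' : root M c' by move: sS2; rewrite SE => /andP[].
  have cc' : c = c'.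
    have := congr1 (@fps_coef0 K) eT.
    by rewrite tE tE' !arc_root_exp ?l0 // => /fmorph_inj.
  subst c'; move: eT; rewrite tE tE' => /addrI/mulfI YY'.
  congr (_, _); apply: (fmorph_inj io); rewrite -Y0 -Y0' YY' //.
  by rewrite expf_neq0 // fps_var_neq0.
have := all_roots_prod_XsubC (p := map_poly (fps_frac K) arc_poly) (rs := TS).
rewrite big_map; have -> : lead_coef (map_poly (fps_frac K) arc_poly)
    = fps_frac K (lead_coef arc_poly).
  by rewrite lead_coef_map_inj //; apply: fps_frac_inj.
apply.
- rewrite size_map sS size_map_inj_poly ?rmorph0 //; last exact: fps_frac_inj.
  exact: size_arc_poly.
- apply/allP => _ /mapP[[c x] cxS ->] /=.
  have [Y [b [_ _ rt _ _]]] := TP _ _ cxS.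
  by rewrite rootE horner_map (rootP rt) rmorph0.
- by rewrite uniq_rootsE.
Qed.

End Arc.

(** * Inertia elements *)

Lemma expr_eq_prim (K : fieldType) m (z x y : K) : m.-primitive_root z ->
  y != 0 -> x ^+ m = y ^+ m -> exists k, x = z ^+ k * y.
Proof.
move=> zP y0 e; have /(prim_rootP zP)[k kE] : (x / y) ^+ m = 1.
  by rewrite expr_div_n e divff // expf_neq0.
by exists k; rewrite -kE divfK.
Qed.

Lemma splits_Xn_sub (K : fieldType) m (z y : K) : m.-primitive_root z ->
  y != 0 -> splits ('X^m - (y ^+ m)%:P).
Proof.
move=> zP y0; have m0 := prim_order_gt0 zP.
exists 1, [seq z ^+ k * y | k : 'I_m]; rewrite scale1r.
have := @all_roots_prod_XsubC K ('X^m - (y ^+ m)%:P) [seq z ^+ k * y | k : 'I_m].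
rewrite (monicP (monicXnsubC _ m0)) scale1r; apply.
- by rewrite size_XnsubC // size_map size_enum_ord.
- apply/allP => _ /mapP[k _ ->].
  by rewrite rootE !hornerE exprMn exprAC (prim_expr_order zP) expr1n mul1r subrr.
- rewrite uniq_rootsE map_inj_uniq ?enum_uniq // => i j /(mulIf y0)/eqP.
  rewrite (eq_prim_root_expr zP) /= => /eqP ij; apply: val_inj.
  by move: ij; rewrite !modn_small.
Qed.

Section ArcPhi.
Variables (C : closedFieldType) (F : fieldType) (io : {rmorphism C -> F}).
Hypothesis charC : forall k, (0 < k)%N -> k%:R != 0 :> C.
Variables (n m : nat).
Hypotheses (m0 : (0 < m)%N) (n0 : (0 < n)%N).
Let N := n`!.
Let E := (m * N)%N.
Let Kx := (m * (2 * E))%N.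
Variables (M : {poly C}) (q0 : C) (rs : seq C).
Hypotheses (q00 : q0 != 0) (size_rs : size rs = n).
Hypothesis ME : M = q0 *: \prod_(c <- rs) ('X - c%:P).
Variables (P : {poly F}) (phi : {rmorphism F -> laurent F}).
Hypotheses (size_P : (size P <= n.+1)%N).
Hypothesis phi_io : forall c, phi (io c) = laurent_const F (io c).
Local Notation U := (laurent_var F).
Hypothesis phiP : U ^+ Kx *: map_poly phi P
  = map_poly (fps_frac F) (arc_poly io m N Kx M P).
Variables (w : C) (rho : {rmorphism laurent F -> laurent F}).
Hypothesis wP : E.-primitive_root w.
Hypothesis rhoE : forall f, rho (fps_frac F f) = fps_frac F (fps_scale (io w) f).
Hypothesis rho_phi : forall c, rho (phi c) = phi c.

Let N0 : (0 < N)%N. Proof. exact: fact_gt0. Qed.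
Let E0 : (0 < E)%N. Proof. by rewrite muln_gt0 m0. Qed.
Let EKx : (E < Kx)%N.
Proof.
have EmE : (E <= m * E)%N by rewrite leq_pmull.
by rewrite /Kx mulnCA mul2n -addnn -addn1 leq_add // (leq_trans E0 EmE).
Qed.

Local Notation Q := (arc_poly io m N Kx M P).

Lemma scale_varX k f : (E %| k)%N ->
  fps_scale (io w) (fps_var F ^+ k * f) = fps_var F ^+ k * fps_scale (io w) f.
Proof.
move=> /dvdnP[q ->]; rewrite rmorphM rmorphXn /= fps_scale_var exprMn -rmorphXn.
by rewrite -rmorphXn mulnC exprM (prim_expr_order wP) expr1n !rmorph1 mul1r.
Qed.

Lemma scale_arc_poly : map_poly (fps_scale (io w)) Q = Q.
Proof.
have sc (p : {poly F}) : map_poly (fps_scale (io w)) (map_poly (@fps_const F) p)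
    = map_poly (@fps_const F) p.
  by rewrite -map_poly_comp; apply: eq_map_poly => c /=; rewrite fps_scale_const.
have cc : map_poly (ccst io) M = map_poly (@fps_const F) (map_poly io M).
  by rewrite map_poly_comp.
rewrite rmorphD rmorphB /= map_polyC map_polyZ /= cc !sc.
rewrite -[_ ^+ E]mulr1 -[_ ^+ Kx]mulr1 !scale_varX ?dvdnn ?rmorph1 //.
  by rewrite !mulr1 -cc.
by rewrite /Kx mulnA dvdn_mull.
Qed.

Let arcR := arc_roots io charC m0 N0 EKx q00 size_rs ME size_P (erefl N) n0.
Definition arc_T := projT1 (cid arcR).
Definition arc_S := projT1 (cid (projT2 (cid arcR))).
Local Notation T := arc_T.
Local Notation S := arc_S.
Lemma arc_TS : [/\ forall c x, ((c, x) \in S)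
        = root M c && (x ^+ mup c M * (mup_cofactor M c).[c] == 1),
      forall c x, (c, x) \in S -> arc_root_spec io m N Kx M P c x (T c x)
    & map_poly (fps_frac F) Q = fps_frac F (lead_coef Q)
        *: \prod_(s <- S) ('X - (fps_frac F (T s.1 s.2))%:P)].
Proof. exact: projT2 (cid (projT2 (cid arcR))). Qed.

Let l c := (m * (N %/ mup c M))%N.

Lemma arc_rootP tau : root (map_poly (fps_frac F) Q) tau ->
  exists c x, (c, x) \in S /\ tau = fps_frac F (T c x).
Proof.
have [_ _ ->] := arc_TS => rt.
have l0 : fps_frac F (lead_coef Q) != 0.
  rewrite fps_frac_eq0 lead_coef_eq0 -size_poly_eq0.
  by rewrite (size_arc_poly io m0 N0 EKx q00 size_rs ME size_P n0).
move: rt; rewrite rootZ // -(big_map (fun s => fps_frac F (T s.1 s.2)) xpredT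
  (fun y => 'X - y%:P)) root_prod_XsubC => /mapP[[c x] cxS ->].
by exists c, x.
Qed.

Lemma phiP_root tau : root (map_poly phi P) tau ->
  exists c x, (c, x) \in S /\ tau = fps_frac F (T c x).
Proof.
move=> rt; apply: arc_rootP; rewrite -phiP rootZ //.
by rewrite expf_neq0 // laurent_var_neq0.
Qed.

Lemma arc_l c x : (c, x) \in S -> [/\ root M c, (0 < mup c M)%N,
  (0 < l c)%N & (l c * mup c M)%N = E].
Proof.
have [-> _ _] := arc_TS => /andP[Mc _].
have /andP[e0 eN] := mup_dvd_fact q00 size_rs ME (erefl N) Mc.
split=> //; first by rewrite muln_gt0 m0 divn_gt0 // dvdn_leq.
by rewrite -mulnA divnK.
Qed.

(** Since [rho] fixes the polynomial it permutes its roots; which root is reached is seen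
    on the leading term [x u^l], which becomes [w^l x u^l]. *)
Lemma scale_arc_root c x : (c, x) \in S -> (c, w ^+ l c * x) \in S /\
  rho (fps_frac F (T c x)) = fps_frac F (T c (w ^+ l c * x)).
Proof.
move=> cxS; have [Mc e0 l0 _] := arc_l cxS; have [SE TP _] := arc_TS.
have [Y [b [tE Y0 rt b0 _]]] := TP _ _ cxS.
have [c' [x' [cxS']]] : exists c' x', (c', x') \in S /\
    fps_frac F (fps_scale (io w) (T c x)) = fps_frac F (T c' x').
  apply: arc_rootP; rewrite rootE horner_map -{1}scale_arc_poly horner_map.
  by rewrite (rootP rt) !rmorph0.
rewrite rhoE => /fps_frac_inj eT; have [Mc' _ l0' _] := arc_l cxS'.
have [Y' [b' [tE' Y0' _ _ _]]] := TP _ _ cxS'.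
have cc' : c = c'.
  have := congr1 (@fps_coef0 F) eT; rewrite fps_coef0_scale tE tE'.
  by rewrite (arc_root_exp io c l0) (arc_root_exp io c' l0') => /fmorph_inj.
subst c'; suff xx : x' = w ^+ l c * x by rewrite -xx eT.
move: eT; rewrite tE tE' rmorphD rmorphM rmorphXn /= fps_scale_const fps_scale_var.
rewrite exprMn -rmorphXn -/(l c) -mulrA mulrCA => /addrI.
move/mulfI; rewrite expf_neq0 ?fps_var_neq0 // => /(_ isT)/(congr1 (@fps_coef0 F)).
rewrite Y0' fps_coef0M fps_coef0_scale Y0 -?rmorphXn ?fps_constK -?rmorphXn -rmorphM.
by move=> /fmorph_inj.
Qed.

Lemma iter_scale_arc_root c x k : (c, x) \in S -> (c, w ^+ (l c * k) * x) \in S /\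
  iter k rho (fps_frac F (T c x)) = fps_frac F (T c (w ^+ (l c * k) * x)).
Proof.
move=> cxS; elim: k => [|k [IHS IH]]; first by rewrite muln0 mul1r.
by have := scale_arc_root IHS; rewrite /= IH mulnS exprD mulrA.
Qed.

Lemma arc_root_orbit c x x' : (c, x) \in S -> (c, x') \in S ->
  exists k, iter k rho (fps_frac F (T c x)) = fps_frac F (T c x').
Proof.
move=> cxS cxS'; have [_ e0 l0 le] := arc_l cxS.
have [SE _ _] := arc_TS; move: (cxS) (cxS').
rewrite !SE => /andP[_ /eqP xE] /andP[_ /eqP xE'].
have zP : (mup c M).-primitive_root (w ^+ l c).
  have := dvdn_prim_root wP (_ : (mup c M %| E)%N); rewrite -le dvdn_mull //.
  by rewrite mulnK // => ->.
have x0 : x != 0.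
  by apply: contra_eq_neq xE => ->; rewrite expr0n eqn0Ngt e0 mul0r eq_sym oner_eq0.
have g0 := mup_cofactor_neq0 c (arc_neq0 q00 ME).
have [k kE] := expr_eq_prim zP x0 (mulIf g0 (etrans xE' (esym xE))).
by exists k; have [_ ->] := iter_scale_arc_root k cxS; rewrite exprM kE.
Qed.

Let wm := w ^+ N.
Lemma wmP : m.-primitive_root wm.
Proof. by have := dvdn_prim_root wP (dvdn_mulr N (dvdnn m)); rewrite mulKn. Qed.

Let cst (c : C) : laurent F := laurent_const F (io c).
Lemma cst_wmP : m.-primitive_root (cst wm).
Proof. by rewrite /cst !fmorph_primitive_root wmP. Qed.

Lemma arc_derivative c x : (c, x) \in S -> exists2 b, fps_coef0 b != 0 &
  U ^+ Kx * (map_poly phi P)^`().[fps_frac F (T c x)]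
    = (U ^+ (N %/ mup c M * (mup c M).-1) * fps_frac F b) ^+ m.
Proof.
move=> cxS; have [_ TP _] := arc_TS.
have [Y [b [tE Y0 rt b0 d]]] := TP _ _ cxS; exists b => //.
rewrite -hornerZ -derivZ phiP deriv_map horner_map /= d.
rewrite rmorphM !rmorphXn [RHS]exprMn -exprM; congr (_ ^+ _ * _).
by rewrite -mulnA mulnC.
Qed.

Lemma phiP_splits : splits (map_poly phi P).
Proof.
have [_ _ e] := arc_TS; exists (U ^- Kx * fps_frac F (lead_coef Q)).
exists [seq fps_frac F (T s.1 s.2) | s <- S]; rewrite big_map -scalerA -e -phiP.
by rewrite scalerA mulVf ?scale1r // expf_neq0 // laurent_var_neq0.
Qed.

Lemma iter_rho_phi_root (th : {poly F}) k tau :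
  root (map_poly phi th) tau -> root (map_poly phi th) (iter k rho tau).
Proof.
move=> rt; have e : map_poly rho (map_poly phi th) = map_poly phi th.
  by rewrite -map_poly_comp; apply: eq_map_poly => c /=; rewrite rho_phi.
elim: k => [|k IHk]; first exact: rt.
by move: IHk; rewrite -(fmorph_root rho) e iterS.
Qed.

(** When [M] is a multiple of [T^n] there is a single cluster, so [rho] permutes the [n]
    roots cyclically; a factor over [F] is fixed by [rho], so it has all of them. *)
Lemma arc_factor_size (th : {poly F}) : M = q0 *: 'X^n -> P != 0 ->
  th %| P -> (1 < size th)%N -> (n < size th)%N.
Proof.
move=> MX P0 thP sth.
have th0 : th != 0 by rewrite -size_poly_gt0 ltnW.
have [z zr] : exists z, root (map_poly phi th) z.
  apply: (splits_root (q := map_poly phi P)); rewrite ?map_poly_eq0 ?dvdp_map //.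
    exact: phiP_splits.
  by rewrite size_map_poly.
have [c [x [cxS zE]]] : exists c x, (c, x) \in S /\ z = fps_frac F (T c x).
  by apply: phiP_root; apply: root_dvdp zr; rewrite dvdp_map.
have [Mc e0 l0 le] := arc_l cxS.
have c0 : c = 0.
  move: Mc; rewrite MX rootE !hornerE mulf_eq0 (negPf q00) expf_eq0 n0 /=.
  by move/eqP.
have eN : mup c M = n.
  rewrite MX -mul_polyC mupMr ?rootC // c0 -['X]subr0 -polyC0 mup_XsubCX.
  by rewrite eqxx.
have zP : n.-primitive_root (w ^+ l c).
  have := dvdn_prim_root wP (_ : (n %| E)%N); rewrite -le eN dvdn_mull //.
  by rewrite mulnK // => ->.
pose r k := iter k rho z.
have rE k : r k = fps_frac F (T c ((w ^+ l c) ^+ k * x)).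
  by rewrite /r zE; have [_ ->] := iter_scale_arc_root k cxS; rewrite exprM.
have x0 : x != 0.
  have [SE _ _] := arc_TS; move: (cxS); rewrite SE => /andP[_].
  by apply: contraTneq => ->; rewrite eN expr0n eqn0Ngt n0 mul0r eq_sym oner_eq0.
have [_ TP _] := arc_TS.
have rI : injective (fun k : 'I_n => r k).
  move=> i j; rewrite !rE => /fps_frac_inj eT.
  have si k : (c, (w ^+ l c) ^+ k * x) \in S.
    by rewrite -exprM; have [] := iter_scale_arc_root k cxS.
  have [Y [b [tE Y0 _ _ _]]] := TP _ _ (si i).
  have [Y' [b' [tE' Y0' _ _ _]]] := TP _ _ (si j).
  move: eT; rewrite tE tE' => /addrI/mulfI; rewrite expf_neq0 ?fps_var_neq0 //.
  move=> /(_ isT)/(congr1 (@fps_coef0 F)); rewrite Y0 Y0' => /fmorph_inj/(mulIf x0).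
  move/eqP; rewrite (eq_prim_root_expr zP) !modn_small // => /eqP ij.
  exact: val_inj.
rewrite -(size_map_poly phi) -[X in (X < _)%N](size_enum_ord n).
rewrite -(size_map (fun k : 'I_n => r k)); apply: max_poly_roots.
- by rewrite map_poly_eq0.
- by apply/allP => _ /mapP[k _ ->]; apply: iter_rho_phi_root.
- by rewrite map_inj_uniq ?enum_uniq.
Qed.

Section ArcGalois.
Variables (Nf : splittingFieldType F) (t a : 'I_n -> Nf).
Hypothesis P0 : P != 0.
Local Notation PN := (map_poly (in_alg Nf) P).
Hypothesis tE : PN = lead_coef PN *: \prod_i ('X - (t i)%:P).
Hypothesis aE : forall i, a i ^+ m = (PN^`()).[t i].
Hypothesis gen : forall V : {subfield Nf},
  (forall i, t i \in V) -> (forall i, a i \in V) -> ({:Nf} <= V)%VS.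

Lemma root_t i : root PN (t i).
Proof.
by rewrite tE rootE hornerZ horner_prod (bigD1 i) //= hornerXsubC subrr mul0r mulr0.
Qed.

Lemma derivative_neq0 c x : (c, x) \in S ->
  (map_poly phi P)^`().[fps_frac F (T c x)] != 0.
Proof.
move=> cxS; have [b b0 e] := arc_derivative cxS.
apply: contraNneq b0 => d0; move: e; rewrite d0 mulr0 => /esym/eqP.
rewrite expf_eq0 m0 mulf_eq0 expf_eq0 (negPf (laurent_var_neq0 _)) andbF /=.
by rewrite fps_frac_eq0 => /eqP ->.
Qed.

Lemma derivative_exp c x : (c, x) \in S -> exists2 y, y != 0 &
  (map_poly phi P)^`().[fps_frac F (T c x)] = y ^+ m.
Proof.
move=> cxS; have [b b0 e] := arc_derivative cxS.
have U0 : U ^+ (2 * E) != 0 by rewrite expf_neq0 // laurent_var_neq0.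
exists (U ^+ (N %/ mup c M * (mup c M).-1) * fps_frac F b / U ^+ (2 * E)).
  rewrite !mulf_neq0 ?invr_neq0 ?expf_neq0 ?laurent_var_neq0 //.
  by rewrite fps_frac_eq0; apply: contraNneq b0 => ->.
rewrite expr_div_n -e -exprM [(2 * E * m)%N]mulnC mulrC mulKf //.
by rewrite expf_neq0 // laurent_var_neq0.
Qed.

(** All the polynomials that define the successive generators split over the Laurent
    series: [P] by [phiP_splits], and [X^m - P'(t_i)] by [derivative_exp] and the presence
    of the [m]-th roots of unity. *)
Lemma arc_embedding : exists psi : {rmorphism Nf -> laurent F},
  forall c, psi c%:A = phi c.
Proof.
have [psi0 psi0E] := extend_base Nf phi.
have inj0 (c : F) : vsval (c%:A : subvs_of (1%AS : {subfield Nf})) = c%:A.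
  by rewrite /= algid1.
have PN1 (V : {subfield Nf}) : map_poly vsval (map_poly (in_alg (subvs_of V)) P) = PN.
  by rewrite -map_poly_comp; apply: eq_map_poly => c /=; rewrite algid1.
have [|psi1 e1] := extend_seq (psi := psi0) (s := codom t).
  move=> _ /codomP[i ->]; exists (map_poly (in_alg _) P).
  rewrite map_poly_eq0 P0 PN1 root_t; split=> //.
  rewrite -map_poly_comp (eq_map_poly (g := phi)); first exact: phiP_splits.
  by move=> c /=; rewrite psi0E.
pose E1 := <<1%AS & codom t>>%AS.
have tE1 i : t i \in E1 by apply: seqv_sub_adjoin; apply: codom_f.
have psi1E c : psi1 c%:A = phi c.
  by rewrite -psi0E; apply: e1; rewrite /= !algid1.
have phi1 : map_poly psi1 (map_poly (in_alg (subvs_of E1)) P) = map_poly phi P.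
  by rewrite -map_poly_comp; apply: eq_map_poly => c /=; rewrite psi1E.
have [|psi2 e2] := extend_seq (psi := psi1) (s := codom a).
  move=> _ /codomP[i ->]; pose ti : subvs_of E1 := Subvs (tE1 i).
  pose d := (map_poly (in_alg (subvs_of E1)) P)^`().[ti].
  exists ('X^m - d%:P); split.
  - by rewrite -size_poly_gt0 size_XnsubC.
  - rewrite rmorphB /= map_polyXn map_polyC /= rootE !hornerE aE.
    rewrite -(horner_map (vsval : {rmorphism _ -> Nf})) /= -deriv_map PN1.
    by rewrite subrr.
  rewrite rmorphB /= map_polyXn map_polyC /= -horner_map /= -deriv_map phi1.
  have [c [x [cxS ->]]] : exists c x, (c, x) \in S /\ psi1 ti = fps_frac F (T c x).
    apply: phiP_root; rewrite -phi1 fmorph_root.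
    by rewrite -(fmorph_root (vsval : {rmorphism _ -> Nf})) PN1 root_t.
  have [y y0 ->] := derivative_exp cxS.
  exact: splits_Xn_sub cst_wmP y0.
have /subvP full : ({:Nf} <= <<E1 & codom a>>)%VS.
  apply: (gen (V := <<E1 & codom a>>%AS)) => i.
    exact: (subvP (subv_adjoin_seq _ _)).
  by apply: seqv_sub_adjoin; apply: codom_f.
have [||psi psiE] := lift_to_fractions (g := psi2)
    (f := vsval : {rmorphism subvs_of <<E1 & codom a>>%AS -> Nf}).
- by move=> b; split=> /eqP; rewrite fmorph_eq0 => /eqP ->; rewrite rmorph0.
- move=> b; exists (Subvs (full b (memvf b))), 1.
  by rewrite rmorph1 oner_eq0 divr1.
exists psi => c; rewrite -psi1E.
have -> : c%:A = vsval (c%:A : subvs_of <<E1 & codom a>>%AS) by rewrite /= algid1.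
by rewrite psiE; apply: e2; rewrite /= !algid1.
Qed.

Lemma arc_reduction : map_poly (@fps_coef0 F) Q = map_poly io M.
Proof.
rewrite rmorphD rmorphB /= map_polyC map_polyZ /= !fps_coef0_varX //; last first.
  exact: ltn_trans EKx.
rewrite scale0r addr0 subr0 -map_poly_comp.
exact: eq_map_poly.
Qed.

(** The element of inertia: it is induced by [u |-> w u] through an embedding of the
    splitting field in the Laurent series, and [res i] is the root of [M] to which [t i]
    reduces. In a cluster of size [e], [a i] is a unit times [u^(h - 2E)] with
    [h e = N (e - 1)]; as [w^E = 1], applying [u |-> w u] [e] times multiplies it by
    [w^(N (e - 1))], where [w^N] is a primitive [m]-th root of unity. *)
Lemma arc_galois : exists (g : gal_of {:Nf}) (res : 'I_n -> C),
  [/\ g \in 'Gal({:Nf} / 1)%g,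
      M = q0 *: \prod_i ('X - (res i)%:P),
      forall i j, g (t i) = t j -> res j = res i,
      forall i j, res i = res j -> exists k, (g ^+ k)%g (t i) = t j
    & forall i, (g ^+ mup (res i) M)%g (a i)
        = (io (wm ^+ (mup (res i) M).-1))%:A * a i].
Proof.
have [psi psiE] := arc_embedding.
have [g gG gE] := galois_of_embeddings (psi := psi) (psi2 := rho \o psi)
  (fun c => etrans (congr1 rho (psiE c)) (etrans (rho_phi c) (esym (psiE c)))).
have gkE k x : psi ((g ^+ k)%g x) = iter k rho (psi x).
  elim: k => [|k IHk]; first by rewrite expg0 gal_id.
  by rewrite expgSr galM ?memvf // gE /= IHk.
have psiP : map_poly psi PN = map_poly phi P.
  by rewrite -map_poly_comp; apply: eq_map_poly => c; apply: psiE.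
have idx i : exists s, s \in S /\ psi (t i) = fps_frac F (T s.1 s.2).
  have [|c [x [cxS e]]] := @phiP_root (psi (t i)).
    by rewrite -psiP fmorph_root root_t.
  by exists (c, x).
pose s i := projT1 (cid (idx i)).
have sP i : s i \in S /\ psi (t i) = fps_frac F (T (s i).1 (s i).2).
  exact: projT2 (cid (idx i)).
have sS i : ((s i).1, (s i).2) \in S by case: (s i) (sP i) => c x [].
have tS i : psi (t i) = fps_frac F (T (s i).1 (s i).2) by case: (sP i).
have [SE TP _] := arc_TS.
have T0 c x : (c, x) \in S -> fps_coef0 (T c x) = io c.
  move=> cxS; have [_ _ l0 _] := arc_l cxS.
  have [Y [b [-> _ _ _ _]]] := TP _ _ cxS; by rewrite (arc_root_exp io c l0).
exists g, (fun i => (s i).1); split=> //.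
- have QE : Q = lead_coef Q *: \prod_i ('X - (T (s i).1 (s i).2)%:P).
    apply: (map_inj_poly (@fps_frac_inj F) (rmorph0 _)).
    have e : map_poly (fps_frac F) Q = (U ^+ Kx * psi (lead_coef PN))
        *: \prod_i ('X - (psi (t i))%:P).
      rewrite -phiP -psiP {1}tE map_polyZ /= scalerA rmorph_prod; congr (_ *: _).
      by apply: eq_bigr => i _; rewrite /= map_polyXsubC.
    rewrite e map_polyZ /= rmorph_prod; congr (_ *: _).
      have := congr1 (fun p : {poly laurent F} => lead_coef p) e.
      rewrite lead_coefZ (monicP (monic_prod_XsubC _ _ _)) mulr1 => <-.
      by rewrite lead_coef_map_inj //; apply: fps_frac_inj.
    by apply: eq_bigr => i _; rewrite /= map_polyXsubC tS.
  have e : map_poly io M = fps_coef0 (lead_coef Q)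
      *: \prod_i ('X - (io (s i).1)%:P).
    rewrite -arc_reduction {1}QE map_polyZ /= rmorph_prod; congr (_ *: _).
    by apply: eq_bigr => i _; rewrite -(T0 _ _ (sS i)); exact: map_polyXsubC.
  apply: (map_inj_poly (fmorph_inj io) (rmorph0 _)).
  rewrite map_polyZ /= rmorph_prod {1}e; congr (_ *: _).
    have := congr1 lead_coef e.
    rewrite lead_coefZ (monicP (monic_prod_XsubC _ _ _)) mulr1 => <-.
    rewrite lead_coef_map ME lead_coefZ (monicP (monic_prod_XsubC _ _ _)).
    by rewrite mulr1.
  by apply: eq_bigr => i _; rewrite /= map_polyXsubC.
- move=> i j gij; apply: (fmorph_inj io); rewrite -(T0 _ _ (sS i)) -(T0 _ _ (sS j)).
  have := gE (t i); rewrite gij /= !tS.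
  have [s'S ->] := scale_arc_root (sS i) => /fps_frac_inj ->.
  by rewrite !T0.
- move=> i j rij; have sj : ((s i).1, (s j).2) \in S by rewrite rij.
  have [k kE] := arc_root_orbit (sS i) sj; exists k.
  by apply: (fmorph_inj psi); rewrite gkE !tS kE rij.
move=> i; set c := (s i).1; set x := (s i).2; set e := mup c M.
have cxS : (c, x) \in S := sS i.
have [Mc e0 l0 le] := arc_l cxS.
have [b b0 bE] := arc_derivative cxS.
have aphi : psi (a i) ^+ m = (map_poly phi P)^`().[fps_frac F (T c x)].
  by rewrite -rmorphXn aE -horner_map /= -deriv_map psiP tS.
have U0 k : U ^+ k != 0 by rewrite expf_neq0 // laurent_var_neq0.
have fb0 : fps_frac F b != 0.
  by rewrite fps_frac_eq0; apply: contraNneq b0 => ->.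
have [k0 k0E] : exists k, U ^+ (2 * E) * psi (a i)
    = cst wm ^+ k * (U ^+ (N %/ e * e.-1) * fps_frac F b).
  apply: (expr_eq_prim cst_wmP); first by rewrite mulf_neq0.
  by rewrite -bE -aphi exprMn -exprM; congr (U ^+ _ * _); rewrite mulnC.
have a0 : psi (a i) != 0.
  by have := derivative_neq0 cxS; rewrite -aphi expf_eq0 m0.
pose G : gal_of {:Nf} := (g ^+ e)%g.
have Gt : G (t i) = t i.
  apply: (fmorph_inj psi); rewrite gkE tS; have [_ ->] := iter_scale_arc_root e cxS.
  by rewrite le (prim_expr_order wP) mul1r.
have [k1 k1E] : exists k, psi (G (a i)) = cst wm ^+ k * psi (a i).
  apply: (expr_eq_prim cst_wmP) => //; rewrite -!rmorphXn; congr (psi _).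
  rewrite aE -horner_map /= Gt -deriv_map -map_poly_comp.
  congr (_^`().[_]); apply: eq_map_poly => z.
  by rewrite /= linearZ /= rmorph1.
pose h := (N %/ e * e.-1)%N; pose be := ccst io (wm ^+ k0) * b.
(* The pole of [a i] is cleared by [u^(2E)], a power that [rho] fixes. *)
have aF : U ^+ (2 * E) * psi (a i) = fps_frac F (fps_var F ^+ h * be).
  by rewrite k0E mulrCA [in RHS]rmorphM rmorphXn /be [in RHS]rmorphM /cst !rmorphXn.
have he : (h * e = N * e.-1)%N.
  rewrite /h mulnAC; congr (_ * _)%N; apply/eqP; rewrite -(eqn_pmul2l m0) mulnA.
  exact/eqP/le.
have iter_frac k f : iter k rho (fps_frac F f)
    = fps_frac F (iter k (fps_scale (io w)) f).
  by elim: k => //= k ->; rewrite rhoE.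
have iter_coef k f j : fcoef (iter k (fps_scale (io w)) f) j
    = io (w ^+ (j * k)) * fcoef f j.
  elim: k => [|k IHk]; first by rewrite muln0 rmorph1 mul1r.
  by rewrite iterS /= IHk mulrA -rmorphXn -rmorphM -exprD mulnS.
have iterM k x1 x2 : iter k rho (x1 * x2) = iter k rho x1 * iter k rho x2.
  by elim: k => //= k ->; rewrite rmorphM.
have iterU k : iter k rho (U ^+ (2 * E)) = U ^+ (2 * E).
  elim: k => //= k ->; rewrite -[U]/(fps_frac F (fps_var F)) -(rmorphXn (fps_frac F)).
  rewrite rhoE -[X in fps_scale _ X]mulr1 (scale_varX _ (dvdn_mull 2 (dvdnn E))).
  by rewrite rmorph1 mulr1.
have : fps_frac F (iter e (fps_scale (io w)) (fps_var F ^+ h * be))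
    = fps_frac F (ccst io (wm ^+ k1) * (fps_var F ^+ h * be)).
  rewrite -iter_frac -aF iterM iterU -gkE -/G k1E rmorphM -aF mulrCA.
  by rewrite /cst /= !rmorphXn.
(* Compare the lowest coefficients. *)
move=> /fps_frac_inj/(congr1 (fun f => fcoef f h)); rewrite iter_coef.
have v0 (f : fps F) : vanish 0 f by [].
have be0 : fps_coef0 be != 0.
  rewrite /be fps_coef0M mulf_neq0 // ccst0 fmorph_eq0 !expf_neq0 //.
  by rewrite (prim_root_eq0 wP) -lt0n.
have ch : fcoef (fps_var F ^+ h * be) h = fps_coef0 be.
  by rewrite -[X in fcoef _ X](addn0 h) (fcoefM_vanish (@vanish_varX F h) (v0 _))
     fcoef_varX eqxx mul1r.
have := fcoefM_vanish (v0 (ccst io (wm ^+ k1))) (vanishMl be (@vanish_varX F h)).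
rewrite add0n => ->; rewrite ch -[fcoef (ccst _ _) 0]/(io (wm ^+ k1)).
move=> /(mulIf be0)/fmorph_inj; rewrite he exprM -/wm => wk.
apply: (fmorph_inj psi); rewrite -/G k1E rmorphM psiE phi_io; congr (_ * _).
by rewrite wk /cst /= !rmorphXn.
Qed.

End ArcGalois.

End ArcPhi.

(** * Embeddings of the target function field in Laurent series *)

Lemma rmorph_mmap (n : nat) (A B D : comNzRingType) (f : {rmorphism A -> B})
    (th : {rmorphism B -> D}) (h : 'I_n -> B) (p : {mpoly A[n]}) :
  th (mmap f h p) = mmap (th \o f) (th \o h) p.
Proof.
rewrite /mmap rmorph_sum; apply: eq_bigr => x _; rewrite rmorphM rmorph_prod.
by congr (_ * _); apply: eq_bigr => i _; rewrite rmorphXn.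
Qed.

Lemma eq_mmap (n : nat) (A B : comNzRingType) (f g : A -> B)
    (h1 h2 : 'I_n -> B) (p : {mpoly A[n]}) :
  f =1 g -> h1 =1 h2 -> mmap f h1 p = mmap g h2 p.
Proof.
move=> fg h12; rewrite /mmap; apply: eq_bigr => x _; rewrite fg; congr (_ * _).
exact: mmap1_eq.
Qed.

Lemma opp_polyC (A : comNzRingType) (x : A) : - x%:P = x *: (- 1 : {poly A}).
Proof. by rewrite scalerN alg_polyC. Qed.

Section Outdeg.
Variable n : nat.
Hypothesis hn : (3 <= n)%N.

Lemma outdeg_inj : injective (@outdeg n).
Proof.
move=> i j; rewrite /outdeg => e; apply: val_inj => /=; move: e.
have := ltn_ord i; have := ltn_ord j.
move=> jn inn; do !case: ifP => //; lia.
Qed.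

Lemma outdeg_le i : (@outdeg n i <= n)%N.
Proof. by have := ltn_ord i; rewrite /outdeg; do !case: ifP => //; lia. Qed.

Lemma outdeg_neq1 i : @outdeg n i != 1%N.
Proof. by have := ltn_ord i; rewrite /outdeg; do !case: ifP => //; lia. Qed.

Lemma outdeg_surj j : (j <= n)%N -> j != 1%N -> exists i : 'I_n, outdeg i = j.
Proof.
move=> jn j1; pose i := (if j == 0 then n.-1 else if j == 2 then n - 2 else j - 3)%N.
have lt : (i < n)%N by rewrite /i; case: eqP => // _; try case: eqP; lia.
exists (Ordinal lt); rewrite /outdeg /= /i.
have [->|j0] := eqVneq j 0%N.
  by case: ltnP; try case: eqP; lia.
have [->|j2] := eqVneq j 2%N.
  by rewrite ltnn eqxx.
by case: ltnP; try case: eqP; lia.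
Qed.

Lemma coef_outdeg_sum (A : nzRingType) (h : nat -> A) :
  \sum_i h (@outdeg n i) *: 'X^(outdeg i)
    = \poly_(j < n.+1) (if j == 1%N then 0 else h j).
Proof.
apply/polyP => j; rewrite coef_sum coef_poly.
have [jn|nj] := ltnP j n.+1; last first.
  rewrite big1 // => i _; rewrite coefZ coefXn gtn_eqF ?mulr0 //.
  by rewrite (leq_ltn_trans (outdeg_le i)).
have [->|j1] := eqVneq j 1%N.
  by rewrite big1 // => i _; rewrite coefZ coefXn eq_sym (negPf (outdeg_neq1 i)) mulr0.
have [i0 iE] := outdeg_surj jn j1.
rewrite (bigD1 i0) //= coefZ coefXn iE eqxx mulr1 big1 ?addr0 // => i ii0.
rewrite coefZ coefXn -iE (inj_eq outdeg_inj) eq_sym (negPf ii0).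
by rewrite mulr0.
Qed.

End Outdeg.

Section Shift.
Variables (R : realType) (n : nat).
Hypothesis hn : (3 <= n)%N.
Variables (k : nat) (c : nat -> R[i]).
Hypothesis hk : (k <= n - 2)%N.
Variables (F : fieldType) (iota : {rmorphism R[i] -> F}) (w : 'I_n -> F).
Hypothesis hF : is_function_field (target_locus k c) iota w.
Variables (q0 r0 b0 : R[i]) (E Kx : nat).
Hypotheses (E0 : (0 < E)%N) (EKx : (E < Kx)%N).

Definition arc_base : {poly R[i]} := q0 *: 'X^n + r0 *: 'X^(n.-1) - b0%:P.

Definition shift_coef (j : nat) : R[i] :=
  if j == n then q0 else if j == n.-1 then r0 else if j == 0%N then b0 else 0.

(** The displaced coordinates as polynomials in [1/u]. The exponents [Kx] and [Kx - E] are
    positive, so that the value at [1/u = 0] is the original point. *)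
Definition shift_w (i : 'I_n) : {poly F} :=
  (w i)%:P + (iota (shift_coef (outdeg i))) *: 'X^Kx
  + (outdeg i == 0%N)%:R *: 'X^(Kx - E).

Local Notation U := (laurent_var F).
Local Notation lc := (laurent_const F).

Definition arc_w (i : 'I_n) : laurent F := (map_poly lc (shift_w i)).[U^-1].

Lemma shift_w_horner (L : fieldType) (f : {rmorphism F -> L}) (x : L) i :
  (map_poly f (shift_w i)).[x] = f (w i)
    + f (iota (shift_coef (outdeg i))) * x ^+ Kx
    + (outdeg i == 0%N)%:R * x ^+ (Kx - E).
Proof.
rewrite /shift_w !rmorphD /= !map_polyZ map_polyC /= !map_polyXn !hornerE.
by rewrite rmorph_nat.
Qed.

Lemma arc_wE i : arc_w i = lc (w i)
    + lc (iota (shift_coef (outdeg i))) * U^-1 ^+ Kx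
    + (outdeg i == 0%N)%:R * U^-1 ^+ (Kx - E).
Proof. exact: shift_w_horner. Qed.

Lemma target_locus_shift (v d : 'I_n -> R[i]) : target_locus k c v ->
  (forall i, (2 <= outdeg i <= k)%N -> d i = 0) ->
  target_locus k c (fun i => v i + d i).
Proof. by move=> vV d0 i ik; rewrite d0 // addr0 vV. Qed.

Lemma poly_eq0_const (h : {poly F}) : (forall s, h.[iota s] = 0) -> h = 0.
Proof.
move=> h0; apply/eqP; apply: contraT => hn0.
have := @max_poly_roots _ h [seq iota (val i)%:R | i : 'I_(size h)] hn0.
rewrite size_map size_enum_ord ltnn; apply.
  by apply/allP => _ /mapP[i _ ->]; rewrite rootE h0.
rewrite map_inj_uniq ?enum_uniq // => i j /fmorph_inj/eqP.
by rewrite eqr_nat => /eqP; apply: val_inj.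
Qed.

Lemma shift_coef_fixed (i : 'I_n) : (2 <= outdeg i <= k)%N ->
  shift_coef (outdeg i) = 0.
Proof.
move=> /andP[i2 ik]; rewrite /shift_coef.
case: eqP => [|_]; first by lia.
case: eqP => [|_]; first by lia.
by case: eqP => // i0; lia.
Qed.

(** A polynomial [f] that vanishes on the locus vanishes at the displaced point, because
    the locus is invariant under translation along the free coordinates [q], [r], [b].
    Conversely, if [f] vanishes at the displaced point, it does so for [1/u]
    indeterminate, by transcendence of [1/u]; then put [1/u = 0]. *)
Lemma shift_kernel (f : {mpoly R[i][n]}) :
  mmap iota w f = 0 <-> mmap (lc \o iota) arc_w f = 0.
Proof.
pose h := mmap (@polyC F \o iota) shift_w f.
have gE : mmap (lc \o iota) arc_w f = (map_poly lc h).[U^-1].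
  pose th : {rmorphism {poly F} -> laurent F} := horner_eval U^-1 \o map_poly lc.
  rewrite -[RHS]/(th h) rmorph_mmap; apply: eq_mmap => x //=.
  by rewrite /horner_eval map_polyC hornerC.
have hs s : h.[iota s] = mmap iota (fun i => w i + iota (shift_coef (outdeg i) * s ^+ Kx
     + (outdeg i == 0%N)%:R * s ^+ (Kx - E))) f.
  rewrite -[LHS]/(horner_eval (iota s) h) rmorph_mmap; apply: eq_mmap => x /=.
    by rewrite /horner_eval hornerC.
  rewrite /horner_eval -[shift_w x](@map_poly_id _ idfun) //.
  rewrite (shift_w_horner idfun) /= -addrA rmorphD !rmorphM !rmorphXn.
  by rewrite rmorph_nat.
split=> [f0|]; last first.
  rewrite gE => /laurent_varV_transc h0; move: (hs 0); rewrite h0 horner0 => /esym.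
  rewrite !expr0n !eqn0Ngt subn_gt0 EKx (ltn_trans E0 EKx) /= => e.
  rewrite -{}e; apply: eq_mmap => // i.
  by rewrite !mulr0 addr0 rmorph0 addr0.
rewrite gE (poly_eq0_const (h := h)) ?rmorph0 ?horner0 // => s; rewrite hs.
set d := (fun i : 'I_n => shift_coef (outdeg i) * s ^+ Kx
     + (outdeg i == 0%N)%:R * s ^+ (Kx - E)).
have -> : mmap iota (fun i => w i + iota (d i)) f
    = mmap iota w (mmap (@mpolyC n R[i]) (fun i => 'X_i + (d i)%:MP) f).
  rewrite rmorph_mmap; apply: eq_mmap => x /=; first by rewrite mmapC.
  by rewrite mmapD mmapX mmap1U mmapC.
apply/(proj1 hF) => v vV; move/(proj1 hF): f0 => f0.
rewrite /meval rmorph_mmap.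
have := f0 _ (target_locus_shift vV (d := d) _); rewrite /meval => <-.
  apply: eq_mmap => x /=; first by rewrite mmapC.
  by rewrite mmapD mmapX mmap1U mmapC.
move=> i ik; rewrite /d shift_coef_fixed // mul0r add0r.
by rewrite (negPf (_ : outdeg i != 0%N)) ?mul0r //; case/andP: ik; case: outdeg.
Qed.

Lemma arc_phi_ex : exists phi : {rmorphism F -> laurent F},
  (forall x, phi (iota x) = lc (iota x)) /\ (forall i, phi (w i) = arc_w i).
Proof.
have [|phi phiE] := lift_to_fractions
  (f := mmap iota w) (g := mmap (lc \o iota) arc_w) shift_kernel.
  by move=> b; have [f [g fg]] := proj2 hF b; exists f, g.
exists phi; split=> [x|i].
  by have := phiE x%:MP; rewrite /= !mmapC.
by have := phiE 'X_i; rewrite /= !mmapX !mmap1U.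
Qed.

Lemma rho_phi_fixed (phi : {rmorphism F -> laurent F})
    (rho : {rmorphism laurent F -> laurent F}) :
    (forall x, phi (iota x) = lc (iota x)) -> (forall i, phi (w i) = arc_w i) ->
    (forall x, rho (lc x) = lc x) -> rho (U ^+ E) = U ^+ E -> (E %| Kx)%N ->
  forall x, rho (phi x) = phi x.
Proof.
move=> phi_io phi_w rho_c rho_U EK x.
have rhoU j : (E %| j)%N -> rho (U^-1 ^+ j) = U^-1 ^+ j.
  by move=> /dvdnP[q ->]; rewrite !exprVn mulnC exprM fmorphV !rmorphXn -[rho U ^+ E]rmorphXn rho_U.
have rho_w i : rho (arc_w i) = arc_w i.
  rewrite arc_wE !rmorphD !rmorphM rmorph_nat !rho_c.
  by rewrite !rmorphXn -!(rmorphXn rho) !rhoU // dvdn_sub.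
have rho_f f : rho (phi (mmap iota w f)) = phi (mmap iota w f).
  rewrite rmorph_mmap rmorph_mmap; apply: eq_mmap => y /=.
    by rewrite phi_io rho_c.
  by rewrite phi_w rho_w.
have [f [g [_ ->]]] := proj2 hF x.
by rewrite fmorph_div fmorph_div !rho_f.
Qed.

Local Notation P := (target_poly w).

Lemma size_target_poly : (size P <= n.+1)%N.
Proof.
rewrite /target_poly (leq_trans (size_polyD _ _)) // geq_max size_polyX; apply/andP.
split; first by rewrite (leq_trans _ (leqW hn)).
apply: (leq_trans (size_sum _ _ _)); apply/bigmax_leqP => i _.
rewrite (leq_trans (size_scale_leq _ _)) // size_polyXn ltnS.
exact: outdeg_le.
Qed.

Lemma arc_phiP (phi : {rmorphism F -> laurent F}) m N :
    E = (m * N)%N ->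
    (forall x, phi (iota x) = lc (iota x)) -> (forall i, phi (w i) = arc_w i) ->
  U ^+ Kx *: map_poly phi P
    = map_poly (fps_frac F) (arc_poly iota m N Kx arc_base P).
Proof.
move=> EE phi_io phi_w.
have U0 j : U ^+ j != 0 by rewrite expf_neq0 // laurent_var_neq0.
have mapP (B : fieldType) (f : {rmorphism F -> B}) : map_poly f P
    = 'X + \sum_i (outsign B i * f (w i)) *: 'X^(outdeg i).
  rewrite /target_poly rmorphD rmorph_sum /= map_polyX; congr (_ + _).
  apply: eq_bigr => i _; rewrite /= map_polyZ map_polyXn /= rmorphM.
  by congr ((_ * _) *: _); rewrite /outsign; case: ifP => _; rewrite ?rmorphN rmorph1.
pose sg (j : nat) : laurent F := if j == 0%N then -1 else 1.
have wE i : U ^+ Kx * arc_w i = U ^+ Kx * lc (w i)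
    + lc (iota (shift_coef (outdeg i))) + U ^+ E * (outdeg i == 0%N)%:R.
  rewrite arc_wE !mulrDr; congr (_ + _ + _).
    by rewrite mulrCA exprVn divff // mulr1.
  rewrite mulrCA mulrC; congr (_ * _).
  by rewrite -{1}(subnK (ltnW EKx)) exprD exprVn mulrAC divff // mul1r.
have sE (i : 'I_n) : outsign (laurent F) i = sg (@outdeg n i) by [].
have n1 : (n.-1 == 0%N) = false by lia.
have n2 : (n.-1 == n) = false by lia.
have n3 : (n == 0%N) = false by lia.
have dE : \sum_(i < n) (sg (outdeg i) * lc (iota (shift_coef (outdeg i)))) *: 'X^(outdeg i)
    = map_poly lc (map_poly iota arc_base).
  rewrite (coef_outdeg_sum hn (fun j => sg j * lc (iota (shift_coef j)))).
  apply/polyP => j; rewrite coef_poly !coef_map /arc_base.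
  rewrite coefB coefD !coefZ !coefXn coefC /shift_coef /sg.
  have [jn|nj] := ltnP j n.+1; last first.
    have -> : (j == n) = false by lia.
    have -> : (j == n.-1) = false by lia.
    have -> : (j == 0%N) = false by lia.
    by rewrite mulr0n !mulr0 subr0 addr0 !raddf0.
  have [->|j1] := eqVneq j 1%N.
    have -> : (1%N == n) = false by lia.
    have -> : (1%N == n.-1) = false by lia.
    by rewrite mulr0n !mulr0 subr0 addr0 !raddf0.
  have [->|jn'] := eqVneq j n.
    by rewrite n3 eq_sym n2 mulr1 mulr0 subr0 addr0 mul1r.
  have [->|jn1] := eqVneq j n.-1.
    by rewrite n1 mulr1 mulr0 subr0 add0r mul1r.
  have [j0|_] := eqVneq j 0%N; last by rewrite !mulr0 subr0 addr0 !raddf0 mulr0.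
  by rewrite !mulr0 add0r sub0r !raddfN mulN1r.
have eE : \sum_(i < n) (sg (outdeg i) * (outdeg i == 0%N)%:R) *: 'X^(outdeg i) = - 1.
  rewrite (coef_outdeg_sum hn (fun j => sg j * (j == 0%N)%:R)).
  apply/polyP => j; rewrite coef_poly coefN coef1 /sg.
  case: j => [|[|j]]; rewrite ?mulr1 ?mulr0 ?oppr0 //=; by case: ifP.
have UE j : @tofrac (fps F) (fps_var F ^+ j) = U ^+ j.
  exact: (rmorphXn (fps_frac F)).
rewrite mapP /arc_poly rmorphD rmorphB /= map_polyC map_polyZ /= !UE.
have -> : map_poly (fps_frac F) (map_poly (@fps_const F) P) = map_poly lc P.
  by rewrite [RHS]map_poly_comp.
have -> : map_poly (fps_frac F) (map_poly (ccst iota) arc_base)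
    = map_poly lc (map_poly iota arc_base).
  by rewrite -!map_poly_comp; apply: eq_map_poly.
rewrite -EE -dE mapP !scalerDr !scaler_sumr.
rewrite [RHS]addrC -addrA; congr (_ + _).
rewrite opp_polyC -eE scaler_sumr -!big_split; apply: eq_bigr => i _ /=.
rewrite !scalerA -!scalerDl sE phi_w; congr (_ *: _).
rewrite mulrCA wE !mulrDr -addrA mulrCA; congr (_ + (_ + _)).
by rewrite mulrCA.
Qed.

End Shift.

(** * Generation of the wreath product *)

Section Wreath.
Variables (C : fieldType) (n m : nat) (z : C).
Hypothesis zP : m.-primitive_root z.
Hypothesis n3 : (3 <= n)%N.
(** [W ze s] says that the element [(ze; s)] of the wreath product belongs to a given
    subgroup; it is a relation on functions, whence the closure under extensional
    equality. *)
Variable W : ('I_n -> C) -> 'S_n -> Prop.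
Hypothesis W_ext : forall ze1 ze2 s, ze1 =1 ze2 -> W ze1 s -> W ze2 s.
Hypothesis W_mul : forall ze1 s1 ze2 s2, W ze1 s1 -> W ze2 s2 ->
  W (fun i => ze1 i * ze2 (s1 i)) (s1 * s2)%g.
Hypothesis W_inv : forall ze s, W ze s ->
  W (fun i => (ze (s^-1%g i))^-1) (s^-1)%g.
Hypothesis W_neq0 : forall ze s i, W ze s -> ze i != 0.
Hypothesis W_trans : forall i j, exists ze s, W ze s /\ s i = j.
Variables (i0 i1 i2 : 'I_n) (ze12 : 'I_n -> C).
Hypothesis W_trans2 : forall i j, i != i0 -> j != i0 ->
  exists ze s, [/\ W ze s, s i0 = i0 & s i = j].
Hypothesis i12 : i1 != i2.
Hypothesis W12 : W ze12 (tperm i1 i2).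
Hypothesis ze12_off : forall i, i != i1 -> i != i2 -> ze12 i = 1.
Hypothesis ze12_on : ze12 i1 * ze12 i2 = z.

Let S (s : 'S_n) := exists ze, W ze s.

Lemma wreath_base_mul s1 s2 : S s1 -> S s2 -> S (s1 * s2)%g.
Proof. by move=> [ze1 h1] [ze2 h2]; exists (fun i => ze1 i * ze2 (s1 i)); apply: W_mul. Qed.

Lemma wreath_base_inv s : S s -> S (s^-1)%g.
Proof. by move=> [ze h]; exists (fun i => (ze (s^-1%g i))^-1); apply: W_inv. Qed.

Lemma wreath_2trans i j : i != j -> exists s, [/\ S s, s i1 = i & s i2 = j].
Proof.
move=> ij; have [x1 [s1 [h1 e1]]] := W_trans i1 i0.
have [x2 [s2 [h2 e2]]] := W_trans i0 i.
have n1 : s1 i2 != i0 by rewrite -e1 (inj_eq perm_inj) eq_sym.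
have n2 : s2^-1%g j != i0 by rewrite -(inj_eq (@perm_inj _ s2)) permKV e2 eq_sym.
have [x3 [s3 [h3 f3 e3]]] := W_trans2 n1 n2.
exists (s1 * s3 * s2)%g; rewrite !permM e1 f3 e2 e3 permKV; split=> //.
by do !apply: wreath_base_mul; [exists x1|exists x3|exists x2].
Qed.

(** The image in the symmetric group is doubly transitive and contains one transposition,
    hence contains them all. *)
Lemma wreath_base_full s : S s.
Proof.
have tp i j : S (tperm i j).
  have [->|ij] := eqVneq i j.
    rewrite tperm1 -(mulVg (tperm i1 i2)).
    apply: wreath_base_mul; last by exists ze12.
    by apply: wreath_base_inv; exists ze12.
  have [r [rS <- <-]] := wreath_2trans ij; rewrite -tpermJ /conjg.
  apply: wreath_base_mul; first exact: wreath_base_inv.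
  by apply: wreath_base_mul => //; exists ze12.
have [ts -> _] := prod_tpermP s.
elim/big_rec: _ => [|ij r _ rS]; last exact: wreath_base_mul.
by rewrite -(tperm1 i1); apply: tp.
Qed.

Let Z (e : 'I_n -> nat) := W (fun i => z ^+ e i) 1%g.

Lemma wreath_ker_mod (e1 e2 : 'I_n -> nat) :
  (forall i, e1 i = e2 i %[mod m]) -> Z e1 -> Z e2.
Proof.
move=> e12; apply: W_ext => i.
by rewrite -(prim_expr_mod zP) e12 (prim_expr_mod zP).
Qed.

Lemma wreath_ker_add e1 e2 : Z e1 -> Z e2 -> Z (fun i => e1 i + e2 i)%N.
Proof.
move=> h1 h2; have := W_mul h1 h2; rewrite mulg1; apply: W_ext => i.
by rewrite perm1 exprD.
Qed.

Lemma wreath_ker0 : Z (fun=> 0%N).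
Proof.
have [ze h] := wreath_base_full 1%g; have := W_mul h (W_inv h).
rewrite mulgV; apply: W_ext => i; rewrite !perm1 invg1 perm1 expr0 divff //.
exact: W_neq0 h.
Qed.

Lemma wreath_ker_muln k e : Z e -> Z (fun i => k * e i)%N.
Proof.
move=> h; elim: k => [|k IHk]; first exact: wreath_ker0.
by have := wreath_ker_add h IHk; apply: W_ext => i; rewrite mulSn.
Qed.

Lemma wreath_ker_conj e (s : 'S_n) : Z e -> Z (fun i => e (s^-1%g i)).
Proof.
move=> h; have [x xs] := wreath_base_full s.
have := W_mul (W_mul (W_inv xs) h) xs; rewrite mulg1 mulVg; apply: W_ext => i.
by rewrite mulrAC mulVf ?mul1r // (W_neq0 _ xs).
Qed.

Let del (i j : 'I_n) : nat := (i == j).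

(** The square of the given element is [z] at [i1] and [i2] and 1 elsewhere; conjugation
    moves it to any pair of distinct places. A third place [k'] then yields [z^2] at a
    single place: [(i, j') (i, k') (j', k')^(m-1)]. *)
Lemma wreath_ker_pair i j : Z (fun l => del i l + del j l)%N.
Proof.
have pair i' j' : i' != j' -> Z (fun l => del i' l + del j' l)%N.
  have h12 : Z (fun l => del i1 l + del i2 l)%N.
    have := W_mul W12 W12; rewrite tperm2; apply: W_ext => l; rewrite /del.
    have [<-|n1] := eqVneq i1 l.
      by rewrite tpermL ze12_on eq_sym (negPf i12) expr1.
    have [<-|n2] := eqVneq i2 l; first by rewrite tpermR mulrC ze12_on expr1.
    by rewrite tpermD // ze12_off 1?eq_sym // mulr1.
  move=> ij; have [s [_ si sj]] := wreath_2trans ij.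
  have := wreath_ker_conj s h12; apply: W_ext => l; congr (_ ^+ (_ + _)); rewrite /del.
    by rewrite -si -{2}(permKV s l) (inj_eq perm_inj).
  by rewrite -sj -{2}(permKV s l) (inj_eq perm_inj).
have [<-|] := eqVneq i j; last exact: pair.
have [j' ij'] : exists j', i != j'.
  by have [->|] := eqVneq i i1; [exists i2 | exists i1].
have [k' [ik' jk']] : exists k', i != k' /\ j' != k'.
  have : (0 < #|~: [set i; j']|)%N by rewrite cardsCs setCK card_ord cards2 ij'; lia.
  by case/card_gt0P => k'; rewrite !inE negb_or !(eq_sym k') => /andP[]; exists k'.
have := wreath_ker_add (wreath_ker_add (pair _ _ ij') (pair _ _ ik'))
  (wreath_ker_muln m.-1 (pair _ _ jk')).
have m0 := prim_order_gt0 zP.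
apply: wreath_ker_mod => l.
have -> : (del i l + del j' l + (del i l + del k' l) + m.-1 * (del j' l + del k' l)
   = (del j' l + del k' l) * m + (del i l + del i l))%N.
  by case: (m) m0 => // m' _ /=; nia.
by rewrite modnMDl.
Qed.

(** By induction on the total exponent, removing two units at a time. *)
Lemma wreath_ker_even (e : 'I_n -> nat) : ~~ odd (\sum_i e i) -> Z e.
Proof.
have [N] := ubnP (\sum_i e i)%N; elim: N e => // N IHN e le ev.
have pos (f : 'I_n -> nat) : (0 < \sum_i f i)%N -> exists i, (0 < f i)%N.
  have [i fi _|f0] := pickP (fun i => 0 < f i)%N; first by exists i.
  by rewrite big1 // => i _; apply/eqP; rewrite -leqn0 leqNgt f0.
have del_sum i : (\sum_l del i l = 1)%N.
  rewrite (bigD1 i) //= /del eqxx big1 ?addn0 // => l.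
  by rewrite eq_sym => /negPf ->.
have del_le f i : (0 < f i)%N -> forall l, (del i l <= f l)%N.
  by move=> fi l; rewrite /del; case: eqP => // <-.
have [e0|ep] := posnP (\sum_i e i)%N.
  apply: wreath_ker_mod wreath_ker0 => i; congr (_ %% _)%N; apply/eqP.
  by rewrite eq_sym -leqn0 -e0 (bigD1 i) //= leq_addr.
have [i ei] := pos _ ep.
pose e1 l := (e l - del i l)%N.
have s1 : (\sum_l e l = 1 + \sum_l e1 l)%N.
  rewrite -(del_sum i) -big_split; apply: eq_bigr => l _ /=.
  by rewrite subnKC // del_le.
have [|j ej] := pos e1.
  by rewrite lt0n; apply: contraNneq ev => s0; rewrite s1 s0.
pose e2 l := (e1 l - del j l)%N.
have s2 : (\sum_l e1 l = 1 + \sum_l e2 l)%N.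
  rewrite -(del_sum j) -big_split; apply: eq_bigr => l _ /=.
  by rewrite subnKC // del_le.
have h2 : Z e2.
  by apply: IHN; move: le ev; rewrite s1 s2 ?addnA ?oddD; lia.
apply: wreath_ker_mod (wreath_ker_add (wreath_ker_pair i j) h2) => l.
by rewrite -addnA /e2 subnKC ?del_le // /e1 subnKC ?del_le.
Qed.

Hypothesis W_root : forall ze s i, W ze s -> ze i ^+ m = 1.
Hypothesis W_parity : forall ze s, ~~ odd m -> W ze s ->
  (\prod_i ze i) ^+ (m %/ 2) = (-1) ^+ s.

(** Divide by an element of the subgroup with the same permutation: there remains an
    element of [mu_m^n] with exponents [e]. If [m] is even, the sign condition makes their
    sum even; if [m] is odd, adding [m] to one exponent corrects the parity. *)
Lemma wreath_full (ze : 'I_n -> C) (s : 'S_n) : (forall i, ze i ^+ m = 1) ->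
  odd m || ((\prod_i ze i) ^+ (m %/ 2) == (-1) ^+ s) -> W ze s.
Proof.
move=> zem par; have [x xs] := wreath_base_full s.
have m0 := prim_order_gt0 zP.
have xn0 i : x i != 0 by apply: W_neq0 xs.
have root1 i : (ze i / x i) ^+ m = 1 by rewrite expr_div_n zem (W_root _ xs) divr1.
pose e i : nat := sval (prim_rootP zP (root1 i)).
have eE i : z ^+ e i = ze i / x i by rewrite -(svalP (prim_rootP zP (root1 i))).
pose b := (odd (\sum_i e i) : nat).
pose e' i := (e i + del i1 i * (b * m))%N.
have e'E i : z ^+ e' i = z ^+ e i.
  by rewrite exprD [(b * m)%N]mulnC mulnCA exprM (prim_expr_order zP) expr1n mulr1.
have Ze' : Z e'.
  apply: wreath_ker_even; rewrite big_split -big_distrl /=.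
  have -> : (\sum_i del i1 i = 1)%N.
    rewrite (bigD1 i1) //= /del eqxx big1 ?addn0 // => l.
    by rewrite eq_sym => /negPf ->.
  rewrite mul1n oddD oddM /b; case: (boolP (odd m)) par => [om _|em /= /eqP par].
    by case: (odd (\sum_i e i)).
  rewrite andbF addbF; have zs : z ^+ ((\sum_i e i) * (m %/ 2)) = 1.
    have -> : z ^+ ((\sum_i e i) * (m %/ 2)) = (\prod_i (ze i / x i)) ^+ (m %/ 2).
      by rewrite exprM expr_sum; congr (_ ^+ _); apply: eq_bigr => i _.
    rewrite big_split prodfV /= exprMn exprVn par (W_parity em xs).
    by rewrite divff // signr_eq0.
  move/eqP: zs; rewrite -(prim_order_dvd zP).
  have m2 : (m = 2 * (m %/ 2))%N by rewrite mulnC divnK // dvdn2.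
  rewrite {1}m2 dvdn_pmul2r ?dvdn2 //.
  by rewrite divn_gt0 // dvdn_leq // dvdn2.
have := W_mul Ze' xs; rewrite mul1g; apply: W_ext => i.
by rewrite perm1 e'E eE divfK.
Qed.

End Wreath.

(** * The sign condition and the order of the group *)

Lemma vandermonde_prod (A : comNzRingType) n (t : 'I_n -> A) (s : 'S_n) :
  let D (u : 'I_n -> A) := \prod_(i < n) \prod_(j < n | (i < j)%N) (u j - u i) in
  D (fun i => t (s i)) = (-1) ^+ s * D t.
Proof.
move=> D; have DE u : D u = \det (Vandermonde n (\row_i u i)).
  rewrite det_Vandermonde; apply: eq_bigr => i _; apply: eq_bigr => j _.
  by rewrite !mxE.
rewrite !DE -odd_permV -det_perm mulrC -det_mulmx -col_permE; congr (\det _).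
by apply/matrixP => i j; rewrite !mxE.
Qed.

Lemma deriv_at_root (A : comNzRingType) n (q : A) (t : 'I_n -> A) i :
  (q *: \prod_j ('X - (t j)%:P))^`().[t i] = q * \prod_(j | j != i) (t i - t j).
Proof.
rewrite derivZ hornerZ (bigD1 i) //= derivM !hornerE derivXsubC hornerC subrr.
rewrite mul0r addr0 mul1r horner_prod; congr (_ * _).
by apply: eq_bigr => j _; rewrite !hornerE.
Qed.

(** Each unordered pair contributes [- (t j - t i)^2]. *)
Lemma prod_diff_square (A : comNzRingType) n (t : 'I_n -> A) : exists K,
  \prod_i \prod_(j | j != i) (t i - t j)
    = (-1) ^+ K * (\prod_(i < n) \prod_(j < n | (i < j)%N) (t j - t i)) ^+ 2.
Proof.
have split_i (i : 'I_n) : \prod_(j | j != i) (t i - t j)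
    = \prod_(j < n | (j < i)%N) (t i - t j)
      * \prod_(j < n | (i < j)%N) (-1 * (t j - t i)).
  rewrite (bigID (fun j : 'I_n => j < i)%N) /=; congr (_ * _).
    by apply: eq_bigl => j; rewrite -(inj_eq val_inj) andbC; case: ltngtP.
  apply: eq_big => [j|j _]; last by rewrite mulN1r opprB.
  by rewrite -(inj_eq val_inj) -leqNgt; case: ltngtP.
exists (\sum_(i < n) \sum_(j < n | (i < j)%N) 1)%N.
have swap : \prod_(i < n) \prod_(j < n | (j < i)%N) (t i - t j)
    = \prod_(i < n) \prod_(j < n | (i < j)%N) (t j - t i).
  by rewrite (exchange_big_dep xpredT).
rewrite (eq_bigr _ (fun i _ => split_i i)) big_split /= swap.
rewrite expr2 mulrCA; congr (_ * _).
rewrite -prodrXr -big_split; apply: eq_bigr => i _ /=.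
by rewrite big_split /= prodr_const sum1_card.
Qed.

(** The product of the [P'(t_i)] is [+- q^n] times the square of the Vandermonde [D], so
    the product of the [a_i^(m/2)] is a constant times [q^(n/2) D], which [G] multiplies
    by the sign of [s]. *)
Lemma galois_parity (C N : fieldType) (io : {rmorphism C -> N}) n m (q : N)
    (t a : 'I_n -> N) (G : {rmorphism N -> N}) (ze : 'I_n -> C) (s : 'S_n) :
    (exists ii : C, ii ^+ 2 = -1) -> ~~ odd n -> ~~ odd m ->
    (forall i, a i ^+ m = (q *: \prod_j ('X - (t j)%:P))^`().[t i]) ->
    (forall i, a i != 0) -> G q = q -> (forall c, G (io c) = io c) ->
    (forall i, G (t i) = t (s i)) -> (forall i, G (a i) = io (ze i) * a (s i)) ->
  (\prod_i ze i) ^+ (m %/ 2) = (-1) ^+ s.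
Proof.
move=> [ii ii2] en em aE a0 Gq Gio Gt Ga.
pose D := \prod_(i < n) \prod_(j < n | (i < j)%N) (t j - t i).
pose A := \prod_i a i ^+ (m %/ 2).
have m2 : (m %/ 2 * 2 = m)%N by rewrite divnK // dvdn2.
have n2 : (n %/ 2 * 2 = n)%N by rewrite divnK // dvdn2.
have [K KE] := prod_diff_square t.
have A2 : A ^+ 2 = (io ii ^+ K * q ^+ (n %/ 2) * D) ^+ 2.
  rewrite /A -prodrXl !exprMn -[q ^+ _ ^+ 2]exprM n2 [_ ^+ K ^+ 2]exprAC -rmorphXn.
  rewrite ii2 rmorphN1.
  rewrite mulrAC -KE mulrC -[X in q ^+ X]card_ord -prodr_const -big_split /=.
  by apply: eq_bigr => i _; rewrite -exprM m2 aE deriv_at_root.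
have GD : G D = (-1) ^+ s * D.
  rewrite -vandermonde_prod rmorph_prod; apply: eq_bigr => i _.
  by rewrite rmorph_prod; apply: eq_bigr => j _; rewrite rmorphB !Gt.
have GX : G (io ii ^+ K * q ^+ (n %/ 2) * D)
    = (-1) ^+ s * (io ii ^+ K * q ^+ (n %/ 2) * D).
  by rewrite !rmorphM !rmorphXn Gio Gq GD mulrCA.
have GA : G A = (-1) ^+ s * A.
  have /eqP := A2; rewrite eqf_sqr => /orP[] /eqP ->; first exact: GX.
  by rewrite rmorphN GX mulrN.
have GA' : G A = io (\prod_i ze i) ^+ (m %/ 2) * A.
  rewrite {1}/A rmorph_prod rmorph_prod -prodrXl [A](reindex_inj (@perm_inj _ s)).
  rewrite -big_split; apply: eq_bigr => i _ /=.
  by rewrite rmorphXn Ga exprMn.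
have An0 : A != 0 by apply/prodf_neq0 => i _; rewrite expf_neq0.
apply: (fmorph_inj io); apply: (mulIf An0).
by rewrite rmorphXn -GA' GA rmorph_sign.
Qed.

Lemma prim_root_half (C : fieldType) m (z : C) : m.-primitive_root z -> ~~ odd m ->
  z ^+ (m %/ 2) = -1.
Proof.
move=> zP em; have m0 := prim_order_gt0 zP.
have m2 : (m %/ 2 * 2 = m)%N by rewrite divnK // dvdn2.
have h0 : (0 < m %/ 2)%N by rewrite divn_gt0 // dvdn_leq // dvdn2.
have : (z ^+ (m %/ 2)) ^+ 2 == 1 by rewrite -exprM m2 (prim_expr_order zP).
rewrite sqrf_eq1 => /orP[|/eqP //]; rewrite -(prim_order_dvd zP).
move=> /(dvdn_leq h0); rewrite -{1}m2 muln2 -addnn -{3}[(m %/ 2)%N]addn0.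
by rewrite leq_add2l leqNgt h0.
Qed.

Section CountG.
Variables (R : realType) (n : nat).
Hypothesis hn : (3 <= n)%N.
Local Notation m := (n - 2)%N.

Let m0 : (0 < m)%N. Proof. by rewrite subn_gt0. Qed.
Let charC k : (0 < k)%N -> k%:R != 0 :> R[i].
Proof. by move=> k0; rewrite pnatr_eq0 -lt0n. Qed.

Lemma mu_exp (x : mu R m) : ssval x ^+ m = 1.
Proof. by apply/eqP; rewrite -(Defs.mem_unity_roots _ m0) ssvalP. Qed.

Lemma mu_exists (x : R[i]) : x ^+ m = 1 -> exists y : mu R m, ssval y = x.
Proof.
move=> xm; have xu : x \in unity_roots R m by rewrite Defs.mem_unity_roots // xm.
by exists (SeqSub xu).
Qed.

Lemma card_mu : #|mu R m| = m.
Proof.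
rewrite card_seq_sub ?undup_uniq //.
have [s [us ss sE]] := exp_roots charC m0 (oner_neq0 R[i]).
rewrite -[RHS]ss; apply: perm_size; apply: uniq_perm => //; first exact: undup_uniq.
by move=> x; rewrite Defs.mem_unity_roots // sE.
Qed.

Definition mu_one : mu R m := projT1 (cid (mu_exists (expr1n _ m))).
Lemma mu_mul_subproof (x y : mu R m) : (ssval x * ssval y) ^+ m = 1.
Proof. by rewrite exprMn !mu_exp mulr1. Qed.
Definition mu_mul (x y : mu R m) : mu R m := projT1 (cid (mu_exists (mu_mul_subproof x y))).
Lemma mu_mulE x y : ssval (mu_mul x y) = ssval x * ssval y.
Proof. exact: projT2 (cid (mu_exists (mu_mul_subproof x y))). Qed.

Lemma mu_neq0 (x : mu R m) : ssval x != 0.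
Proof.
by apply/eqP => x0; have := mu_exp x; rewrite x0 expr0n eqn0Ngt m0 => /eqP;
   rewrite eq_sym oner_eq0.
Qed.

Lemma mu_inj : injective (fun x : mu R m => ssval x).
Proof. exact: val_inj. Qed.

Definition sheet_fun (ze : {ffun 'I_n -> mu R m}) (s : 'S_n) (x : sheet R n) : sheet R n :=
  (s x.1, mu_mul x.2 (ze x.1)).

Lemma sheet_fun_inj ze s : injective (sheet_fun ze s).
Proof.
move=> [i x] [j y] [/perm_inj <- e]; congr (_, _); apply: mu_inj.
by apply: (mulIf (mu_neq0 (ze i))); rewrite -!mu_mulE e.
Qed.

Definition sheet_perm ze s := perm (@sheet_fun_inj ze s).

Lemma acts_as_perm ze s pi : acts_as ze s pi = (pi == sheet_perm ze s).
Proof.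
apply/forallP/eqP => [ap|-> x]; last first.
  by rewrite permE /= mu_mulE !eqxx.
apply/permP => x; rewrite permE; have /andP[/eqP e1 /eqP e2] := ap x.
by rewrite [pi x]surjective_pairing e1; congr (_, _); apply: mu_inj; rewrite e2 mu_mulE.
Qed.

Definition sheet_cond (x : {ffun 'I_n -> mu R m} * 'S_n) : bool :=
  odd n || ((\prod_i ssval (x.1 i)) ^+ (m %/ 2) == (-1) ^+ x.2).

Lemma G_image : G R n = [set sheet_perm x.1 x.2 | x in [set x | sheet_cond x]].
Proof.
apply/setP => pi; rewrite inE; apply/existsP/imsetP.
  move=> [ze /existsP[s /andP[cnd]]]; rewrite acts_as_perm => /eqP ->.
  by exists (ze, s); rewrite ?inE.
move=> [[ze s]]; rewrite inE => cnd ->; exists ze; apply/existsP; exists s.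
by rewrite acts_as_perm eqxx andbT.
Qed.

Lemma sheet_perm_inj : injective (fun x : {ffun 'I_n -> mu R m} * 'S_n => sheet_perm x.1 x.2).
Proof.
move=> [ze s] [ze' s'] /= e; have one i : (s i, mu_mul mu_one (ze i))
    = (s' i, mu_mul mu_one (ze' i)).
  by have := congr1 (fun p : {perm sheet R n} => p (i, mu_one)) e; rewrite !permE.
congr (_, _); last by apply/permP => i; case: (one i).
apply/ffunP => i; apply: mu_inj; apply: (mulfI (mu_neq0 mu_one)).
by case: (one i) => _ ei; rewrite -!mu_mulE ei.
Qed.

Lemma card_sheet_data : #|{: {ffun 'I_n -> mu R m} * 'S_n}| = (m ^ n * n`!)%N.
Proof. by rewrite card_prod card_ffun card_mu card_ord card_Sn. Qed.

(** For [n] even, multiplying [zeta_0] by a primitive [m]-th root of unity changes the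
    sign of [(prod_i zeta_i)^(m/2)], so exactly half of the pairs satisfy the condition. *)
Lemma card_G : #|G R n| = (m ^ n * n`! %/ gcdn 2 m)%N.
Proof.
rewrite G_image card_imset; last exact: sheet_perm_inj.
have odd_nm : odd n = odd m by rewrite oddB //; lia.
have [on|en] := boolP (odd n).
  have -> : gcdn 2 m = 1%N by apply/eqP; rewrite -/(coprime 2 m) coprime2n -odd_nm.
  rewrite divn1 -card_sheet_data; apply: eq_card => x.
  by rewrite !inE /sheet_cond on.
have em : ~~ odd m by rewrite -odd_nm.
have -> : gcdn 2 m = 2%N by apply/gcdn_idPl; rewrite dvdn2.
have [z zP] := closed_prim_root charC m0.
have [zz zzE] := mu_exists (prim_expr_order zP).
have m2 : (m %/ 2 * 2 = m)%N by rewrite divnK // dvdn2.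
have zm := prim_root_half zP em.
have i0P : (0 < n)%N by lia.
pose i0 := Ordinal i0P.
pose f (x : {ffun 'I_n -> mu R m} * 'S_n) : {ffun 'I_n -> mu R m} * 'S_n :=
  ([ffun i => if i == i0 then mu_mul zz (x.1 i) else x.1 i], x.2).
have f_inj : injective f.
  move=> [x s] [y s'] [e <-]; congr (_, _); apply/ffunP => i.
  have := congr1 (fun g : {ffun 'I_n -> mu R m} => g i) e; rewrite !ffunE.
  case: eqP => // _ e'; apply: mu_inj; apply: (mulfI (mu_neq0 zz)).
  by rewrite -!mu_mulE e'.
have fP (x : {ffun 'I_n -> mu R m} * 'S_n) : \prod_i ssval ((f x).1 i) = z * \prod_i ssval (x.1 i).
  rewrite (bigD1 i0) //= [in RHS](bigD1 i0) //= ffunE eqxx mu_mulE zzE -mulrA.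
  congr (_ * (_ * _)); apply: eq_bigr => i /negPf ni; by rewrite ffunE ni.
have sq (x : {ffun 'I_n -> mu R m} * 'S_n) : (\prod_i ssval (x.1 i)) ^+ (m %/ 2) == 1
    \/ (\prod_i ssval (x.1 i)) ^+ (m %/ 2) == -1.
  apply/orP.
  have : ((\prod_i ssval (x.1 i)) ^+ (m %/ 2)) ^+ 2 == 1.
    by rewrite -exprM m2 -prodrXl big1 // => i _; apply: mu_exp.
  by rewrite sqrf_eq1.
have n11 : (1 == -1 :> R[i]) = false.
  by rewrite -subr_eq0 opprK -(natrD _ 1 1) pnatr_eq0.
have condf x : sheet_cond (f x) = ~~ sheet_cond x.
  rewrite /sheet_cond (negPf en) /= fP exprMn zm mulN1r.
  by case: (sq x) => /eqP ->; case: (x.2 : bool);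
    rewrite ?expr1 ?expr0 ?opprK ?eqxx ?[-1 == 1]eq_sym ?n11.
pose B := [set x | sheet_cond x].
have le1 : (#|B| <= #|~: B|)%N.
  rewrite -(card_imset _ f_inj); apply/subset_leq_card/subsetP => _ /imsetP[x xB ->].
  by move: xB; rewrite !inE condf negbK.
have le2 : (#|~: B| <= #|B|)%N.
  rewrite -(card_imset _ f_inj); apply/subset_leq_card/subsetP => _ /imsetP[x xB ->].
  by move: xB; rewrite !inE condf.
have tot := cardsC B; rewrite card_sheet_data in tot.
by rewrite -tot -/B; lia.
Qed.
End CountG.

(** * The source function field *)

Lemma coef1_deriv (A : nzRingType) (p : {poly A}) : p`_1 = p^`().[0].
Proof. by rewrite horner_coef0 coef_deriv mulr1n. Qed.

Section Bracket.
Variables (L : fieldType) (n : nat) (x y hf : L) (z : nat -> L).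
Hypothesis hn : (3 <= n)%N.
Hypothesis hfE : hf * 2%:R = 1.
Let p := 1 + x * y.

(** The same polynomials as in the definition of [K_n], for arbitrary values of the
    coordinates in a field; [hf] stands for one half. *)
Definition phi_bracket : {poly L} :=
  (n%:R * y) *: (y *: 'X + hf%:P) + z 3 *: (p *: 'X + (hf * x)%:P)
  + \sum_(4 <= j < n.+1) z j *: 'X^(j - 2).

Definition phi_poly : {poly L} :=
  (1 - y *: 'X) ^+ (n - 1) * (p *: 'X - x%:P) + (p *: 'X - x%:P) ^+ 2 * phi_bracket.

Lemma coef_bracket j : phi_bracket`_j =
  if j == 0%N then n%:R * y * hf + z 3 * (hf * x)
  else if j == 1%N then n%:R * y * y + z 3 * p
  else if (j + 2 <= n)%N then z (j + 2)%N else 0.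
Proof.
rewrite /phi_bracket !coefD !coefZ !coefD !coefZ !coefX !coefC coef_sum.
have -> : \sum_(4 <= i < n.+1) (z i *: 'X^(i - 2))`_j
   = if (1 < j)%N && (j + 2 <= n)%N then z (j + 2)%N else 0.
  case: ifP => [/andP[j1 jn]|h].
    rewrite (bigD1_seq (j + 2)%N) ?iota_uniq ?mem_index_iota ?ltnS ?jn //=; last by lia.
    rewrite coefZ coefXn addnK eqxx mulr1 big_seq_cond big1 ?addr0 // => i.
    rewrite mem_index_iota coefZ coefXn => /andP[/andP[i4 _] ij].
    by rewrite (_ : (j == i - 2)%N = false) ?mulr0 //; lia.
  rewrite big_seq big1 // => i; rewrite mem_index_iota => /andP[i4 iN].
  rewrite coefZ coefXn (_ : (j == i - 2)%N = false) ?mulr0 //; lia.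
by case: j => [|[|j]] /=; rewrite ?mulr0 ?mulr1 ?addr0 ?add0r //; ring.
Qed.

Lemma size_bracket : (size phi_bracket <= n.-1)%N.
Proof.
apply/leq_sizeP => j nj; rewrite coef_bracket.
case: eqP => [|_]; first by lia.
case: eqP => [|_]; first by lia.
by case: ifP => //; lia.
Qed.

Lemma size_linear (a b : L) : (size (a *: 'X - b%:P)%R <= 2)%N.
Proof.
rewrite (leq_trans (size_polyD _ _)) // geq_max size_polyN.
by rewrite (leq_trans (size_scale_leq _ _)) ?size_polyX // (leq_trans (size_polyC_leq1 _)).
Qed.

Lemma size_power (q : {poly L}) k : (size q <= 2)%N -> (size (q ^+ k)%R <= k.+1)%N.
Proof.
move=> q2; apply: (leq_trans (size_poly_exp_leq _ _)); rewrite ltnS.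
by have : ((size q).-1 <= 1)%N; [lia | move=> h; nia].
Qed.

Lemma phi_linearE : (1 - y *: 'X) = (- y) *: 'X - (- 1)%:P :> {poly L}.
Proof. by rewrite scaleNr polyCN opprK addrC. Qed.

Lemma size_phi_poly : (size phi_poly <= n.+1)%N.
Proof.
rewrite /phi_poly (leq_trans (size_polyD _ _)) // geq_max; apply/andP; split.
  have h1 : (size ((1 - y *: 'X) ^+ (n - 1))%R <= (n - 1).+1)%N.
    by apply: size_power; rewrite phi_linearE size_linear.
  have h2 := size_linear p x.
  apply: (leq_trans (size_polyMleq _ _)).
  by move: h1 h2; move: (size _) (size _) => u v; lia.
have h1 : (size ((p *: 'X - x%:P) ^+ 2)%R <= 3)%N by apply: size_power; apply: size_linear.
have h2 := size_bracket.
apply: (leq_trans (size_polyMleq _ _)).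
by move: h1 h2; move: (size _) (size _) => u v; lia.
Qed.

Lemma phi_coef1 : phi_poly`_1 = 1.
Proof.
have B0 : phi_bracket.[0] = n%:R * y * hf + z 3 * (hf * x).
  by rewrite horner_coef0 coef_bracket.
have B1 : phi_bracket^`().[0] = n%:R * y * y + z 3 * p.
  by rewrite -coef1_deriv coef_bracket.
rewrite coef1_deriv /phi_poly; move: phi_bracket B0 B1 => B B0 B1.
have d1 : ((1 - y *: 'X) ^+ (n - 1))^`().[0] = - (n%:R - 1) * y :> L.
  rewrite deriv_exp !derivE hornerMn hornerM horner_exp !hornerE ?(mulr0, subr0, expr1n, mulr1).
  rewrite -mulr_natl natrB ?(ltnW (ltnW hn)) //; by ring.
have d0 : ((1 - y *: 'X) ^+ (n - 1)).[0] = 1 :> L.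
  by rewrite horner_exp !hornerE ?(mulr0, subr0, expr1n).
have e1 : (p *: 'X - x%:P)^`().[0] = p by rewrite !derivE !hornerE ?subr0.
have e0 : (p *: 'X - x%:P).[0] = - x by rewrite !hornerE ?(mulr0, sub0r, add0r).
move: ((1 - y *: 'X) ^+ (n - 1)) (p *: 'X - x%:P) d1 d0 e1 e0 => D l d1 d0 e1 e0.
rewrite expr2 derivD !derivM !(hornerD, hornerM) d1 d0 e1 e0 B0 B1.
apply/eqP; rewrite -subr_eq0; apply/eqP.
transitivity (- (x * p * n%:R * y + z 3 * x ^+ 2 * p) * (hf * 2%:R - 1)).
  by rewrite /p; ring.
by rewrite hfE subrr mulr0.
Qed.

Lemma phi_root : p != 0 -> phi_poly.[x / p] = 0.
Proof.
move=> p0; have e0 : (p *: 'X - x%:P).[x / p] = 0.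
  by rewrite hornerD hornerN hornerZ hornerX hornerC mulrCA divff // mulr1 subrr.
rewrite /phi_poly; move: (p *: 'X - x%:P) e0 => l e0.
by rewrite expr2 !(hornerD, hornerM) e0 !(mulr0, mul0r) addr0.
Qed.

Lemma phi_deriv_root : p != 0 -> phi_poly^`().[x / p] = p^-1 ^+ (n - 2).
Proof.
move=> p0; have e0 : (p *: 'X - x%:P).[x / p] = 0.
  by rewrite hornerD hornerN hornerZ hornerX hornerC mulrCA divff // mulr1 subrr.
have e1 : (p *: 'X - x%:P)^`().[x / p] = p by rewrite !derivE !hornerE ?subr0.
have e2 : (1 - y *: 'X).[x / p] = p^-1.
  rewrite hornerD hornerN hornerZ hornerX -[1]/(1%:P) hornerC.
  apply: (mulIf p0); rewrite mulVf // mulrBl mul1r -!mulrA.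
  by rewrite [p^-1 * p]mulVf // mulr1 /p mulrC addrK.
have e3 : ((1 - y *: 'X) ^+ (n - 1)).[x / p] = p^-1 ^+ (n - 1) by rewrite horner_exp e2.
rewrite /phi_poly; move: ((1 - y *: 'X) ^+ (n - 1)) (p *: 'X - x%:P) e0 e1 e3.
move=> D l e0 e1 e3.
rewrite expr2 derivD !derivM !(hornerD, hornerM) e0 e1 !(mulr0, mul0r, addr0, add0r) e3.
rewrite (_ : (n - 1 = (n - 2).+1)%N); last by lia.
by rewrite exprS mulrAC mulVf // mul1r.
Qed.

Lemma phi_coef0 : phi_poly`_0 = - x + x ^+ 2 * phi_bracket`_0.
Proof.
have d0 : ((1 - y *: 'X) ^+ (n - 1)).[0] = 1 :> L.
  by rewrite horner_exp !hornerE ?(mulr0, subr0, expr1n).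
have e0 : (p *: 'X - x%:P).[0] = - x by rewrite !hornerE ?(mulr0, sub0r, add0r).
rewrite -!horner_coef0 /phi_poly.
move: ((1 - y *: 'X) ^+ (n - 1)) (p *: 'X - x%:P) d0 e0 => D l d0 e0.
by rewrite expr2 !(hornerD, hornerM) d0 e0 mul1r mulrNN.
Qed.

Lemma phi_top : p = 0 -> phi_poly`_n = 0.
Proof.
move=> p0; rewrite nth_default // /phi_poly p0 scale0r sub0r sqrrN.
rewrite (leq_trans (size_polyD _ _)) // geq_max mulrN size_polyN; apply/andP; split.
  have h1 : (size ((1 - y *: 'X) ^+ (n - 1))%R <= (n - 1).+1)%N.
    by apply: size_power; rewrite phi_linearE size_linear.
  have h2 := size_polyC_leq1 x.
  apply: (leq_trans (size_polyMleq _ _)).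
  by move: h1 h2; move: (size _) (size _) => u v; lia.
rewrite -rmorphXn /= mul_polyC (leq_trans (size_scale_leq _ _)) //.
by rewrite (leq_trans size_bracket) // leq_pred.
Qed.

End Bracket.

Section BracketGenerates.
Variables (F : fieldType) (L : fieldExtType F) (n : nat) (x y hf : L) (z : nat -> L).
Hypothesis hn : (3 <= n)%N.
Hypothesis hfE : hf * 2%:R = 1.
Let p := 1 + x * y.
Hypotheses (p0 : p != 0) (x0 : x != 0).
Variable V : {subfield L}.
Hypothesis phiV : phi_poly n x y hf z \is a polyOver V.
Hypotheses (tV : x / p \in V) (aV : p^-1 \in V).

Lemma phi_x_mem : x \in V.
Proof. by rewrite -[x](divfK p0) -[X in _ * X]invrK rpred_div. Qed.

Lemma phi_y_mem : y \in V.
Proof.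
have pV : p \in V by rewrite -[p]invrK rpredV.
by rewrite -[y](mulKf x0) mulrC rpred_div ?phi_x_mem // -[_ * y](addKr 1) rpredD ?rpredN ?rpred1.
Qed.

(** The bracket is the quotient of [Phi_n(T) - (1 - yT)^(n-1) (pT - x)] by [(pT - x)^2], so
    its coefficients are rational in [t] and [a]; each [z_j] is read off one of them. *)
Lemma phi_z_mem j : (3 <= j <= n)%N -> z j \in V.
Proof.
move=> /andP[j3 jn]; have xV := phi_x_mem; have yV := phi_y_mem.
have pV : p \in V by rewrite -[p]invrK rpredV.
have hfV : hf \in V.
  have : hf = 2%:R^-1.
    by rewrite -[LHS]mulr1 -[X in _ * X](divff (_ : 2%:R != 0)) ?mulrA ?hfE ?mul1r //;
    apply: contraTneq (oner_neq0 L) => e; rewrite -hfE e mulr0 eqxx.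
  by move=> ->; rewrite rpredV rpred_nat.
have BV : phi_bracket n x y hf z \is a polyOver V.
  have lV : p *: 'X - x%:P \is a polyOver V.
    by rewrite rpredB ?polyOverZ ?polyOverX ?polyOverC.
  have l0 : (p *: 'X - x%:P) ^+ 2 != 0.
    rewrite expf_neq0 //; apply: contra_neq x0 => /(congr1 (fun q : {poly L} => q`_0)).
    by rewrite coefB coefZ coefX coefC coef0 mulr0 sub0r => /eqP; rewrite oppr_eq0 => /eqP.
  have -> : phi_bracket n x y hf z = (phi_poly n x y hf z
      - (1 - y *: 'X) ^+ (n - 1) * (p *: 'X - x%:P)) %/ (p *: 'X - x%:P) ^+ 2.
    by rewrite /phi_poly -/p addrAC subrr add0r mulKp.
  apply: divp_polyOver; last by rewrite rpredX.
  by rewrite rpredB // rpredM // rpredX // rpredB ?rpred1 // polyOverZ ?polyOverX.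
have /polyOverP Bj := BV.
have [->|j3'] := eqVneq j 3.
  have := Bj 0%N; rewrite coef_bracket // => b0.
  have hx0 : hf * x != 0.
    by rewrite mulf_neq0 //; apply: contraTneq (oner_neq0 L) => e; rewrite -hfE e mul0r eqxx.
  rewrite -[z 3](mulfK hx0); apply: rpred_div; last exact: rpredM.
  rewrite -[_ * (hf * x)](addKr (n%:R * y * hf)) rpredD // rpredN !rpredM ?rpred_nat //.
have := Bj (j - 2)%N; rewrite coef_bracket //.
have [-> -> j2] : [/\ (j - 2 == 0)%N = false, (j - 2 == 1)%N = false & (1 < j)%N].
  by clear -j3 j3'; split; lia.
by rewrite subnK ?jn.
Qed.

End BracketGenerates.

Lemma map_Phi (R : realType) n (L : fieldType) (f : {rmorphism {mpoly R[i][n]} -> L}) :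
  map_poly f (Phi R n) = phi_poly n (f (xvar R n)) (f (yvar R n))
    (f (Defs.half R n)) (fun j => f (zvar R n j)).
Proof.
rewrite /Phi /phi_poly /phi_bracket.
have -> : 1 + f (xvar R n) * f (yvar R n) = f (pvar R n).
  by rewrite /pvar rmorphD rmorph1 rmorphM.
have lin a b : map_poly f (a *: 'X + b%:P) = f a *: 'X + (f b)%:P.
  by rewrite rmorphD /= map_polyZ map_polyX map_polyC.
have linB a b : map_poly f (a *: 'X - b%:P) = f a *: 'X - (f b)%:P.
  by rewrite rmorphB /= map_polyZ map_polyX map_polyC.
rewrite [LHS]rmorphD [X in X + _ = _]rmorphM [X in _ + X = _]rmorphM !rmorphXn /= linB.
rewrite rmorphB rmorph1 /= map_polyZ map_polyX; congr (_ + _ * _).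
rewrite [LHS]rmorphD [X in X + _ = _]rmorphD rmorph_sum /=.
congr (_ + _ + _).
- apply: etrans (map_polyZ _ _ _) _; congr (_ *: _); last exact: lin.
  by rewrite rmorphM rmorph_nat.
- apply: etrans (map_polyZ _ _ _) _; congr (_ *: _); apply: etrans (lin _ _) _.
  by rewrite rmorphM.
apply: eq_bigr => j _; apply: etrans (map_polyZ _ _ _) _.
by congr (_ *: _); apply: map_polyXn.
Qed.

Section Source.
Variables (R : realType) (n : nat).
Hypothesis hn : (3 <= n)%N.
Variables (k : nat) (c : nat -> R[i]).
Hypothesis hk : (k <= n - 2)%N.
Variables (F : fieldType) (iota : {rmorphism R[i] -> F}) (w : 'I_n -> F).
Hypothesis hF : is_function_field (target_locus k c) iota w.
Variables (L : fieldExtType F) (v : 'I_n -> L).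
Hypothesis hL : is_function_field (source_locus k c) (in_alg L \o iota) v.
Hypothesis hK : forall i, mmap (in_alg L \o iota) v (K R i) = in_alg L (w i).

Let ev : {rmorphism {mpoly R[i][n]} -> L} := mmap (in_alg L \o iota) v.
Let x := ev (xvar R n).
Let y := ev (yvar R n).
Let z j := ev (zvar R n j).
Let hf := ev (Defs.half R n).
Let p := ev (pvar R n).
Let tL := x / p.
Let aL := p^-1.

Lemma source_pE : p = 1 + x * y.
Proof. by rewrite /p /pvar rmorphD rmorph1 rmorphM. Qed.

Lemma source_half : hf * 2%:R = 1.
Proof.
rewrite /hf /Defs.half -[ev _]/(mmap _ _ _) mmapC.
have -> : 2%:R = (in_alg L \o iota) 2%:R :> L by rewrite rmorph_nat.
by rewrite -rmorphM mulVf ?rmorph1 // pnatr_eq0.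
Qed.

Lemma source_Phi : map_poly ev (Phi R n) = phi_poly n x y hf z.
Proof. exact: map_Phi. Qed.

Local Notation P := (target_poly w).

Lemma source_poly : map_poly (in_alg L) P = phi_poly n x y hf z.
Proof.
have c1 := phi_coef1 x y z hn source_half.
have sP := size_phi_poly x y hf z hn.
have coefP i : in_alg L (outsign F i * w i) = (phi_poly n x y hf z)`_(@outdeg n i).
  transitivity (in_alg L (outsign F i) * ev (K R i)).
    by rewrite (hK i : ev (K R i) = _); apply: (rmorphM (in_alg L)).
  have -> : ev (K R i) = ev (outsign _ i) * ev (Phi R n)`_(outdeg i) by apply: (rmorphM ev).
  have -> : ev (Phi R n)`_(outdeg i) = (phi_poly n x y hf z)`_(outdeg i).
    by rewrite -source_Phi; apply/esym/(coef_map ev).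
  rewrite mulrA /outsign.
  case: ifP => _; last by rewrite (rmorph1 (in_alg L)) (rmorph1 ev) !mul1r.
  by rewrite (rmorphN1 (in_alg L)) (rmorphN1 ev) mulrNN !mul1r.
have -> : map_poly (in_alg L) P
    = 'X + \sum_i (phi_poly n x y hf z)`_(@outdeg n i) *: 'X^(outdeg i).
  rewrite /target_poly rmorphD rmorph_sum; congr (_ + _); first exact: map_polyX.
  apply: eq_bigr => i _; apply: etrans (map_polyZ _ _ _) _.
  by congr (_ *: _); [apply: coefP | apply: map_polyXn].
rewrite (coef_outdeg_sum hn (fun j => (phi_poly n x y hf z)`_j)).
apply/polyP => j; rewrite coefD coefX coef_poly.
have [jn|nj] := ltnP j n.+1; last first.
  rewrite addr0 nth_default ?(leq_trans sP) //.
  by rewrite (_ : (j == 1)%N = false) //; lia.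
by have [->|_] := eqVneq j 1%N; rewrite ?c1 ?addr0 ?add0r.
Qed.

Lemma free_coef_neq0 i : ~~ (2 <= outdeg i <= k)%N -> w i != 0.
Proof.
move=> fi; apply/eqP => wi0.
have /(proj1 hF) Xi0 : mmap iota w 'X_i = 0 by rewrite mmapX mmap1U.
pose u (j : 'I_n) : R[i] := if (2 <= outdeg j <= k)%N then c (outdeg j) else 1.
have /Xi0 : target_locus k c u by move=> j jk; rewrite /u jk.
by rewrite mevalXU /u (negPf fi) => /eqP; rewrite oner_eq0.
Qed.

Lemma target_coef i : P`_(@outdeg n i) = outsign F i * w i.
Proof.
rewrite /target_poly coefD coefX (negPf (outdeg_neq1 hn i)) add0r coef_sum.
rewrite (bigD1 i) //= coefZ coefXn eqxx mulr1 big1 ?addr0 // => j ji.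
rewrite coefZ coefXn (inj_eq (outdeg_inj hn)) eq_sym (negPf ji).
by rewrite mulr0.
Qed.

Lemma target_coef_neq0 j : (j == 0%N) || (n.-1 <= j <= n)%N -> P`_j != 0.
Proof.
move=> jP; have [||i iE] := @outdeg_surj n hn j; [by clear -jP hn; lia..|].
rewrite -iE target_coef mulf_neq0 //.
  by rewrite /outsign; case: ifP; rewrite ?oppr_eq0 oner_eq0.
by apply: free_coef_neq0; rewrite iE; clear -jP hn hk; lia.
Qed.

Lemma size_target_polyE : size P = n.+1.
Proof.
apply/eqP; rewrite eqn_leq (size_target_poly hn) /=.
have : P`_n != 0 by apply: target_coef_neq0; rewrite leq_pred leqnn orbT.
by apply: contraNT; rewrite -leqNgt => sP; rewrite nth_default.
Qed.

Lemma source_coef j : in_alg L P`_j = (phi_poly n x y hf z)`_j.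
Proof. by rewrite -source_poly; apply/esym/(coef_map (in_alg L)). Qed.

(** If [p] vanished, [Phi_n] would have degree less than [n], against the freedom of [q]. *)
Lemma source_p_neq0 : p != 0.
Proof.
have : P`_n != 0 by apply: target_coef_neq0; rewrite leq_pred leqnn orbT.
apply: contra => /eqP p0; apply/eqP/(fmorph_inj (in_alg L)).
apply: etrans (source_coef _) _; rewrite (rmorph0 (in_alg L)).
by rewrite (@phi_top _ n x y hf z hn) // -source_pE.
Qed.

(** If [x] vanished, so would the constant term [- b]. *)
Lemma source_x_neq0 : x != 0.
Proof.
have : P`_0 != 0 by apply: target_coef_neq0.
apply: contra => /eqP x0; apply/eqP/(fmorph_inj (in_alg L)).
apply: etrans (source_coef _) _; rewrite (rmorph0 (in_alg L)).
by rewrite (@phi_coef0 _ n x y hf z) // x0 oppr0 expr0n mul0r addr0.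
Qed.

Lemma source_root : (map_poly (in_alg L) P).[tL] = 0.
Proof.
rewrite source_poly /tL source_pE phi_root // -source_pE.
exact: source_p_neq0.
Qed.

Lemma source_deriv : (map_poly (in_alg L) P)^`().[tL] = aL ^+ (n - 2).
Proof.
rewrite source_poly /tL /aL source_pE phi_deriv_root // -source_pE.
exact: source_p_neq0.
Qed.

Lemma source_gen (V : {subfield L}) : tL \in V -> aL \in V -> ({:L} <= V)%VS.
Proof.
move=> tV aV; have p0 := source_p_neq0; have x0 := source_x_neq0.
have phiV : phi_poly n x y hf z \is a polyOver V.
  by rewrite -source_poly alg_polyOver.
rewrite /tL /aL source_pE in p0 tV aV.
have vV i : v i \in V.
  have -> : v i = ev 'X_i by rewrite /ev /= mmapX mmap1U.
  have -> : 'X_i = Defs.coord R n i :> {mpoly R[i][n]} by rewrite /Defs.coord valK.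
  case: i => [[|[|i]] lt] /=.
  - exact: (phi_x_mem p0 tV aV).
  - exact: (phi_y_mem p0 x0 tV aV).
  apply: (phi_z_mem hn source_half p0 x0 phiV tV aV (j := i.+3)).
  by apply/andP; split.
have evV f : ev f \in V.
  rewrite /ev /= /mmap rpred_sum // => mm _; apply: rpredM.
    by rewrite rpredZ // rpred1.
  by apply: rpred_prod => i _; apply: rpredX.
apply/subvP => e _; have [f [g [_ ->]]] := proj2 hL e.
by rewrite rpred_div // evV.
Qed.

End Source.

(** * Arcs in the target *)

Section TargetArcs.
Variables (R : realType) (n : nat).
Hypothesis hn : (3 <= n)%N.
Variables (k : nat) (c : nat -> R[i]).
Hypothesis hk : (k <= n - 2)%N.
Variables (F : fieldType) (iota : {rmorphism R[i] -> F}) (w : 'I_n -> F).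
Hypothesis hF : is_function_field (target_locus k c) iota w.
Local Notation P := (target_poly w).
Local Notation m := (n - 2)%N.

Lemma natr_complex_neq0 j : (0 < j)%N -> j%:R != 0 :> R[i].
Proof. by move=> k0; rewrite pnatr_eq0 -lt0n. Qed.
Let charC := natr_complex_neq0.
Let m0 : (0 < m)%N. Proof. by rewrite subn_gt0. Qed.
Let n0 : (0 < n)%N. Proof. exact: leq_trans hn. Qed.
Let N := n`!.
Let E := (m * N)%N.
Let Kx := (m * (2 * E))%N.
Let E0 : (0 < E)%N. Proof. by rewrite muln_gt0 m0 fact_gt0. Qed.
Let EKx : (E < Kx)%N.
Proof.
have EmE : (E <= m * E)%N by rewrite leq_pmull.
by rewrite /Kx mulnCA mul2n -addnn -addn1 leq_add // (leq_trans E0 EmE).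
Qed.

Lemma target_neq0 : P != 0.
Proof. by rewrite -size_poly_eq0 (size_target_polyE hn hk hF). Qed.

Section OneArc.
Variables q0 r0 b0 : R[i].
Hypothesis q00 : q0 != 0.
Local Notation M := (arc_base n q0 r0 b0).

Lemma coef_arc_base j : M`_j =
  q0 * (j == n)%:R + r0 * (j == n.-1)%:R - (if j == 0%N then b0 else 0).
Proof. by rewrite /arc_base coefB coefD !coefZ !coefXn coefC. Qed.

Lemma size_arc_base : size M = n.+1 /\ lead_coef M = q0.
Proof.
have top : M`_n = q0.
  rewrite coef_arc_base eqxx.
  have -> : (n == n.-1) = false by clear -hn; lia.
  have -> : (n == 0%N) = false by clear -hn; lia.
  by rewrite mulr1 mulr0 addr0 subr0.
have sz : size M = n.+1.
  apply/eqP; rewrite eqn_leq; apply/andP; split.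
    apply/leq_sizeP => j nj; rewrite coef_arc_base.
    have -> : (j == n) = false by clear -hn nj; lia.
    have -> : (j == n.-1) = false by clear -hn nj; lia.
    have -> : (j == 0%N) = false by clear -hn nj; lia.
    by rewrite !mulr0 addr0 subr0.
  apply: contraT; rewrite -leqNgt => sM; move: q00.
  by rewrite -top nth_default ?eqxx.
by split=> //; rewrite lead_coefE sz.
Qed.

Lemma arc_base_split : exists rs, size rs = n /\ M = q0 *: \prod_(x <- rs) ('X - x%:P).
Proof.
have [sM lM] := size_arc_base.
have [rs e] := closed_field_poly_normal M; rewrite lM in e.
exists rs; split=> //; have := sM.
by rewrite e size_scale // size_prod_XsubC => -[].
Qed.

Lemma arc_setup : exists (phi : {rmorphism F -> laurent F})
    (rho : {rmorphism laurent F -> laurent F}) (u : R[i]),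
  [/\ forall x, phi (iota x) = laurent_const F (iota x),
      laurent_var F ^+ Kx *: map_poly phi P
        = map_poly (fps_frac F) (arc_poly iota m N Kx M P),
      E.-primitive_root u,
      forall f, rho (fps_frac F f) = fps_frac F (fps_scale (iota u) f)
    & forall x, rho (phi x) = phi x].
Proof.
have [phi [phi_io phi_w]] := arc_phi_ex hn hk hF q0 r0 b0 E0 EKx.
have [u uP] := closed_prim_root charC E0.
have u0 : iota u != 0 by rewrite fmorph_eq0 (prim_root_eq0 uP) -lt0n.
have [rho rhoE] := laurent_scale u0.
exists phi, rho, u; split=> //.
  exact: (arc_phiP (m := m) (N := N) hn hk E0 EKx (erefl E) phi_io phi_w).
apply: (rho_phi_fixed hF phi_io phi_w).
- by move=> x; rewrite /laurent_const /= rhoE fps_scale_const.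
- rewrite rmorphXn /laurent_var rhoE fps_scale_var rmorphM exprMn.
  rewrite -[X in X * _](rmorphXn (fps_frac F \o @fps_const F)) -rmorphXn.
  by rewrite (prim_expr_order uP) !rmorph1 mul1r.
- by rewrite /Kx mulnA dvdn_mull.
Qed.

Lemma target_arc (Nf : splittingFieldType F) (t a : 'I_n -> Nf) :
  root_data m P t a ->
  (forall V : {subfield Nf}, (forall i, t i \in V) -> (forall i, a i \in V) ->
     ({:Nf} <= V)%VS) ->
  exists z : R[i], m.-primitive_root z /\
  exists (g : gal_of {:Nf}) (res : 'I_n -> R[i]),
  [/\ g \in 'Gal({:Nf} / 1)%g,
      M = q0 *: \prod_i ('X - (res i)%:P),
      forall i j, g (t i) = t j -> res j = res i,
      forall i j, res i = res j -> exists k, (g ^+ k)%g (t i) = t j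
    & forall i, (g ^+ mup (res i) M)%g (a i)
        = (iota (z ^+ (mup (res i) M).-1))%:A * a i].
Proof.
move=> [tE aE] gen; have [phi [rho [u [phi_io phiP uP rhoE rho_phi]]]] := arc_setup.
have [rs [srs ME]] := arc_base_split.
exists (u ^+ N); split; first exact: (wmP m0 uP).
exact: (arc_galois charC m0 n0 q00 srs ME (size_target_poly hn w) phi_io phiP uP rhoE rho_phi
  target_neq0 tE aE gen).
Qed.

End OneArc.

(** Irreducibility of [P], from the arc [M = T^n]. *)
Lemma target_factor_size (th : {poly F}) : th %| P -> (1 < size th)%N -> size th = n.+1.
Proof.
move=> thP sth; apply/eqP; rewrite eqn_leq; apply/andP; split.
  by rewrite -(size_target_polyE hn hk hF) dvdp_leq // target_neq0.
have [phi [rho [u [phi_io phiP uP rhoE rho_phi]]]] := arc_setup 1 0 0.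
have [rs [srs ME]] := arc_base_split 0 0 (oner_neq0 R[i]).
apply: (arc_factor_size charC m0 n0 (oner_neq0 _) srs ME (size_target_poly hn w)
  phiP uP rhoE rho_phi _ target_neq0 thP sth).
by rewrite /arc_base scale0r addr0 polyC0 subr0.
Qed.

End TargetArcs.

(** * Galois action on the roots and the radicals *)

Lemma mem_gal1 (F : fieldType) (N : splittingFieldType F) (g : gal_of {:N}) :
  g \in 'Gal({:N} / 1)%g.
Proof. by rewrite gal_kHom ?sub1v // k1AHom. Qed.

Lemma gal_alg (F : fieldType) (N : splittingFieldType F) (g : gal_of {:N}) (c : F) :
  g c%:A = c%:A.
Proof. by rewrite linearZ /= rmorph1. Qed.

Lemma gal_poly (F : fieldType) (N : splittingFieldType F) (g : gal_of {:N})
  (p : {poly F}) : map_poly g (map_poly (in_alg N) p) = map_poly (in_alg N) p.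
Proof. by rewrite -map_poly_comp; apply: eq_map_poly => c /=; apply: gal_alg. Qed.

(** In characteristic zero, differentiation lowers the multiplicity of a root by one. *)
Lemma mup_deriv (C : closedFieldType) (p : {poly C}) x :
  (forall k, (0 < k)%N -> k%:R != 0 :> C) -> p != 0 -> root p x ->
  mup x p = (mup x p^`()).+1.
Proof.
move=> charC p0 px; set e := mup x p.
have e0 : (0 < e)%N by rewrite -XsubC_dvd // dvdp_XsubCl.
have pE := mup_cofactorE x p0; have g0 := mup_cofactor_neq0 x p0.
set g := mup_cofactor p x in pE g0; rewrite -/e in pE.
have -> : p^`() = ('X - x%:P) ^+ e.-1 * (e%:R *: g + ('X - x%:P) * g^`()).
  rewrite {1}pE derivM deriv_exp derivXsubC mul1r mulrDr; congr (_ + _).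
    by rewrite -scalerAr scaler_nat mulrnAl.
  by rewrite mulrA -exprSr prednK.
rewrite mupMl ?mup_XsubCX ?eqxx ?prednK //.
rewrite rootE !hornerE subrr mul0r addr0 mulf_neq0 //.
exact: charC.
Qed.

Section Sheets.
Variables (R : realType) (n : nat).
Hypothesis hn : (3 <= n)%N.
Variables (k : nat) (c : nat -> R[i]).
Hypothesis hk : (k <= n - 2)%N.
Variables (F : fieldType) (iota : {rmorphism R[i] -> F}) (w : 'I_n -> F).
Hypothesis hF : is_function_field (target_locus k c) iota w.
Local Notation P := (target_poly w).
Local Notation m := (n - 2)%N.
Let m0 : (0 < m)%N. Proof. by rewrite subn_gt0. Qed.

(** By irreducibility: the greatest common divisor of [P] and [P'] is a factor of [P] of
    smaller degree. *)
Lemma target_separable : separable_poly P.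
Proof.
rewrite unlock /coprimep; have P0 := target_neq0 hn hk hF.
have sP := size_target_polyE hn hk hF.
have P'0 : P^`() != 0.
  have : P^`()`_n.-1 != 0.
    rewrite coef_deriv prednK ?(leq_trans _ hn) // -mulr_natr mulf_neq0 //.
      by apply: (target_coef_neq0 hn hk hF); rewrite leq_pred leqnn orbT.
    by rewrite -(rmorph_nat iota) fmorph_eq0 pnatr_eq0 -lt0n (leq_trans _ hn).
  by apply: contraNneq => ->; rewrite coef0.
have g0 : gcdp P P^`() != 0 by rewrite gcdp_eq0 (negPf P0).
rewrite eqn_leq size_poly_gt0 g0 andbT leqNgt; apply/negP => sg.
have := target_factor_size hn hk hF (dvdp_gcdl P P^`()) sg.
have := dvdp_leq P'0 (dvdp_gcdr P P^`()); have := lt_size_deriv P0.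
by rewrite sP; move: (size _) (size _) => u v; clear; lia.
Qed.

Section RootData.
Variables (N : splittingFieldType F) (t a : 'I_n -> N).
Hypothesis rd : root_data m P t a.
Hypothesis gen : forall V : {subfield N},
  (forall i, t i \in V) -> (forall i, a i \in V) -> ({:N} <= V)%VS.
Local Notation PN := (map_poly (in_alg N) P).

Definition constN : {rmorphism R[i] -> N} := in_alg N \o iota.

Lemma gal_cst (g : gal_of {:N}) x : g (constN x) = constN x.
Proof. exact: gal_alg. Qed.

Lemma gal_cstM (g : gal_of {:N}) x y : g (constN x * y) = constN x * g y.
Proof. by rewrite rmorphM; congr (_ * _); apply: gal_cst. Qed.

Lemma lead_target_neq0 : lead_coef PN != 0.
Proof. by rewrite lead_coef_eq0 map_poly_eq0 (target_neq0 hn hk hF). Qed.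

Lemma root_data_t_inj : injective t.
Proof.
have [tE _] := rd.
have : separable_poly PN by rewrite separable_map target_separable.
rewrite tE (eqp_separable (eqp_scale _ lead_target_neq0)).
rewrite -(big_map t xpredT (fun x => 'X - x%:P)) separable_prod_XsubC.
move=> u; apply/injectiveP; rewrite /injectiveb /dinjectiveb enumT.
by move: u; rewrite /index_enum unlock.
Qed.

Lemma root_data_a_neq0 i : a i != 0.
Proof.
have [tE aE] := rd; have : a i ^+ m != 0; last by rewrite expf_eq0 m0.
rewrite aE tE deriv_at_root mulf_neq0 ?lead_target_neq0 //.
apply/prodf_neq0 => j ji; rewrite subr_eq0 (inj_eq root_data_t_inj) eq_sym.
exact: ji.
Qed.

Lemma target_root x : root PN x -> exists i, x = t i.
Proof.
have [tE _] := rd; rewrite tE rootZ ?lead_target_neq0 // -(big_map t xpredT (fun x => 'X - x%:P)).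
by rewrite root_prod_XsubC => /mapP[i _ ->]; exists i.
Qed.

Lemma root_data_root i : root PN (t i).
Proof.
have [tE _] := rd; rewrite tE rootZ ?lead_target_neq0 // -(big_map t xpredT (fun x => 'X - x%:P)).
by rewrite root_prod_XsubC map_f // mem_index_enum.
Qed.

Lemma derivative_root_mu x i : x ^+ m = PN^`().[t i] ->
  exists xi : mu R m, x = constN (ssval xi) * a i.
Proof.
have [_ aE] := rd; move=> xm.
have [z zP] := closed_prim_root (@natr_complex_neq0 R) m0.
have zP' : m.-primitive_root (constN z) by rewrite fmorph_primitive_root.
have [j jE] := expr_eq_prim zP' (root_data_a_neq0 i) (etrans xm (esym (aE i))).
have [|xi xiE] := @mu_exists R n hn (z ^+ j).
  by rewrite exprAC (prim_expr_order zP) expr1n.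
by exists xi; rewrite xiE rmorphXn.
Qed.

(** [ze] takes values in the base field rather than in [mu_m], so that products and
    inverses need no proof of membership; see [acts_root]. *)
Definition acts (g : gal_of {:N}) (ze : 'I_n -> R[i]) (s : 'S_n) :=
  forall i, g (t i) = t (s i) /\ g (a i) = constN (ze i) * a (s i).

Lemma gal_acts (g : gal_of {:N}) : exists (ze : {ffun 'I_n -> mu R m}) (s : 'S_n),
  acts g (fun i => ssval (ze i)) s.
Proof.
have [_ aE] := rd.
have ext i : exists j, g (t i) = t j.
  by apply: target_root; rewrite -(gal_poly g P) fmorph_root root_data_root.
pose f i := projT1 (cid (ext i)).
have fE i : g (t i) = t (f i) by exact: projT2 (cid (ext i)).
have f_inj : injective f.
  move=> i j e; apply: root_data_t_inj; apply: (fmorph_inj g).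
  by apply: (etrans (fE i)); rewrite e; apply/esym/fE.
have exa i : exists xi : mu R m, g (a i) = constN (ssval xi) * a (f i).
  apply: derivative_root_mu; rewrite -rmorphXn aE -horner_map /= -deriv_map gal_poly.
  by rewrite -fE.
exists [ffun i => projT1 (cid (exa i))], (perm f_inj) => i.
by rewrite permE ffunE; split=> //; apply: projT2 (cid (exa i)).
Qed.

Lemma acts_uniq g ze1 s1 ze2 s2 : acts g ze1 s1 -> acts g ze2 s2 ->
  s1 = s2 /\ ze1 =1 ze2.
Proof.
move=> h1 h2; have s12 : s1 = s2.
  apply/permP => i; apply: root_data_t_inj.
  by have [<- _] := h1 i; have [<- _] := h2 i.
split=> // i; have [_ e1] := h1 i; have [_ e2] := h2 i.
by move: e1; rewrite e2 s12 => /(mulIf (root_data_a_neq0 _))/fmorph_inj.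
Qed.

Lemma acts_mul g1 ze1 s1 g2 ze2 s2 : acts g1 ze1 s1 -> acts g2 ze2 s2 ->
  acts (g1 * g2)%g (fun i => ze1 i * ze2 (s1 i)) (s1 * s2)%g.
Proof.
move=> h1 h2 i; have [t1 a1] := h1 i; have [t2 a2] := h2 (s1 i).
rewrite !galM ?memvf // t1 t2 a1 permM; split=> //.
by rewrite gal_cstM a2 [constN (_ * _)]rmorphM mulrA.
Qed.

Lemma acts_inv g ze s : acts g ze s -> (forall i, ze i != 0) ->
  acts g^-1%g (fun i => (ze (s^-1%g i))^-1) s^-1%g.
Proof.
move=> h ze0 i; have [ti ai] := h (s^-1%g i); rewrite permKV in ti ai.
have gV x y : g x = y -> g^-1%g y = x.
  by move=> <-; rewrite -galM ?memvf // mulgV gal_id.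
split; first exact: gV.
by apply: gV; rewrite gal_cstM ai mulrA -rmorphM mulVf // rmorph1 mul1r.
Qed.

Lemma acts_faithful g : acts g (fun=> 1) 1%g -> g = 1%g.
Proof.
move=> h; pose V := fixedField [set g].
have fix_mem x : g x = x -> x \in V.
  move=> gx; apply/fixedFieldP; first exact: memvf.
  by move=> g'; rewrite inE => /eqP ->.
apply/eqP/gal_eqP => x _; rewrite gal_id.
have /subvP/(_ x (memvf x)) : ({:N} <= V)%VS.
  apply: gen => i; apply: fix_mem; have [hti hai] := h i.
    by rewrite hti perm1.
  by rewrite hai perm1 rmorph1 mul1r.
move=> /(fixedFieldP (memvf x)); apply; exact: set11.
Qed.

Lemma acts_sqr (g : gal_of {:N}) (ze : 'I_n -> R[i]) s i : acts g ze s -> (g ^+ 2)%g (a i)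
  = constN (ze i * ze (s i)) * a ((s * s)%g i).
Proof. by move=> h; rewrite expgS expg1; have [_] := acts_mul h h i. Qed.

Lemma acts_root g (ze : 'I_n -> R[i]) s i : acts g ze s -> ze i ^+ m = 1.
Proof.
move=> h; have [ze' [s' h']] := gal_acts g.
by have [_ ->] := acts_uniq h h'; apply: (mu_exp hn).
Qed.

Lemma acts_parity g (ze : 'I_n -> R[i]) s : ~~ odd m -> acts g ze s ->
  (\prod_i ze i) ^+ (m %/ 2) = (-1) ^+ s.
Proof.
move=> em h; have [tE aE] := rd.
have en : ~~ odd n by move: em; rewrite oddB ?(ltnW hn) // addbF.
apply: (galois_parity (io := constN) (q := lead_coef PN) (t := t) (a := a) (G := g)) => //.
- by exists 'i%C; rewrite sqr_i.
- by move=> i; rewrite aE {1}tE.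
- exact: root_data_a_neq0.
- by rewrite lead_coef_map; apply: gal_alg.
- exact: gal_cst.
- by move=> i; case: (h i).
- by move=> i; case: (h i).
Qed.

Definition realized (ze : 'I_n -> R[i]) (s : 'S_n) := exists g, acts g ze s.

Lemma realized_of (g : gal_of {:N}) i j : g (t i) = t j -> exists ze s, realized ze s /\ s i = j.
Proof.
move=> gij; have [ze [s h]] := gal_acts g.
exists (fun i => ssval (ze i)), s; split; first by exists g.
by apply: root_data_t_inj; have [<- _] := h i.
Qed.

Lemma arc_roots_of (q0 r0 b0 : R[i]) (res : 'I_n -> R[i]) : q0 != 0 ->
  arc_base n q0 r0 b0 = q0 *: \prod_i ('X - (res i)%:P) ->
  forall x, root (arc_base n q0 r0 b0) x = [exists i, res i == x].
Proof.
move=> q00 -> x; rewrite rootZ // -(big_map res xpredT (fun x => 'X - x%:P)).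
rewrite root_prod_XsubC; apply/mapP/existsP => [[i _ ->]|[i /eqP <-]]; exists i => //.
by rewrite mem_index_enum.
Qed.

Lemma arc_mult_of (q0 r0 b0 : R[i]) (res : 'I_n -> R[i]) : q0 != 0 ->
  arc_base n q0 r0 b0 = q0 *: \prod_i ('X - (res i)%:P) ->
  forall x, mup x (arc_base n q0 r0 b0) = #|[set i | res i == x]|.
Proof.
move=> q00 -> x; rewrite -mul_polyC mupMr ?rootC //.
rewrite -(big_map res xpredT (fun x => 'X - x%:P)) mu_prod_XsubC count_map.
rewrite -sum1_count -sum1_card; apply: eq_bigl => i.
by rewrite inE.
Qed.

(** The arc [M = T^n], with one cluster. *)
Lemma realized_trans i j : exists ze s, realized ze s /\ s i = j.
Proof.
have [z [_ [g [res [_ ME _ cyc _]]]]] :=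
  target_arc hn hk hF 0 0 (oner_neq0 _) rd gen.
have res0 i' : res i' = 0.
  have : root (arc_base n (1 : R[i]) 0 0) (res i').
    by rewrite (arc_roots_of (oner_neq0 _) ME); apply/existsP; exists i'.
  rewrite /arc_base rootE !hornerE subr0 expf_eq0.
  by case/andP => _ /eqP.
have [j' gij] := cyc i j (etrans (res0 i) (esym (res0 j))).
exact: realized_of gij.
Qed.

Lemma arc_pow_res (res : 'I_n -> R[i]) (g : gal_of {:N}) :
  (forall i j, g (t i) = t j -> res j = res i) ->
  forall l i j, (g ^+ l)%g (t i) = t j -> res j = res i.
Proof.
move=> h; elim=> [|l IHl] i j.
  by rewrite expg0 gal_id => /root_data_t_inj ->.
rewrite expgS galM ?memvf //; have [ze [s hg]] := gal_acts g.
by have [gt _] := hg i; rewrite gt => /IHl ->; apply: h.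
Qed.

(** The arc [M = T^n - T^(n-1)], with a cluster of size [n - 1] at 0 and a single root
    at 1. *)
Lemma realized_trans2 : exists i0, forall i j, i != i0 -> j != i0 ->
  exists ze s, [/\ realized ze s, s i0 = i0 & s i = j].
Proof.
have [z [_ [g [res [_ ME pres cyc _]]]]] :=
  target_arc hn hk hF (-1) 0 (oner_neq0 _) rd gen.
have ME' : arc_base n (1 : R[i]) (-1) 0 = 'X^(n.-1) * ('X - 1).
  rewrite /arc_base scale1r scaleN1r polyC0 subr0 mulrBr mulr1 -exprSr.
  by rewrite prednK // (leq_trans _ hn).
have rt x : root (arc_base n (1 : R[i]) (-1) 0) x -> x = 0 \/ x = 1.
  rewrite ME' rootM => /orP[]; rewrite rootE !hornerE ?expf_eq0.
    by case/andP => _ /eqP; left.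
  by rewrite subr_eq0 => /eqP; right.
have m1 : mup 1 (arc_base n (1 : R[i]) (-1) 0) = 1%N.
  rewrite ME' mupMr; last by rewrite rootE !hornerE expr1n oner_eq0.
  by have := mup_XsubCX 1 (1 : R[i]) 1; rewrite eqxx expr1 polyC1.
have /eqP/cards1P[i0 i0E] : #|[set i | res i == 1]| = 1%N.
  by rewrite -(arc_mult_of (oner_neq0 _) ME).
have res1 i : (res i == 1) = (i == i0).
  by have := in_set1 i i0; rewrite -i0E inE.
have res0 i : i != i0 -> res i = 0.
  move=> ii0; have /rt[//|e] : root (arc_base n (1 : R[i]) (-1) 0) (res i).
    by rewrite (arc_roots_of (oner_neq0 _) ME); apply/existsP; exists i.
  by move: ii0; rewrite -res1 e eqxx.
exists i0 => i j ii0 ji0.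
have [l gij] := cyc i j (etrans (res0 i ii0) (esym (res0 j ji0))).
have [ze [s h]] := gal_acts (g ^+ l)%g.
exists (fun i => ssval (ze i)), s; split; first by exists (g ^+ l)%g.
  have [gi0 _] := h i0; have := arc_pow_res pres gi0.
  by move=> e; apply/eqP; rewrite -res1 e res1.
by apply: root_data_t_inj; have [<- _] := h i.
Qed.

(** The arc [M = (n-1) T^n - n T^(n-1) + 1]. Its derivative is [n (n-1) T^(n-2) (T - 1)],
    so 1 is a double root and the other roots are simple. *)
Lemma realized_swap : exists (z : R[i]) i1 i2 ze, [/\ m.-primitive_root z, i1 != i2,
  realized ze (tperm i1 i2),
  forall i, i != i1 -> i != i2 -> ze i = 1 & ze i1 * ze i2 = z].
Proof.
have n1 : (0 < n.-1)%N by clear -hn; lia.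
pose q0 : R[i] := n.-1%:R; pose r0 : R[i] := - n%:R.
have q00 : q0 != 0 by apply: natr_complex_neq0.
have [z [zP [g [res [_ ME pres cyc pow]]]]] := target_arc hn hk hF r0 (-1) q00 rd gen.
set M := arc_base n q0 r0 (-1) in ME pow.
have M'E : M^`() = ('X - 1%:P) * ((n%:R * n.-1%:R : R[i]) *: 'X^(n.-2)).
  rewrite /M /arc_base derivB derivD !derivZ !derivXn derivC subr0.
  rewrite -['X^(n.-1) *+ n]scaler_nat -['X^(n.-2) *+ n.-1]scaler_nat !scalerA /r0 /q0.
  rewrite [n.-1%:R * n%:R]mulrC mulNr scaleNr mulrBl -scalerAr -exprS prednK //.
  by rewrite polyC1 mul1r.
have M0 : M != 0.
  by rewrite /M -size_poly_eq0; have [-> _] := size_arc_base hn r0 (-1) q00.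
have nn0 : (n%:R * n.-1%:R : R[i]) != 0.
  by rewrite mulf_neq0 // natr_complex_neq0 // (leq_trans _ hn).
have rt := arc_roots_of q00 ME; have mt := arc_mult_of q00 ME.
have M_0 : ~~ root M 0.
  rewrite rootE /M /arc_base !hornerE !expr0n.
  have -> : (n == 0%N) = false by clear -hn; lia.
  have -> : (n.-1 == 0%N) = false by clear -hn; lia.
  by rewrite !mulr0 addr0 add0r opprK oner_eq0.
have M_1 : root M 1.
  rewrite rootE /M /arc_base !hornerE !expr1n !mulr1 /q0 /r0 opprK.
  by rewrite -{2}[n]prednK ?(leq_trans _ hn) // -addn1 natrD opprD addrA subrr add0r addNr.
have mup1 : mup 1 M = 2.
  rewrite (mup_deriv (@natr_complex_neq0 R) M0 M_1) M'E mupMl.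
    by have := mup_XsubCX 1 (1 : R[i]) 1; rewrite eqxx expr1 => ->.
  by rewrite rootE !hornerE expr1n mulr1.
have mup_other x : root M x -> x != 1 -> mup x M = 1%N.
  move=> Mx x1; rewrite (mup_deriv (@natr_complex_neq0 R) M0 Mx); congr _.+1.
  apply: mupNroot; rewrite M'E rootM root_XsubC negb_or x1 /=.
  rewrite rootE !hornerE mulf_neq0 // expf_neq0 //.
  by apply: contraNneq M_0 => <-.
have /eqP/cards2P[i1 [i2 [i12 i12E]]] : #|[set i | res i == 1]| = 2 by rewrite -mt.
have res1 i : (res i == 1) = (i == i1) || (i == i2).
  by have := in_set2 i i1 i2; rewrite -i12E inE.
have res_i1 : res i1 = 1 by apply/eqP; rewrite res1 eqxx.
have res_i2 : res i2 = 1 by apply/eqP; rewrite res1 eqxx orbT.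
have resM i : root M (res i) by rewrite rt; apply/existsP; exists i.
have [ze [s h]] := gal_acts g.
have s_res i : res (s i) = res i by apply: pres; case: (h i).
have other i : i != i1 -> i != i2 -> s i = i /\ ssval (ze i) = 1.
  move=> n1' n2'; have r1 : res i != 1 by rewrite res1 (negPf n1') (negPf n2').
  have mi := mup_other _ (resM i) r1.
  have si : s i = i.
    have /eqP/cards1P[j jE] : #|[set j | res j == res i]| = 1%N by rewrite -mt.
    have : s i \in [set j | res j == res i] by rewrite inE s_res.
    have : i \in [set j | res j == res i] by rewrite inE.
    by rewrite jE !in_set1 => /eqP -> /eqP.
  split=> //; have [_ ai] := h i; have := pow i.
  rewrite mi expg1 ai si /= rmorph1 scale1r => /(mulIf (root_data_a_neq0 i)) e.
  by apply: (fmorph_inj constN); rewrite rmorph1.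
have si1 : s i1 = i2.
  have [l gl] := cyc i1 i2 (etrans res_i1 (esym res_i2)).
  have : (s i1 == i1) || (s i1 == i2) by rewrite -res1 s_res res_i1.
  case/orP => /eqP // s1; case/eqP: i12; apply: root_data_t_inj; rewrite -gl.
  have fixed : g (t i1) = t i1 by have [-> _] := h i1; rewrite s1.
  elim: (l) => [|l' IHl]; first by rewrite expg0 gal_id.
  by rewrite expgS galM ?memvf // fixed.
have si2 : s i2 = i1.
  have : (s i2 == i1) || (s i2 == i2) by rewrite -res1 s_res res_i2.
  case/orP => /eqP // s2; case/eqP: i12.
  by apply: (@perm_inj _ s); rewrite si1 s2.
have sE : s = tperm i1 i2.
  apply/permP => i; have [->|n1'] := eqVneq i i1; first by rewrite tpermL.
  have [->|n2'] := eqVneq i i2; first by rewrite tpermR.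
  by rewrite tpermD 1?eq_sym //; case: (other i).
exists z, i1, i2, (fun i => ssval (ze i)); split=> //.
- by exists g; rewrite -sE.
- by move=> i n1' n2'; case: (other i).
have := pow i1; rewrite res_i1 mup1 expr1 (acts_sqr i1 h) permM si1 si2.
by move=> /(mulIf (root_data_a_neq0 i1))/fmorph_inj.
Qed.

Lemma realized_full (ze : 'I_n -> R[i]) (s : 'S_n) : (forall i, ze i ^+ m = 1) ->
  odd m || ((\prod_i ze i) ^+ (m %/ 2) == (-1) ^+ s) -> realized ze s.
Proof.
have [z [i1 [i2 [ze12 [zP i12 h12 off on]]]]] := realized_swap.
have [i0 tr2] := realized_trans2.
have nz ze' s' i : realized ze' s' -> ze' i != 0.
  move=> [g h]; have := acts_root i h; apply: contra_eq_neq => ->.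
  by rewrite expr0n eqn0Ngt m0 eq_sym oner_eq0.
apply: (wreath_full zP hn (W := realized) _ _ _ nz realized_trans tr2 i12 h12 off on).
- move=> ze1 ze2 s' e [g h]; exists g => i.
  by have [h1 h2] := h i; rewrite -e.
- by move=> ze1 s1 ze2 s2 [g1 h1] [g2 h2]; exists (g1 * g2)%g; apply: acts_mul.
- move=> ze' s' [g h]; exists g^-1%g; apply: acts_inv => // i.
  by apply: (nz _ s'); exists g.
- by move=> ze' s' i [g h]; apply: acts_root h.
- by move=> ze' s' om [g h]; apply: acts_parity h.
Qed.

End RootData.
End Sheets.

(** * Sheets and monodromy *)

Section Cover.
Variables (R : realType) (n : nat).
Hypothesis hn : (3 <= n)%N.
Variables (k : nat) (c : nat -> R[i]).
Hypothesis hk : (k <= n - 2)%N.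
Variables (F : fieldType) (iota : {rmorphism R[i] -> F}) (w : 'I_n -> F).
Hypothesis hF : is_function_field (target_locus k c) iota w.
Local Notation P := (target_poly w).
Local Notation m := (n - 2)%N.
Let m0 : (0 < m)%N. Proof. by rewrite subn_gt0. Qed.
Variables (L : fieldExtType F) (tL aL : L).
Hypothesis tLP : (map_poly (in_alg L) P).[tL] = 0.
Hypothesis aLP : (map_poly (in_alg L) P)^`().[tL] = aL ^+ m.
Hypothesis genL : forall V : {subfield L}, tL \in V -> aL \in V -> ({:L} <= V)%VS.
Variable (N : splittingFieldType F).
Local Notation PN := (map_poly (in_alg N) P).

Lemma ahom_poly (j : 'AHom(L, N)) (p : {poly F}) :
  map_poly j (map_poly (in_alg L) p) = map_poly (in_alg N) p.
Proof.
by rewrite -map_poly_comp; apply: eq_map_poly => x /=; rewrite linearZ /= rmorph1.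
Qed.

Lemma ahom_root (j : 'AHom(L, N)) : root PN (j tL).
Proof. by rewrite -(ahom_poly j) rootE horner_map tLP rmorph0. Qed.

Lemma ahom_deriv (j : 'AHom(L, N)) : j aL ^+ m = PN^`().[j tL].
Proof. by rewrite -rmorphXn -aLP -horner_map /= -deriv_map ahom_poly. Qed.

(** [P] is, up to a constant, the minimal polynomial of the image of [tL], so it splits in
    the normal extension [N]; conjugating the image of [aL] gives the [m]-th roots. *)
Lemma root_data_exists (j : 'AHom(L, N)) : exists t a : 'I_n -> N, root_data m P t a.
Proof.
pose mp := minPoly 1%AS (j tL).
have [th thE] := polyOver1P (minPolyOver 1%AS (j tL)).
have mpP : mp %| PN by apply: minPoly_dvdp; rewrite ?alg_polyOver ?ahom_root.
have sth : size th = n.+1.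
  apply: (target_factor_size hn hk hF).
    by rewrite -(dvdp_map (in_alg N)) -thE.
  by rewrite -(size_map_poly (in_alg N)) -thE size_minPoly ltnS.
have smp : size mp = n.+1 by rewrite /mp thE size_map_poly.
have PE : PN = lead_coef PN *: mp.
  have : mp %= PN by rewrite -dvdp_size_eqp // smp size_map_poly (size_target_polyE hn hk hF).
  move=> /eqp_eq; rewrite (monicP (monic_minPoly _ _)) scale1r => e.
  exact: esym e.
have [r /eqP rE] := splitting_field_normal (1%AS : {subfield N}) (j tL).
have sr : size r = n by move: smp; rewrite /mp rE size_prod_XsubC => -[].
pose t (i : 'I_n) := r`_i.
have tE : PN = lead_coef PN *: \prod_i ('X - (t i)%:P).
  by rewrite {1}PE /mp rE (big_nth 0) sr big_mkord.
have exa i : exists x, x ^+ m = PN^`().[t i].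
  have [||||g gG gE] := @normalField_root_minPoly F N 1%AS {:N}%AS (j tL) (t i).
  - exact: sub1v.
  - exact: normalFieldf.
  - exact: memvf.
  - by rewrite rE root_prod_XsubC mem_nth // sr.
  exists (g (j aL)); rewrite -rmorphXn ahom_deriv -horner_map /= -deriv_map.
  by rewrite gal_poly gE.
exists t, (fun i => projT1 (cid (exa i))); split=> // i.
exact: projT2 (cid (exa i)).
Qed.

Hypothesis hN : is_normal_closure L N.

(** The subfield generated by the [t i] and the [a i] is stable under automorphisms, and it
    contains the image of the source field. *)
Lemma normal_closure_gen (t a : 'I_n -> N) : root_data m P t a ->
  forall V : {subfield N}, (forall i, t i \in V) -> (forall i, a i \in V) ->
  ({:N} <= V)%VS.
Proof.
move=> rd V tV aV; have [j minN] := hN.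
pose M := <<1%AS & codom t ++ codom a>>%AS.
have inM x : x \in codom t ++ codom a -> x \in M by apply: seqv_sub_adjoin.
have tM i : t i \in M by apply: inM; rewrite mem_cat codom_f.
have aM i : a i \in M by apply: inM; rewrite mem_cat codom_f orbT.
have cM x : in_alg N x \in M by rewrite /= rpredZ // mem1v.
suff NM : ({:N} <= M)%VS.
  apply: (subv_trans NM); apply/Fadjoin_seqP; split; first exact: sub1v.
  by move=> x; rewrite mem_cat => /orP[] /codomP[i ->].
apply: minN.
  have /(limgS j) jL : ({:L} <= <<1%AS & [:: tL; aL]>>%AS)%VS.
    by apply: genL; apply: seqv_sub_adjoin; rewrite !inE eqxx ?orbT.
  apply: (subv_trans jL); rewrite aimg_adjoin_seq aimg1; apply/Fadjoin_seqP.
  split; first exact: sub1v.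
  have [i ti] := target_root hn hk hF rd (ahom_root j).
  move=> x; rewrite !inE => /orP[] /eqP ->; first by rewrite ti.
  have [|xi ->] := derivative_root_mu hn hk hF rd (x := j aL) (i := i).
    by rewrite ahom_deriv ti.
  by rewrite rpredM // cM.
apply/forall_inP => x _; apply/eqP/eqP.
rewrite eqEdim limg_dim_eq ?leqnn ?andbT; last first.
  by rewrite (eqP (AEnd_lker0 x)) capv0.
rewrite aimg_adjoin_seq aimg1; apply/Fadjoin_seqP; split; first exact: sub1v.
have xP (p : {poly F}) : map_poly x (map_poly (in_alg N) p) = map_poly (in_alg N) p.
  by rewrite -map_poly_comp; apply: eq_map_poly => y /=; rewrite linearZ /= rmorph1.
have xt i : exists i', x (t i) = t i'.
  apply: (target_root hn hk hF rd); rewrite -(xP P) fmorph_root.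
  exact: (root_data_root hn hk hF rd).
move=> y; rewrite map_cat mem_cat => /orP[] /mapP[_ /codomP[i ->] ->].
  by have [i' ->] := xt i.
have [i' xi'] := xt i; have [tE aE] := rd.
have [|xi ->] := derivative_root_mu hn hk hF rd (x := x (a i)) (i := i').
  by rewrite -rmorphXn aE -horner_map /= -deriv_map xP xi'.
by rewrite rpredM // cM.
Qed.

Section Labelled.
Variables t a : 'I_n -> N.
Hypothesis rd : root_data m P t a.
Let gen := normal_closure_gen rd.
Local Notation constN := (constN iota N).
Let tI := root_data_t_inj hn hk hF rd.
Let a0 := root_data_a_neq0 hn hk hF rd.

Lemma ahom_sheet (phi : 'AHom(L, N)) : exists x : sheet R n,
  phi tL = t x.1 /\ phi aL = constN (ssval x.2) * a x.1.
Proof.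
have [i ti] := target_root hn hk hF rd (ahom_root phi).
have [|xi xiE] := derivative_root_mu hn hk hF rd (x := phi aL) (i := i).
  by rewrite ahom_deriv ti.
by exists (i, xi).
Qed.

Definition sheet_of (phi : 'AHom(L, N)) : sheet R n := projT1 (cid (ahom_sheet phi)).

Lemma sheet_ofP (phi : 'AHom(L, N)) : phi tL = t (sheet_of phi).1
  /\ phi aL = constN (ssval (sheet_of phi).2) * a (sheet_of phi).1.
Proof. exact: projT2 (cid (ahom_sheet phi)). Qed.

Lemma sheet_of_uniq (phi : 'AHom(L, N)) (x : sheet R n) :
  phi tL = t x.1 -> phi aL = constN (ssval x.2) * a x.1 -> sheet_of phi = x.
Proof.
move=> ti ai; have [e1 e2] := sheet_ofP phi; set y := sheet_of phi in e1 e2 *.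
have y1 : y.1 = x.1 by apply: tI; rewrite -e1 ti.
have y2 : y.2 = x.2.
  apply: val_inj; apply: (fmorph_inj constN); apply: (mulIf (a0 x.1)).
  by apply: etrans ai; rewrite e2 y1.
by rewrite [y]surjective_pairing y1 y2 -surjective_pairing.
Qed.

Lemma ahom_eq (phi psi : 'AHom(L, N)) : phi tL = psi tL -> phi aL = psi aL -> phi = psi.
Proof.
move=> et ea; have /subvP eqV : ({:L} <= ker_sub_ahom_aspace phi psi)%VS.
  by apply: genL; rewrite memv_ker add_lfunE opp_lfunE subr_eq0; apply/eqP.
apply/val_inj/lfunP => x /=; apply/eqP; rewrite -subr_eq0 -opp_lfunE -add_lfunE -memv_ker.
exact/eqV/memvf.
Qed.

Lemma sheet_of_inj : injective sheet_of.
Proof.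
move=> phi psi e; have [t1 a1] := sheet_ofP phi; have [t2 a2] := sheet_ofP psi.
by apply: ahom_eq; rewrite ?t1 ?t2 ?a1 ?a2 e.
Qed.

Lemma sheet_of_comp (g : gal_of {:N}) (phi : 'AHom(L, N)) (ze : {ffun 'I_n -> mu R m}) s :
    acts iota t a g (fun i => ssval (ze i)) s ->
  sheet_of (gal_repr g \o phi)%AF = sheet_perm hn ze s (sheet_of phi).
Proof.
move=> h; have [tp ap] := sheet_ofP phi; have [ti ai] := h (sheet_of phi).1.
apply: sheet_of_uniq; rewrite permE comp_lfunE; first by rewrite tp.
by rewrite ap gal_cstM ai mulrA mu_mulE [constN (_ * _)]rmorphM.
Qed.

(** Move a given embedding by an automorphism that sends [t_i] to [t_i'] and [a_i] to the
    required multiple of [a_i']; a third place absorbs the sign condition. *)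
Lemma sheet_of_surj (x : sheet R n) : exists phi, sheet_of phi = x.
Proof.
have [j _] := hN; have [tj aj] := sheet_ofP j; set y := sheet_of j in tj aj.
have y0 := mu_neq0 hn y.2; have x0 := mu_neq0 hn x.2.
have [l yl] : exists l : 'I_n, l != y.1.
  have : (0 < #|~: [set y.1]|)%N by rewrite cardsCs setCK card_ord cards1 subn_gt0 (leq_trans _ hn).
  by case/card_gt0P => l; rewrite !inE; exists l.
have [z zP] := closed_prim_root (@natr_complex_neq0 R) m0.
pose r := ssval x.2 / ssval y.2.
have rm : r ^+ m = 1 by rewrite expr_div_n !(mu_exp hn) divr1.
have r0 : r != 0 by rewrite mulf_neq0 // invr_eq0.
pose s : 'S_n := tperm y.1 x.1.
pose ze i := if i == y.1 then r else if i == l then r^-1 * z ^+ s else 1.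
have ze_prod : \prod_i ze i = z ^+ s.
  rewrite (bigD1 y.1) //= (bigD1 l) //= big1 => [|i /andP[iy il]].
    by rewrite /ze eqxx (negPf yl) eqxx mulr1 mulrA divff // mul1r.
  by rewrite /ze (negPf iy) (negPf il).
have [|| g h] := realized_full hn hk hF rd gen (ze := ze) (s := s).
- move=> i; rewrite /ze; case: eqP => // _; case: eqP => // _; last exact: expr1n.
  by rewrite exprMn exprVn rm invr1 mul1r exprAC (prim_expr_order zP) expr1n.
- rewrite ze_prod; case: (boolP (odd m)) => //= em.
  by rewrite exprAC (prim_root_half zP em).
exists (gal_repr g \o j)%AF; have [ti ai] := h y.1; apply: sheet_of_uniq.
  by rewrite comp_lfunE tj ti /s tpermL.
rewrite comp_lfunE aj gal_cstM ai mulrA /s tpermL -rmorphM /ze eqxx /r.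
by rewrite mulrCA divff // mulr1.
Qed.

Lemma sheet_of_bij : bijective sheet_of.
Proof.
pose f x := projT1 (cid (sheet_of_surj x)).
have fE x : sheet_of (f x) = x by exact: projT2 (cid (sheet_of_surj x)).
by exists f => // phi; apply: sheet_of_inj.
Qed.

Lemma gal_data (g : gal_of {:N}) : exists x : {ffun 'I_n -> mu R m} * 'S_n,
  acts iota t a g (fun i => ssval (x.1 i)) x.2.
Proof. by have [ze [s h]] := gal_acts hn hk hF rd g; exists (ze, s). Qed.

Definition monodromy (g : gal_of {:N}) : {perm sheet R n} :=
  let x := projT1 (cid (gal_data g)) in sheet_perm hn x.1 x.2.

Lemma monodromyE (g : gal_of {:N}) (ze : {ffun 'I_n -> mu R m}) s :
  acts iota t a g (fun i => ssval (ze i)) s -> monodromy g = sheet_perm hn ze s.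
Proof.
move=> h; have h' := projT2 (cid (gal_data g)).
rewrite /monodromy; move: (projT1 _) h' => [ze' s'] /= h'.
have [-> e] := acts_uniq hn hk hF rd h' h.
by congr sheet_perm; apply/ffunP => i; apply: val_inj; apply: e.
Qed.

Lemma monodromyM : {in 'Gal({:N} / 1)%g &, {morph monodromy : g h / (g * h)%g}}.
Proof.
move=> g h _ _; have [[zg sg] /= ag] := gal_data g; have [[zh sh] /= ah] := gal_data h.
rewrite (monodromyE ag) (monodromyE ah).
pose zgh := [ffun i => mu_mul hn (zg i) (zh (sg i))].
have agh : acts iota t a (g * h)%g (fun i => ssval (zgh i)) (sg * sh)%g.
  by move=> i; rewrite ffunE mu_mulE; have := acts_mul ag ah i.
rewrite (monodromyE agh); apply/permP => x; rewrite permM !permE /sheet_fun /=.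
by congr (_, _); [rewrite permM | apply: val_inj; rewrite /= ffunE !mu_mulE mulrA].
Qed.

Canonical monodromy_morphism := Morphism monodromyM.

Lemma monodromy_isom : isom 'Gal({:N} / 1)%g (G R n) monodromy_morphism.
Proof.
apply: sub_isom; first exact: subxx; last first.
  apply/injmP => g h _ _ /=.
  have [[zg sg] /= ag] := gal_data g; have [[zh sh] /= ah] := gal_data h.
  rewrite (monodromyE ag) (monodromyE ah) => /(@sheet_perm_inj R n hn (_, _) (_, _))[ez es].
  subst zh sh; have ah' := acts_inv ah (fun i => mu_neq0 hn (zg i)).
  have : (g * h^-1)%g = 1%g.
    apply: (acts_faithful (t := t) (a := a) (iota := iota) gen) => i.
    have := acts_mul ag ah' i; rewrite mulgV permK => -[-> ->]; split=> //.
    by rewrite divff // (mu_neq0 hn).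
  by move/(congr1 (fun x => x * h)%g); rewrite mulgKV mul1g.
rewrite morphimEdom (G_image R hn); apply/setP => pi; apply/imsetP/imsetP.
  move=> [g _ ->]; have [[zg sg] /= ag] := gal_data g.
  exists (zg, sg); last exact: monodromyE.
  rewrite inE /sheet_cond /=; case: (boolP (odd n)) => //= on; apply/eqP.
  apply: (acts_parity hn hk hF rd) ag.
  by rewrite oddB ?(ltnW hn) // addbF.
move=> [[ze s]]; rewrite inE /sheet_cond /= => cond ->.
have [||g h] := realized_full hn hk hF rd gen (ze := fun i => ssval (ze i)) (s := s).
- by move=> i; apply: mu_exp.
- by move: cond; rewrite oddB ?(ltnW hn) // addbF.
by exists g; [apply: mem_gal1 | rewrite /= (monodromyE h)].
Qed.

End Labelled.
End Cover.

Theorem theorem1p2 (R : realType) (n : nat) (hn : (3 <= n)%N)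
  (k : nat) (hk : (k <= n - 2)%N) (c : nat -> R[i])
  (* target function field F, source function field L, pullback, normal closure N *)
  (F : fieldType) (iota : {rmorphism R[i] -> F}) (w : 'I_n -> F)
  (hF : is_function_field (target_locus k c) iota w)
  (L : fieldExtType F) (v : 'I_n -> L)
  (hL : is_function_field (source_locus k c) (in_alg L \o iota) v)
  (hK : forall i, mmap (in_alg L \o iota) v (K R i) = in_alg L (w i))
  (N : splittingFieldType F) (hN : is_normal_closure L N) :
  let m := (n - 2)%N in
  let ev := mmap (in_alg L \o iota) v in
  let tL : L := ev (xvar R n) / ev (pvar R n) in
  let aL : L := (ev (pvar R n))^-1 in
  let P := target_poly w in
  (exists t a : 'I_n -> N, root_data m P t a)
  /\ (forall t a : 'I_n -> N, root_data m P t a ->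
      exists s : 'AHom(L, N) -> sheet R n,
        [/\ bijective s,
            forall phi : 'AHom(L, N),
              phi tL = t (s phi).1
              /\ phi aL = in_alg N (iota (ssval (s phi).2)) * a (s phi).1
          & exists mon : {morphism 'Gal({:N} / 1)%g >-> {perm sheet R n}},
              (forall (g : gal_of {:N}) (phi : 'AHom(L, N)),
                 g \in 'Gal({:N} / 1)%g ->
                 s (gal_repr g \o phi)%AF = mon g (s phi))
              /\ isom 'Gal({:N} / 1)%g (G R n) mon])
  /\ #|G R n| = (m ^ n * n`! %/ gcdn 2 m)%N.
Proof.
move=> m ev tL aL P.
have tLP := source_root hn hk hF hK.
have aLP := source_deriv hn hk hF hK.
have genL := source_gen hn hk hF hL hK.
split; last split; last exact: card_G.
  by have [j _] := hN; apply: (root_data_exists hn hk hF tLP aLP j).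
move=> t a rd; exists (sheet_of hn hk hF tLP aLP rd); split.
- exact: (sheet_of_bij hn hk hF tLP aLP genL hN rd).
- by move=> phi; apply: sheet_ofP.
exists (monodromy_morphism hn hk hF rd); split.
  move=> g phi _; have [[ze s] h] := gal_data hn hk hF rd g.
  by rewrite /= (monodromyE hn hk hF rd h); apply: sheet_of_comp.
exact: (monodromy_isom hn hk hF tLP aLP genL hN rd).
Qed.
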